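(* Let $a<b$ be real numbers, let $R>0$, and let $F$ be analytic in the rectangular region $(a,b)\times(0,R)=\{x+iy\in\mathbb{C}: a<x<b,\ 0<y<R\}$. Suppose $f(x)=\lim_{y\to0^{+}}F(x+iy)$ in the space $\mathcal{D}'(a,b)$. Let $x_{0}\in(a,b)$ be such that $f(x_{0}+0)=\gamma$ $(\mathrm{L})$. If $f$ is distributionally bounded at $x=x_{0}$, then $f(x_{0})=\gamma$ $(\mathrm{L})$. Furthermore, $F(z)\to\gamma$ as $z\to x_{0}$ in an angular fashion.
   Context: The equality $f(x)=\lim_{y\to0^{+}}F(x+iy)$ in $\mathcal{D}'(a,b)$ means that $\langle f,\phi\rangle=\lim_{y\to0^{+}}\int_{a}^{b}F(x+iy)\phi(x)\,\mathrm{d}x$ for every $\phi\in\mathcal{D}(a,b)$ (the smooth functions with compact support in $(a,b)$). Here $\gamma\in\mathbb{C}$. Distributional (Łojasiewicz) point value: for $f\in\mathcal{D}'(a,b)$ and $x_0\in(a,b)$, $f(x_{0})=\gamma$ $(\mathrm{L})$ means that $$\lim_{\varepsilon\to0^{+}}\langle f(x_{0}+\varepsilon x),\phi(x)\rangle=\gamma\int_{-\infty}^{\infty}\phi(x)\,\mathrm{d}x\qquad( * )$$ for every $\phi\in\mathcal{D}(\mathbb{R})$ (the pairing is defined for all sufficiently small $\varepsilon>0$). Distributional lateral limit: $f(x_{0}+0)=\gamma$ $(\mathrm{L})$ means that $( * )$ holds for every $\phi\in\mathcal{D}(\mathbb{R})$ with (compact) support contained in $(0,\infty)$. Distributional boundedness: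 let $\partial_{x_{0}}(g)=((x-x_{0})g(x))'$ (distributional derivative). The distribution $f\in\mathcal{D}'(a,b)$ is distributionally bounded at $x=x_{0}$ if there exist $n\in\mathbb{N}$ and $f_{n}\in\mathcal{D}'(a,b)$ such that $f=\partial_{x_{0}}^{n}f_{n}$ and, for some $\varepsilon>0$, $f_{n}$ coincides on $(x_{0}-\varepsilon,x_{0}+\varepsilon)$ with the regular distribution given by a function that is continuous and bounded on $(x_{0}-\varepsilon,x_{0})\cup(x_{0},x_{0}+\varepsilon)$. ''$F(z)\to\gamma$ as $z\to x_{0}$ in an angular fashion'' means: for every $\theta\in(0,\pi/2)$, $F(z)\to\gamma$ as $z\to x_{0}$ with $z$ restricted to the sector $\theta\le\arg(z-x_{0})\le\pi-\theta$. *)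

(* Defs.v *)
From Stdlib Require Export Reals Rtopology.
From Coquelicot Require Export Coquelicot.
Open Scope R_scope.

Definition Ioo (a b : R) : R -> Prop := fun x => a < x < b.

Definition smooth (phi : R -> C) : Prop :=
  forall (k : nat) (x : R),
    ex_derive_n (fun t => Re (phi t)) k x /\
    ex_derive_n (fun t => Im (phi t)) k x.

Definition CDerive_n (phi : R -> C) (k : nat) : R -> C :=
  fun x => (Derive_n (fun t => Re (phi t)) k x,
            Derive_n (fun t => Im (phi t)) k x).

Definition support (phi : R -> C) : R -> Prop :=
  adherence (fun x => phi x <> 0%C).

Definition test_function (U : R -> Prop) (phi : R -> C) : Prop :=
  smooth phi /\ compact (support phi) /\ included (support phi) U.

(* A distribution is a total functional on [R -> C] of which only the values
   on test functions are meaningful; equality in D'(U) is [distr_eq U]. *)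
Definition functional := (R -> C) -> C.

(* [M] bounds the derivatives of order at most [N] uniformly, so the estimate
   is the usual |T phi| <= c * max_(k <= N) sup |phi^(k)| on each compact. *)
Definition distribution (U : R -> Prop) (T : functional) : Prop :=
  (forall (c : C) (phi psi : R -> C),
     test_function U phi -> test_function U psi ->
     T (fun x => c * phi x + psi x)%C = (c * T phi + T psi)%C) /\
  (forall K : R -> Prop, compact K -> included K U ->
     exists (c : R) (N : nat), forall phi : R -> C,
       test_function U phi -> included (support phi) K ->
       forall M : R,
         (forall (k : nat) (x : R), (k <= N)%nat -> Cmod (CDerive_n phi k x) <= M) ->
         Cmod (T phi) <= c * M).

Definition distr_eq (U : R -> Prop) (S T : functional) : Prop :=
  forall phi : R -> C, test_function U phi -> S phi = T phi.

Definition distr_mul (h : R -> C) (T : functional) : functional :=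
  fun phi => T (fun x => h x * phi x)%C.

Definition distr_derive (T : functional) : functional :=
  fun phi => (- T (CDerive_n phi 1))%C.

Definition distr_partial (x0 : R) (T : functional) : functional :=
  distr_derive (distr_mul (fun x => RtoC (x - x0)) T).

Definition regular_on (c d : R) (g : R -> C) : functional :=
  fun phi => RInt (V := C_R_CompleteNormedModule) (fun x => g x * phi x)%C c d.

(* <f(x0 + eps x), phi(x)>, by the change of variables t = x0 + eps x. *)
Definition dilate_pairing (f : functional) (x0 eps : R) (phi : R -> C) : C :=
  (RtoC (/ eps) * f (fun t => phi ((t - x0) / eps)%R))%C.

Definition total_integral (phi : R -> C) : C :=
  RInt_gen (V := C_R_CompleteNormedModule) phi
    (Rbar_locally m_infty) (Rbar_locally p_infty).

Definition dilation_limit (f : functional) (x0 : R) (gamma : C) (phi : R -> C) : Prop :=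
  filterlim (fun eps : R => dilate_pairing f x0 eps phi) (at_right 0)
    (locally (gamma * total_integral phi)%C).

Definition point_value (f : functional) (x0 : R) (gamma : C) : Prop :=
  forall phi : R -> C,
    test_function (fun _ => True) phi -> dilation_limit f x0 gamma phi.

Definition right_limit (f : functional) (x0 : R) (gamma : C) : Prop :=
  forall phi : R -> C,
    test_function (fun x => 0 < x) phi -> dilation_limit f x0 gamma phi.

Definition distr_bounded_at (a b : R) (f : functional) (x0 : R) : Prop :=
  exists (n : nat) (fn : functional),
    distribution (Ioo a b) fn /\
    distr_eq (Ioo a b) f (Nat.iter n (distr_partial x0) fn) /\
    exists (eps : R) (g : R -> C),
      0 < eps /\ a <= x0 - eps /\ x0 + eps <= b /\
      (forall x : R, Ioo (x0 - eps) (x0 + eps) x -> x <> x0 ->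
         continuous (T := R_UniformSpace) (U := C_UniformSpace) g x) /\
      (exists M : R, forall x : R,
         Ioo (x0 - eps) (x0 + eps) x -> x <> x0 -> Cmod (g x) <= M) /\
      distr_eq (Ioo (x0 - eps) (x0 + eps)) fn
        (regular_on (x0 - eps) (x0 + eps) g).

Definition analytic_on_rectangle (a b h : R) (F : C -> C) : Prop :=
  forall x y : R, a < x < b -> 0 < y < h ->
    ex_derive (K := C_AbsRing) (V := C_NormedModule) F (x, y).

Definition boundary_value (a b : R) (F : C -> C) (f : functional) : Prop :=
  forall phi : R -> C, test_function (Ioo a b) phi ->
    filterlim (fun y : R => regular_on a b (fun x => F (x, y)) phi) (at_right 0)
      (locally (f phi)).

(* The points z <> x0 having an argument of z - x0 in [theta, PI - theta]. *)
Definition sector (theta x0 : R) (z : C) : Prop :=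
  exists r t : R,
    0 < r /\ theta <= t <= PI - theta /\ z = (x0 + r * cos t, r * sin t).

Definition angular_limit (F : C -> C) (x0 : R) (gamma : C) : Prop :=
  forall theta : R, 0 < theta < PI / 2 ->
    filterlim F (within (sector theta x0) (locally (RtoC x0))) (locally gamma).

(* Main.v *)
Require Import Defs.
From Stdlib Require Import Lra Lia Classical FunctionalExtensionality ClassicalEpsilon.

(** Subtracting [gamma] from [F], and [gamma] times the integral from [f], one may
    take [gamma = 0]. The proof recovers [F] near [x0] from [f] by a Cauchy
    integral, and exploits the freedom in the choice of the Cauchy kernel.

    Let [p] be a point of the upper unit half-circle and [X = (x - x0) / rho]. The
    kernel [H(X)] is a constant times
      [X / (X + i) ^ 2 * (X + i del) ^ (i lam) * 1 / (X - p)],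
    normalised to have residue [1] at [p], so that
      [f (H ((x - x0) / rho)) = 2 pi i rho F(x0 + rho p) + O(rho ^ 2)]
    ([boundary_cauchy_formula]). For the functions [F(. + i s)], which are
    holomorphic across the real axis, this is Cauchy's theorem on a smoothly cut
    off strip ([goursat], [dC_pairing]) together with the jump of a pairing across
    a simple pole ([pole_jump]). When [s -> 0] the pairing with [H] tends to [f],
    by the hypothesis on the boundary value, while the contributions from far
    away stay bounded: a family of functionals that converges on every test
    function is bounded in some [C^N]-norm ([uniform_boundedness]).

    Distributional boundedness says that [f] is the [n]-th image of a bounded
    function under [((x - x0) .)']. Hence [f (phi)] is at most a constant times the
    integral of a bound for the iterated derivatives of [phi] under
    [(x - x0) d/dx], for test functions [phi] that vanish at [x0]. These
    derivatives are invariant under dilations about [x0], so the estimates are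
    uniform in [rho]. All factors of [H] satisfy Riccati or linear equations,
    which bounds their iterated derivatives by the functions themselves
    ([kernel_axis_bound]).

    Two conclusions follow. For [lam = 0] the values [F(x0 + rho p)] are at most
    a constant times a power of [1 / Im p] ([angular_growth]). For large [lam]
    the modulus [exp (- lam * arg)] of the power makes [H] exponentially small
    on the negative axis, compared with its residue, against a polynomial loss
    in the derivatives; the neighbourhoods of [0] and of infinity contribute
    little because of their size; and on the remaining compact part of the
    positive axis the lateral limit applies. As [H] depends on [p] in a Lipschitz
    way, all this is uniform in sectors ([angular_limit_unit]). It is a
    two-constants argument in which the power plays the role of the harmonic
    measure of the negative axis.

    For the point value, consider the integral of [F(x0 + eps (x + i s)) phi(x)]
    as a function of [s]; its derivatives fall on [phi]. Expand it at height [y]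
    to an order beyond the growth of [F] at the axis. The remainder is then
    [O(y)] down to [s = 0], uniformly in [eps], and the Taylor polynomial tends
    to zero with [eps] because the points at height [y] lie in a sector
    ([point_value_zero]). *)

(** * Complex-valued functions of real and complex variables *)

(** [C] carries the product topology of the plane, so a function of two real
    variables is treated as a function on [C] throughout. *)
Notation ccont := (continuous (U := C_UniformSpace)).
Definition CInt (f : R -> C) (a b : R) : C :=
  RInt (V := C_R_CompleteNormedModule) f a b.
Notation ex_CInt := (ex_RInt (V := C_R_NormedModule)).
Definition dC (f : R -> C) (x : R) (l : C) : Prop :=
  is_derive (K := R_AbsRing) (V := C_R_NormedModule) f x l.

Lemma norm_C_R (z : C) : @norm R_AbsRing C_R_NormedModule z = Cmod z.
Proof.
  unfold norm; simpl; unfold prod_norm.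
  rewrite !pow2_abs || (simpl; unfold norm; simpl; unfold abs; simpl).
  reflexivity.
Qed.

Lemma fst_le_Cmod (z : C) : Rabs (fst z) <= Cmod z.
Proof. eapply Rle_trans; [apply Rmax_l | apply Rmax_Cmod]. Qed.

Lemma snd_le_Cmod (z : C) : Rabs (snd z) <= Cmod z.
Proof. eapply Rle_trans; [apply Rmax_r | apply Rmax_Cmod]. Qed.

Lemma Cmod_le_sum (z : C) : Cmod z <= Rabs (fst z) + Rabs (snd z).
Proof.
  destruct z as [x y]; simpl.
  replace ((x, y) : C) with ((RtoC x) + Ci * RtoC y)%C
    by (apply injective_projections; simpl; ring).
  eapply Rle_trans; [apply Cmod_triangle|].
  rewrite Cmod_mult, Cmod_Ci, !Cmod_R; lra.
Qed.

Lemma Cmod_minus_sym (z w : C) : Cmod (z - w) = Cmod (w - z).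
Proof. rewrite <- Cmod_opp; f_equal; ring. Qed.

Lemma Cmod_triangle_minus (z w : C) : Cmod (z - w) <= Cmod z + Cmod w.
Proof.
  unfold Cminus; eapply Rle_trans; [apply Cmod_triangle|]; rewrite Cmod_opp; lra.
Qed.

Lemma Cmod_triangle_rev (z w : C) : Cmod z - Cmod w <= Cmod (z - w).
Proof.
  replace z with ((z - w) + w)%C at 1 by ring.
  pose proof (Cmod_triangle (z - w) w); lra.
Qed.

Lemma Cmod_neq_0 (z : C) : 0 < Cmod z -> z <> 0%C.
Proof. intros H E; rewrite E, Cmod_0 in H; lra. Qed.

Section Continuity.
Context {T : UniformSpace}.
Implicit Types (f g : T -> C).

Lemma ccont_iff f (x : T) :
  ccont f x <-> (forall eps, 0 < eps -> locally x (fun y => Cmod (f y - f x) < eps)).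
Proof.
  split.
  - intros H eps He.
    pose (e2 := mkposreal (eps / 2) ltac:(lra)).
    assert (H1 := proj1 (filterlim_locally _ _) H e2).
    revert H1; apply filter_imp; intros y [H1 H2].
    eapply Rle_lt_trans; [apply Cmod_le_sum|].
    unfold ball, minus in H1, H2; simpl in *.
    unfold AbsRing_ball, abs, minus, plus, opp in H1, H2; simpl in *.
    unfold Rminus in *. lra.
  - intros H; apply filterlim_locally; intros eps.
    generalize (H eps (cond_pos eps)); apply filter_imp; intros y Hy.
    split; unfold ball; simpl; unfold AbsRing_ball, abs, minus, plus, opp; simpl.
    + eapply Rle_lt_trans; [apply (fst_le_Cmod (f y - f x)%C)|exact Hy].
    + eapply Rle_lt_trans; [apply (snd_le_Cmod (f y - f x)%C)|exact Hy].
Qed.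

Lemma ccont_fst f x : ccont f x -> continuous (fun t => fst (f t)) x.
Proof.
  intros H; apply (continuous_comp f (fun z : C => fst z)); [exact H|].
  destruct (f x); apply continuous_fst.
Qed.

Lemma ccont_snd f x : ccont f x -> continuous (fun t => snd (f t)) x.
Proof.
  intros H; apply (continuous_comp f (fun z : C => snd z)); [exact H|].
  destruct (f x); apply continuous_snd.
Qed.

Lemma ccont_pair f x :
  continuous (fun t => fst (f t)) x -> continuous (fun t => snd (f t)) x ->
  ccont f x.
Proof.
  intros H1 H2; apply filterlim_locally; intros eps.
  apply (filter_and _ _ (proj1 (filterlim_locally _ _) H1 eps)
           (proj1 (filterlim_locally _ _) H2 eps)).
Qed.

Lemma ccont_const (c : C) x : ccont (fun _ : T => c) x.
Proof. apply continuous_const. Qed.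

Lemma ccont_plus f g x :
  ccont f x -> ccont g x -> ccont (fun t => f t + g t)%C x.
Proof. exact (continuous_plus (V := C_R_NormedModule) f g x). Qed.

Lemma ccont_opp f x : ccont f x -> ccont (fun t => - f t)%C x.
Proof. exact (continuous_opp (V := C_R_NormedModule) f x). Qed.

Lemma ccont_minus f g x :
  ccont f x -> ccont g x -> ccont (fun t => f t - g t)%C x.
Proof. exact (continuous_minus (V := C_R_NormedModule) f g x). Qed.

Lemma ccont_mult f g x :
  ccont f x -> ccont g x -> ccont (fun t => f t * g t)%C x.
Proof.
  intros Hf Hg.
  pose proof (ccont_fst _ _ Hf) as f1; pose proof (ccont_snd _ _ Hf) as f2.
  pose proof (ccont_fst _ _ Hg) as g1; pose proof (ccont_snd _ _ Hg) as g2.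
  apply ccont_pair; simpl.
  - apply (continuous_minus (V := R_NormedModule));
      apply (continuous_mult (K := R_AbsRing)); assumption.
  - apply (continuous_plus (V := R_NormedModule));
      apply (continuous_mult (K := R_AbsRing)); assumption.
Qed.

Lemma ccont_RtoC (u : T -> R) x : continuous u x -> ccont (fun t => RtoC (u t)) x.
Proof. intros H; apply ccont_pair; simpl; [exact H|apply continuous_const]. Qed.

Lemma ccont_inv f x : ccont f x -> f x <> 0%C -> ccont (fun t => / f t)%C x.
Proof.
  intros Hf H0; rewrite ccont_iff in *; intros eps He.
  assert (Hm : 0 < Cmod (f x)) by (apply Cmod_gt_0; exact H0).
  assert (H1 : 0 < Rmin (Cmod (f x) / 2) (eps * (Cmod (f x) * Cmod (f x)) / 2)).
  { apply Rmin_glb_lt; [lra|]. apply Rdiv_lt_0_compat; [|lra].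
    apply Rmult_lt_0_compat; [lra|apply Rmult_lt_0_compat; lra]. }
  generalize (Hf _ H1); apply filter_imp; intros y Hy.
  pose proof (Rmin_l (Cmod (f x) / 2) (eps * (Cmod (f x) * Cmod (f x)) / 2)).
  pose proof (Rmin_r (Cmod (f x) / 2) (eps * (Cmod (f x) * Cmod (f x)) / 2)).
  pose proof (Cmod_triangle_rev (f x) (f x - f y)) as H3.
  replace (f x - (f x - f y))%C with (f y) in H3 by ring.
  rewrite Cmod_minus_sym in Hy.
  assert (Hy0 : f y <> 0%C) by (apply Cmod_neq_0; lra).
  replace (/ f y - / f x)%C with ((f x - f y) / (f y * f x))%C
    by (field; split; assumption).
  rewrite Cmod_div, Cmod_mult by (apply Cmult_neq_0; assumption).
  assert (Hp : 0 < Cmod (f y) * Cmod (f x)) by (apply Rmult_lt_0_compat; lra).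
  apply Rmult_lt_reg_r with (Cmod (f y) * Cmod (f x)); [exact Hp|].
  unfold Rdiv; rewrite Rmult_assoc, Rinv_l, Rmult_1_r by lra.
  assert (eps * (Cmod (f x) * Cmod (f x)) / 2 <= eps * (Cmod (f y) * Cmod (f x))).
  { replace (eps * (Cmod (f x) * Cmod (f x)) / 2)
      with (eps * (Cmod (f x) / 2 * Cmod (f x))) by field.
    apply Rmult_le_compat_l; [lra|]; apply Rmult_le_compat_r; lra. }
  lra.
Qed.

Lemma ccont_comp_ext f g x :
  locally x (fun t => f t = g t) -> ccont f x -> ccont g x.
Proof. intros E; apply continuous_ext_loc; revert E; apply filter_imp; auto. Qed.

End Continuity.

Lemma ccont_horizontal (G : C -> C) (x y : R) :
  ccont G (x, y) -> ccont (fun t : R => G (t, y)) x.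
Proof.
  intros H; apply (continuous_comp (fun t : R => (t, y) : C) G); [|exact H].
  apply ccont_pair; simpl; [apply continuous_id | apply continuous_const].
Qed.

Lemma ccont_vertical (G : C -> C) (x y : R) :
  ccont G (x, y) -> ccont (fun t : R => G (x, t)) y.
Proof.
  intros H; apply (continuous_comp (fun t : R => (x, t) : C) G); [|exact H].
  apply ccont_pair; simpl; [apply continuous_const | apply continuous_id].
Qed.

Lemma locally_Cmod (z : C) (P : C -> Prop) :
  locally (T := C_UniformSpace) z P <->
  exists d, 0 < d /\ forall w, Cmod (w - z) < d -> P w.
Proof.
  split.
  - intros [d Hd]; exists d; split; [apply cond_pos|]; intros w Hw; apply Hd.
    split; unfold ball; simpl; unfold AbsRing_ball, abs, minus, plus, opp; simpl.
    + eapply Rle_lt_trans; [apply (fst_le_Cmod (w - z)%C)|exact Hw].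
    + eapply Rle_lt_trans; [apply (snd_le_Cmod (w - z)%C)|exact Hw].
  - intros [d [Hd HP]]; exists (mkposreal (d / 2) ltac:(lra)); intros w [H1 H2].
    apply HP; eapply Rle_lt_trans; [apply Cmod_le_sum|].
    unfold ball in H1, H2; simpl in *.
    unfold AbsRing_ball, abs, minus, plus, opp in H1, H2; simpl in *.
    unfold Rminus in *. lra.
Qed.

Lemma locally_R (x : R) (P : R -> Prop) :
  locally x P <-> exists d, 0 < d /\ forall y, Rabs (y - x) < d -> P y.
Proof.
  split.
  - intros [d Hd]; exists d; split; [apply cond_pos|]; intros y Hy; apply Hd, Hy.
  - intros [d [Hd HP]]; exists (mkposreal d Hd); intros y Hy; apply HP, Hy.
Qed.

Lemma continuous_Cmod {T : UniformSpace} (f : T -> C) (x : T) :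
  ccont f x -> continuous (fun t => Cmod (f t)) x.
Proof.
  intros H; apply (continuous_ext (fun t => norm (V := C_R_NormedModule) (f t)));
    [intros; apply norm_C_R|].
  apply (continuous_comp f); [exact H|apply (filterlim_norm (V := C_R_NormedModule))].
Qed.

Lemma locally_off_interval (c d x : R) :
  ~ (c <= x <= d) -> locally x (fun y => ~ (c <= y <= d)).
Proof.
  intros Hx; apply locally_R; destruct (Rlt_or_le x c) as [H|H].
  - exists (c - x); split; [lra|]; intros y Hy; apply Rabs_def2 in Hy; lra.
  - assert (d < x) by (apply Rnot_le_lt; intros Q; apply Hx; lra).
    exists (x - d); split; [lra|]; intros y Hy; apply Rabs_def2 in Hy; lra.
Qed.

Lemma unit_circle_mod (t : R) : Cmod (cos t, sin t) = 1.
Proof.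
  unfold Cmod; simpl.
  replace (cos t * (cos t * 1) + sin t * (sin t * 1)) with 1; [apply sqrt_1|].
  pose proof (sin2_cos2 t) as Q; unfold Rsqr in Q; lra.
Qed.

Lemma pow_fact_le_exp (x : R) (k : nat) :
  0 <= x -> x ^ k / INR (Factorial.fact k) <= exp x.
Proof.
  intros Hx; eapply Rle_trans; [|apply (exp_ge_taylor x k Hx)].
  assert (G : forall i, 0 <= x ^ i / INR (Factorial.fact i)).
  { intros i; apply Rmult_le_pos; [apply pow_le, Hx|].
    left; apply Rinv_0_lt_compat, INR_fact_lt_0. }
  destruct k as [|k]; [apply Rle_refl|]; rewrite tech5.
  pose proof (cond_pos_sum _ k G); lra.
Qed.

(** * Integrals *)

Lemma ex_CInt_cont (f : R -> C) (a b : R) :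
  (forall x, Rmin a b <= x <= Rmax a b -> ccont f x) -> ex_CInt f a b.
Proof. exact (ex_RInt_continuous (V := C_R_CompleteNormedModule) f a b). Qed.

Lemma CInt_components (f : R -> C) a b :
  ex_CInt f a b ->
  CInt f a b = (RInt (fun t => fst (f t)) a b, RInt (fun t => snd (f t)) a b).
Proof.
  intros H; symmetry.
  apply (RInt_fct_extend_pair (U := R_NormedModule) (V := R_NormedModule)
    (fun g u v => RInt (V := R_CompleteNormedModule) g u v)
    (fun g u v => RInt (V := R_CompleteNormedModule) g u v)).
  - intros; apply is_RInt_unique; assumption.
  - intros; apply is_RInt_unique; assumption.
  - apply (RInt_correct (V := C_R_CompleteNormedModule)), H.
Qed.

Lemma ex_CInt_fst (f : R -> C) a b :
  ex_CInt f a b -> ex_RInt (fun t => fst (f t)) a b.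
Proof.
  intros [l H]; exists (fst l).
  apply (is_RInt_fct_extend_fst (U := R_NormedModule) (V := R_NormedModule)), H.
Qed.

Lemma ex_CInt_snd (f : R -> C) a b :
  ex_CInt f a b -> ex_RInt (fun t => snd (f t)) a b.
Proof.
  intros [l H]; exists (snd l).
  apply (is_RInt_fct_extend_snd (U := R_NormedModule) (V := R_NormedModule)), H.
Qed.

Lemma ex_CInt_pair (f : R -> C) a b :
  ex_RInt (fun t => fst (f t)) a b -> ex_RInt (fun t => snd (f t)) a b ->
  ex_CInt f a b.
Proof.
  intros [l1 H1] [l2 H2]; exists (l1, l2).
  apply (is_RInt_fct_extend_pair (U := R_NormedModule) (V := R_NormedModule));
    assumption.
Qed.

Lemma CInt_ext (f g : R -> C) a b :
  (forall x, Rmin a b < x < Rmax a b -> f x = g x) -> CInt f a b = CInt g a b.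
Proof. exact (RInt_ext (V := C_R_CompleteNormedModule) f g a b). Qed.

Lemma CInt_scal (c : C) (f : R -> C) a b :
  ex_CInt f a b ->
  ex_CInt (fun t => c * f t)%C a b /\
  CInt (fun t => c * f t)%C a b = (c * CInt f a b)%C.
Proof.
  intros H.
  pose proof (ex_CInt_fst _ _ _ H) as H1; pose proof (ex_CInt_snd _ _ _ H) as H2.
  assert (E1 : forall k, ex_RInt (fun t => k * fst (f t)) a b)
    by (intro k; apply (ex_RInt_scal (V := R_NormedModule)); exact H1).
  assert (E2 : forall k, ex_RInt (fun t => k * snd (f t)) a b)
    by (intro k; apply (ex_RInt_scal (V := R_NormedModule)); exact H2).
  assert (S1 : forall k, RInt (fun t => k * fst (f t)) a b = k * RInt (fun t => fst (f t)) a b)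
    by (intro k; apply (RInt_scal (V := R_CompleteNormedModule)); exact H1).
  assert (S2 : forall k, RInt (fun t => k * snd (f t)) a b = k * RInt (fun t => snd (f t)) a b)
    by (intro k; apply (RInt_scal (V := R_CompleteNormedModule)); exact H2).
  assert (E : ex_CInt (fun t => c * f t)%C a b).
  { apply ex_CInt_pair; simpl.
    - apply (ex_RInt_minus (V := R_NormedModule)); auto.
    - apply (ex_RInt_plus (V := R_NormedModule)); auto. }
  split; [exact E|].
  rewrite (CInt_components _ _ _ E), (CInt_components _ _ _ H).
  apply injective_projections; simpl; rewrite <- S1, <- S2.
  - apply (RInt_minus (V := R_CompleteNormedModule)); auto.
  - apply (RInt_plus (V := R_CompleteNormedModule)); auto.
Qed.

Lemma CInt_plus (f g : R -> C) a b :
  ex_CInt f a b -> ex_CInt g a b ->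
  CInt (fun t => f t + g t)%C a b = (CInt f a b + CInt g a b)%C.
Proof. exact (RInt_plus (V := C_R_CompleteNormedModule) f g a b). Qed.

Lemma CInt_minus (f g : R -> C) a b :
  ex_CInt f a b -> ex_CInt g a b ->
  CInt (fun t => f t - g t)%C a b = (CInt f a b - CInt g a b)%C.
Proof. exact (RInt_minus (V := C_R_CompleteNormedModule) f g a b). Qed.

Lemma CInt_Chasles (f : R -> C) a b c :
  ex_CInt f a b -> ex_CInt f b c ->
  (CInt f a b + CInt f b c)%C = CInt f a c.
Proof. exact (RInt_Chasles (V := C_R_CompleteNormedModule) f a b c). Qed.

Lemma CInt_norm_le (f : R -> C) (g : R -> R) a b :
  a <= b -> (forall x, a <= x <= b -> Cmod (f x) <= g x) ->
  ex_CInt f a b -> ex_RInt g a b ->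
  Cmod (CInt f a b) <= RInt g a b.
Proof.
  intros Hab H Hf Hg; rewrite <- norm_C_R.
  apply (norm_RInt_le (V := C_R_NormedModule) f g a b); auto.
  - intros x Hx; rewrite norm_C_R; auto.
  - apply (RInt_correct (V := C_R_CompleteNormedModule)), Hf.
  - apply (RInt_correct (V := R_CompleteNormedModule)), Hg.
Qed.

Lemma CInt_norm_const (f : R -> C) (M : R) a b :
  a <= b -> (forall x, a <= x <= b -> Cmod (f x) <= M) ->
  ex_CInt f a b -> Cmod (CInt f a b) <= (b - a) * M.
Proof.
  intros Hab H Hf.
  eapply Rle_trans; [apply (CInt_norm_le f (fun _ => M)); auto|].
  - apply ex_RInt_const.
  - rewrite (RInt_const a b M); right; reflexivity.
Qed.

(** * Derivatives along the real line *)

Lemma dC_fst (f : R -> C) x l : dC f x l -> is_derive (fun t => fst (f t)) x (fst l).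
Proof.
  intros H.
  apply (filterdiff_comp' (K := R_AbsRing) (V := C_R_NormedModule) f
    (fun z : C_R_NormedModule => fst z) x _ (fun z => fst z) H).
  apply filterdiff_linear; apply is_linear_fst.
Qed.

Lemma dC_snd (f : R -> C) x l : dC f x l -> is_derive (fun t => snd (f t)) x (snd l).
Proof.
  intros H.
  apply (filterdiff_comp' (K := R_AbsRing) (V := C_R_NormedModule) f
    (fun z : C_R_NormedModule => snd z) x _ (fun z => snd z) H).
  apply filterdiff_linear; apply is_linear_snd.
Qed.

Lemma dC_pair (f : R -> C) x l :
  is_derive (fun t => fst (f t)) x (fst l) ->
  is_derive (fun t => snd (f t)) x (snd l) -> dC f x l.
Proof.
  intros H1 H2.
  apply (filterdiff_ext (fun t => (fst (f t), snd (f t)) : C_R_NormedModule));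
    [intros t; symmetry; apply surjective_pairing|].
  apply (filterdiff_comp'_2 (K := R_AbsRing) (U := R_NormedModule)
    (V := R_NormedModule) (W := C_R_NormedModule)
    (fun t => fst (f t)) (fun t => snd (f t))
    (fun u v => (u, v) : C_R_NormedModule) x
    (fun y => scal y (fst l)) (fun y => scal y (snd l)) (fun u v => (u, v)) H1 H2).
  apply (filterdiff_ext (fun t => t)); [intros [u v]; reflexivity|].
  apply (filterdiff_ext_lin _ (fun t => t)); [apply filterdiff_id|].
  intros [u v]; reflexivity.
Qed.

Lemma dC_eq (f : R -> C) x (l l' : C) : dC f x l -> l = l' -> dC f x l'.
Proof. intros H <-; exact H. Qed.

Lemma dC_cont (f : R -> C) x l : dC f x l -> ccont f x.
Proof.
  intros H; apply (ex_derive_continuous (K := R_AbsRing) (V := C_R_NormedModule)).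
  exists l; exact H.
Qed.

Lemma dC_const (c : C) x : dC (fun _ => c) x 0%C.
Proof. apply (is_derive_const (K := R_AbsRing) (V := C_R_NormedModule)). Qed.

Lemma dC_plus (f g : R -> C) x l m :
  dC f x l -> dC g x m -> dC (fun t => f t + g t)%C x (l + m)%C.
Proof. exact (is_derive_plus (K := R_AbsRing) (V := C_R_NormedModule) f g x l m). Qed.

Lemma dC_minus (f g : R -> C) x l m :
  dC f x l -> dC g x m -> dC (fun t => f t - g t)%C x (l - m)%C.
Proof. exact (is_derive_minus (K := R_AbsRing) (V := C_R_NormedModule) f g x l m). Qed.

Lemma dC_opp (f : R -> C) x l : dC f x l -> dC (fun t => - f t)%C x (- l)%C.
Proof. exact (is_derive_opp (K := R_AbsRing) (V := C_R_NormedModule) f x l). Qed.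

Lemma is_derive_eq (f : R -> R) (x l l' : R) : is_derive f x l -> l = l' -> is_derive f x l'.
Proof. intros H <-; exact H. Qed.

Lemma dC_mult (f g : R -> C) x l m :
  dC f x l -> dC g x m -> dC (fun t => f t * g t)%C x (l * g x + f x * m)%C.
Proof.
  intros Hf Hg.
  pose proof (dC_fst _ _ _ Hf) as f1; pose proof (dC_snd _ _ _ Hf) as f2.
  pose proof (dC_fst _ _ _ Hg) as g1; pose proof (dC_snd _ _ _ Hg) as g2.
  apply dC_pair; simpl.
  - eapply is_derive_eq.
    + apply (is_derive_minus (V := R_NormedModule));
        apply (is_derive_mult (K := R_AbsRing)); try eassumption; intros; apply Rmult_comm.
    + unfold minus, plus, opp, mult; simpl. ring.
  - eapply is_derive_eq.
    + apply (is_derive_plus (V := R_NormedModule));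
        apply (is_derive_mult (K := R_AbsRing)); try eassumption; intros; apply Rmult_comm.
    + unfold minus, plus, opp, mult; simpl; ring.
Qed.

Lemma dC_scal (c : C) (f : R -> C) x l :
  dC f x l -> dC (fun t => c * f t)%C x (c * l)%C.
Proof.
  intros H; eapply dC_eq; [apply dC_mult; [apply dC_const|exact H]|]; cbv beta; ring.
Qed.

Lemma dC_RtoC (u : R -> R) x l : is_derive u x l -> dC (fun t => RtoC (u t)) x (RtoC l).
Proof.
  intros H; apply dC_pair; simpl; [exact H|].
  apply (is_derive_const (K := R_AbsRing) (V := R_NormedModule)).
Qed.

Lemma dC_comp (f : R -> C) (g : R -> R) x l k :
  dC f (g x) l -> is_derive g x k -> dC (fun t => f (g t)) x (RtoC k * l)%C.
Proof.
  intros Hf Hg; eapply dC_eq;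
    [apply (is_derive_comp (K := R_AbsRing) (V := C_R_NormedModule)); eassumption|].
  apply injective_projections; unfold scal; simpl; unfold prod_scal, scal; simpl;
    unfold mult; simpl; ring.
Qed.

Lemma dC_ext_loc (f g : R -> C) x l :
  locally x (fun t => f t = g t) -> dC f x l -> dC g x l.
Proof. apply (is_derive_ext_loc (K := R_AbsRing) (V := C_R_NormedModule)). Qed.

Lemma dC_unique (f : R -> C) x l m : dC f x l -> dC f x m -> l = m.
Proof.
  intros H1 H2; apply injective_projections.
  - rewrite <- (is_derive_unique _ _ _ (dC_fst _ _ _ H1)).
    apply is_derive_unique, dC_fst, H2.
  - rewrite <- (is_derive_unique _ _ _ (dC_snd _ _ _ H1)).
    apply is_derive_unique, dC_snd, H2.
Qed.

Lemma CInt_derive (f f' : R -> C) a b :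
  (forall x, Rmin a b <= x <= Rmax a b -> dC f x (f' x)) ->
  (forall x, Rmin a b <= x <= Rmax a b -> ccont f' x) ->
  CInt f' a b = (f b - f a)%C.
Proof.
  intros H1 H2.
  apply (is_RInt_unique (V := C_R_CompleteNormedModule)).
  apply (is_RInt_derive (V := C_R_CompleteNormedModule)); assumption.
Qed.

(** The mean value theorem is applied to the real function
    [Re (conj (f b - f a) * f)]. *)
Lemma dC_mean_value (f f' : R -> C) (M a b : R) :
  a <= b -> (forall x, a <= x <= b -> dC f x (f' x)) ->
  (forall x, a <= x <= b -> Cmod (f' x) <= M) ->
  Cmod (f b - f a) <= M * (b - a).
Proof.
  intros Hab Hd HM.
  set (u := (f b - f a)%C).
  set (phi := fun t => fst (Cconj u * f t)%C).
  destruct (Req_dec a b) as [->|Hne].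
  { unfold u; replace (f b - f b)%C with (RtoC 0) by ring; rewrite Cmod_0; lra. }
  destruct (MVT_gen phi a b (fun t => fst (Cconj u * f' t)%C)) as [c [Hc E]].
  - intros x Hx; rewrite Rmin_left, Rmax_right in Hx by lra.
    apply dC_fst, dC_scal, Hd; lra.
  - intros x Hx; rewrite Rmin_left, Rmax_right in Hx by lra.
    apply continuity_pt_filterlim.
    apply (ccont_fst (fun t => Cconj u * f t)%C).
    eapply dC_cont; apply dC_scal, Hd; lra.
  - rewrite Rmin_left, Rmax_right in Hc by lra.
    assert (E2 : phi b - phi a = Cmod u * Cmod u).
    { transitivity (Cmod u ^ 2); [|simpl; ring].
      rewrite Cmod2_alt; unfold phi, u, Re, Im; simpl; ring. }
    assert (fst (Cconj u * f' c)%C <= Cmod u * M).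
    { eapply Rle_trans; [apply Rle_abs|]. eapply Rle_trans; [apply fst_le_Cmod|].
      rewrite Cmod_mult, Cmod_conj; apply Rmult_le_compat_l; [apply Cmod_ge_0|].
      apply HM; lra. }
    assert (Cmod u * Cmod u <= Cmod u * (M * (b - a))).
    { rewrite <- E2, E; fold phi.
      replace (Cmod u * (M * (b - a))) with ((Cmod u * M) * (b - a)) by ring.
      apply Rmult_le_compat_r; lra. }
    destruct (Cmod_ge_0 u) as [Hu|Hu].
    + apply Rmult_le_reg_l with (Cmod u); auto.
    + rewrite <- Hu.
      assert (0 <= M) by (eapply Rle_trans; [apply Cmod_ge_0|apply (HM a); lra]).
      nra.
Qed.

(** * Complex derivatives *)

Definition Cder (G : C -> C) (z l : C) : Prop :=
  is_derive (K := C_AbsRing) (V := C_NormedModule) G z l.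

Lemma Cder_iff (G : C -> C) (z l : C) :
  Cder G z l <->
  (forall eps, 0 < eps -> exists d, 0 < d /\ forall w, Cmod (w - z) < d ->
     Cmod (G w - G z - l * (w - z)) <= eps * Cmod (w - z)).
Proof.
  split.
  - intros [_ H] eps He.
    specialize (H z (fun P HP => HP) (mkposreal eps He)).
    destruct H as [d Hd]; exists d; split; [apply cond_pos|]; intros w Hw.
    specialize (Hd w Hw).
    replace (l * (w - z))%C with ((w - z) * l)%C by ring. exact Hd.
  - intros H; split; [apply is_linear_scal_l|].
    intros z' Hz.
    assert (z = z') as <- by
      (apply (is_filter_lim_locally_unique (V := AbsRing_NormedModule C_AbsRing)); exact Hz).
    intros eps; destruct (H eps (cond_pos eps)) as [d [Hd HP]].
    exists (mkposreal d Hd); intros w Hw.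
    specialize (HP w Hw). replace (l * (w - z))%C with ((w - z) * l)%C in HP by ring.
    exact HP.
Qed.

Lemma dC_eps (f : R -> C) (x : R) (l : C) :
  (forall eps, 0 < eps -> exists d, 0 < d /\ forall y, Rabs (y - x) < d ->
     Cmod (f y - f x - RtoC (y - x) * l) <= eps * Rabs (y - x)) -> dC f x l.
Proof.
  intros H; split; [apply is_linear_scal_l|].
  intros x' Hx.
  assert (x = x') as <- by
    (apply (is_filter_lim_locally_unique (V := R_NormedModule)); exact Hx).
  intros eps; destruct (H eps (cond_pos eps)) as [d [Hd HP]].
  exists (mkposreal d Hd); intros y Hy. specialize (HP y Hy).
  rewrite norm_C_R.
  replace (Cmod _) with (Cmod (f y - f x - (y - x)%R * l)); [exact HP|].
  f_equal; apply injective_projections; simpl; unfold scal, minus, plus, opp; simpl;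
    unfold mult; simpl; ring.
Qed.

Lemma Cder_x (G : C -> C) (x y : R) l :
  Cder G (x, y) l -> dC (fun t => G (t, y)) x l.
Proof.
  rewrite Cder_iff; intros H; apply dC_eps; intros eps He.
  destruct (H eps He) as [d [Hd HP]]; exists d; split; [exact Hd|]; intros t Ht.
  assert (E : ((t, y) - (x, y))%C = RtoC (t - x))
    by (apply injective_projections; simpl; ring).
  specialize (HP (t, y)); rewrite E, Cmod_R in HP.
  replace (RtoC (t - x) * l)%C with (l * RtoC (t - x))%C by ring; auto.
Qed.

Lemma Cder_y (G : C -> C) (x y : R) l :
  Cder G (x, y) l -> dC (fun t => G (x, t)) y (Ci * l).
Proof.
  rewrite Cder_iff; intros H; apply dC_eps; intros eps He.
  destruct (H eps He) as [d [Hd HP]]; exists d; split; [exact Hd|]; intros t Ht.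
  assert (E : ((x, t) - (x, y))%C = (Ci * RtoC (t - y))%C)
    by (apply injective_projections; simpl; ring).
  specialize (HP (x, t)); rewrite E, Cmod_mult, Cmod_Ci, Cmod_R, Rmult_1_l in HP.
  replace (RtoC (t - y) * (Ci * l))%C with (l * (Ci * RtoC (t - y)))%C by ring; auto.
Qed.

Lemma Cder_cont (G : C -> C) (z l : C) : Cder G z l -> ccont G z.
Proof.
  rewrite Cder_iff; intros H; apply ccont_iff; intros eps He; apply locally_Cmod.
  destruct (H 1 Rlt_0_1) as [d [Hd HP]].
  pose proof (Cmod_ge_0 l).
  set (q := eps / (2 + Cmod l)).
  assert (Hq : 0 < q) by (apply Rdiv_lt_0_compat; lra).
  exists (Rmin d q); split; [apply Rmin_glb_lt; auto|]; intros w Hw.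
  assert (Hw1 : Cmod (w - z) < d) by (eapply Rlt_le_trans; [exact Hw|apply Rmin_l]).
  assert (Hw2 : Cmod (w - z) < q) by (eapply Rlt_le_trans; [exact Hw|apply Rmin_r]).
  replace (G w - G z)%C with ((G w - G z - l * (w - z)) + l * (w - z))%C by ring.
  eapply Rle_lt_trans; [apply Cmod_triangle|]; rewrite Cmod_mult.
  specialize (HP w Hw1). pose proof (Cmod_ge_0 (w - z)).
  assert (eps = q * (2 + Cmod l)) by (unfold q; field; lra).
  nra.
Qed.

Lemma Cder_eq (G : C -> C) (z l l' : C) : Cder G z l -> l = l' -> Cder G z l'.
Proof. intros H <-; exact H. Qed.

Lemma Cder_const (c z : C) : Cder (fun _ => c) z 0%C.
Proof. apply (is_derive_const (K := C_AbsRing) (V := C_NormedModule)). Qed.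

Lemma Cder_id (z : C) : Cder (fun w => w) z 1%C.
Proof.
  apply Cder_iff; intros eps He; exists 1; split; [lra|]; intros w _.
  replace (w - z - 1 * (w - z))%C with (RtoC 0) by ring; rewrite Cmod_0.
  apply Rmult_le_pos; [lra|apply Cmod_ge_0].
Qed.

Lemma Cder_minus (G K : C -> C) (z l m : C) :
  Cder G z l -> Cder K z m -> Cder (fun w => G w - K w)%C z (l - m)%C.
Proof. exact (is_derive_minus (K := C_AbsRing) (V := C_NormedModule) G K z l m). Qed.

Lemma Cder_plus (G K : C -> C) (z l m : C) :
  Cder G z l -> Cder K z m -> Cder (fun w => G w + K w)%C z (l + m)%C.
Proof. exact (is_derive_plus (K := C_AbsRing) (V := C_NormedModule) G K z l m). Qed.

(** Two uniform structures on [C] are in play: that of the product of two lines,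
    and that of a field over which [C] is a module. They have the same
    neighbourhoods, and the product and chain rules live in the second. *)
Lemma Cder_self (G : C -> C) (z l : C) :
  Cder G z l <->
  is_derive (K := C_AbsRing) (V := AbsRing_NormedModule C_AbsRing) G z l.
Proof. split; intros [_ H]; (split; [apply is_linear_scal_l|exact H]). Qed.

Lemma Cder_mult (G K : C -> C) (z l m : C) :
  Cder G z l -> Cder K z m -> Cder (fun w => G w * K w)%C z (l * K z + G z * m)%C.
Proof.
  intros HG HK.
  apply Cder_self in HG, HK; apply Cder_self.
  exact (is_derive_mult (K := C_AbsRing) G K z l m HG HK Cmult_comm).
Qed.

Lemma Cder_comp (G K : C -> C) (z l m : C) :
  Cder G (K z) l -> Cder K z m -> Cder (fun w => G (K w)) z (m * l)%C.
Proof.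
  intros HG HK.
  apply Cder_self in HK.
  exact (is_derive_comp (K := C_AbsRing) (V := C_NormedModule) G K z l m HG HK).
Qed.

Lemma Cder_inv (z : C) : z <> 0%C -> Cder (fun w => / w)%C z (- (/ z * / z))%C.
Proof.
  intros Hz; apply Cder_iff; intros eps He.
  assert (Hm : 0 < Cmod z) by (apply Cmod_gt_0; exact Hz).
  set (m := Cmod z) in *.
  set (q := eps * (m * m * m) / 2).
  assert (Hm3 : 0 < m * m * m) by (repeat apply Rmult_lt_0_compat; auto).
  assert (Hq : 0 < q) by (unfold q; apply Rdiv_lt_0_compat; [nra|lra]).
  exists (Rmin (m / 2) q); split; [apply Rmin_glb_lt; lra|]; intros w Hw.
  assert (Hw1 : Cmod (w - z) < m / 2) by (eapply Rlt_le_trans; [exact Hw|apply Rmin_l]).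
  assert (Hw2 : Cmod (w - z) < q) by (eapply Rlt_le_trans; [exact Hw|apply Rmin_r]).
  pose proof (Cmod_triangle_rev z (z - w)) as H3.
  replace (z - (z - w))%C with w in H3 by ring.
  rewrite (Cmod_minus_sym z w) in H3; fold m in H3.
  assert (Hw0 : w <> 0%C) by (apply Cmod_neq_0; lra).
  replace (/ w - / z - - (/ z * / z) * (w - z))%C
    with ((w - z) * ((w - z) / (w * (z * z))))%C by (field; split; assumption).
  rewrite Cmod_mult, Rmult_comm; apply Rmult_le_compat_r; [apply Cmod_ge_0|].
  rewrite Cmod_div, !Cmod_mult by (repeat apply Cmult_neq_0; assumption).
  fold m. set (k := Cmod w) in *.
  assert (Hk : 0 < k * (m * m)) by (apply Rmult_lt_0_compat; [lra|nra]).
  apply Rmult_le_reg_r with (k * (m * m)); [exact Hk|].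
  unfold Rdiv; rewrite Rmult_assoc, Rinv_l, Rmult_1_r by lra.
  assert (q <= eps * (k * (m * m))).
  { unfold q; replace (eps * (m * m * m) / 2) with (eps * (m / 2 * (m * m))) by field.
    apply Rmult_le_compat_l; [lra|]; apply Rmult_le_compat_r; [nra|lra]. }
  lra.
Qed.

(** * Goursat's theorem and primitives on rectangles *)

Definition rect_int (G : C -> C) (x x' y y' : R) : C :=
  ((CInt (fun t => G (t, y)) x x' - CInt (fun t => G (t, y')) x x')
   + Ci * (CInt (fun s => G (x', s)) y y' - CInt (fun s => G (x, s)) y y'))%C.

Definition cont_rect (G : C -> C) (x x' y y' : R) : Prop :=
  forall u v, x <= u <= x' -> y <= v <= y' -> ccont G (u, v).

Lemma cont_rect_h G x x' y y' u v w :
  cont_rect G x x' y y' -> x <= u <= x' -> x <= w <= x' -> y <= v <= y' ->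
  ex_CInt (fun t => G (t, v)) u w.
Proof.
  intros H Hu Hw Hv; apply ex_CInt_cont; intros t Ht.
  apply ccont_horizontal, H; auto.
  destruct Ht; split.
  - eapply Rle_trans; [|eassumption]; apply Rmin_glb; lra.
  - eapply Rle_trans; [eassumption|]; apply Rmax_lub; lra.
Qed.

Lemma cont_rect_v G x x' y y' u v w :
  cont_rect G x x' y y' -> x <= u <= x' -> y <= v <= y' -> y <= w <= y' ->
  ex_CInt (fun t => G (u, t)) v w.
Proof.
  intros H Hu Hw Hv; apply ex_CInt_cont; intros t Ht.
  apply ccont_vertical, H; auto.
  destruct Ht; split.
  - eapply Rle_trans; [|eassumption]; apply Rmin_glb; lra.
  - eapply Rle_trans; [eassumption|]; apply Rmax_lub; lra.
Qed.

Lemma rect_int_split G x xm x' y ym y' :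
  cont_rect G x x' y y' -> x <= xm <= x' -> y <= ym <= y' ->
  rect_int G x x' y y' =
  (rect_int G x xm y ym + rect_int G xm x' y ym
   + rect_int G x xm ym y' + rect_int G xm x' ym y')%C.
Proof.
  intros H Hx Hy.
  assert (h : forall v, y <= v <= y' ->
    (CInt (fun t => G (t, v)) x xm + CInt (fun t => G (t, v)) xm x')%C
    = CInt (fun t => G (t, v)) x x').
  { intros v Hv; apply CInt_Chasles; eapply cont_rect_h; try exact H; lra. }
  assert (v : forall u, x <= u <= x' ->
    (CInt (fun t => G (u, t)) y ym + CInt (fun t => G (u, t)) ym y')%C
    = CInt (fun t => G (u, t)) y y').
  { intros u Hu; apply CInt_Chasles; eapply cont_rect_v; try exact H; lra. }
  pose proof (h y ltac:(lra)) as h1; pose proof (h y' ltac:(lra)) as h2.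
  pose proof (v x ltac:(lra)) as v1; pose proof (v x' ltac:(lra)) as v2.
  unfold rect_int; rewrite <- h1, <- h2, <- v1, <- v2; ring.
Qed.

Lemma rect_int_norm G x x' y y' M :
  x <= x' -> y <= y' -> cont_rect G x x' y y' ->
  (forall u v, x <= u <= x' -> y <= v <= y' -> Cmod (G (u, v)) <= M) ->
  Cmod (rect_int G x x' y y') <= 2 * ((x' - x) + (y' - y)) * M.
Proof.
  intros Hx Hy Hc HM; unfold rect_int.
  eapply Rle_trans; [apply Cmod_triangle|].
  rewrite Cmod_mult, Cmod_Ci, Rmult_1_l.
  pose proof (Cmod_triangle_minus (CInt (fun t => G (t, y)) x x') (CInt (fun t => G (t, y')) x x')).
  pose proof (Cmod_triangle_minus (CInt (fun t => G (x', t)) y y') (CInt (fun t => G (x, t)) y y')).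
  assert (Cmod (CInt (fun t => G (t, y)) x x') <= (x' - x) * M).
  { apply CInt_norm_const; [lra| |eapply cont_rect_h; try exact Hc; lra].
    intros; apply HM; lra. }
  assert (Cmod (CInt (fun t => G (t, y')) x x') <= (x' - x) * M).
  { apply CInt_norm_const; [lra| |eapply cont_rect_h; try exact Hc; lra].
    intros; apply HM; lra. }
  assert (Cmod (CInt (fun t => G (x', t)) y y') <= (y' - y) * M).
  { apply CInt_norm_const; [lra| |eapply cont_rect_v; try exact Hc; lra].
    intros; apply HM; lra. }
  assert (Cmod (CInt (fun t => G (x, t)) y y') <= (y' - y) * M).
  { apply CInt_norm_const; [lra| |eapply cont_rect_v; try exact Hc; lra].
    intros; apply HM; lra. }
  lra.
Qed.

(** An affine function has a quadratic primitive, so its integral around a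
    closed contour is the increment of that primitive. *)
Lemma rect_int_affine (c l z : C) x x' y y' :
  rect_int (fun w => c + l * (w - z))%C x x' y y' = 0%C.
Proof.
  set (P := fun w => (c * w + l * ((w - z) * (w - z)) * / 2)%C).
  assert (HP : forall w, Cder P w (c + l * (w - z))%C).
  { intros w; unfold P; eapply Cder_eq.
    - apply Cder_plus; [apply Cder_mult; [apply Cder_const|apply Cder_id]|].
      apply Cder_mult; [|apply Cder_const].
      apply Cder_mult; [apply Cder_const|].
      apply Cder_mult; (apply Cder_minus; [apply Cder_id|apply Cder_const]).
    - cbv beta; field. }
  assert (HC : forall w, ccont (fun w => c + l * (w - z))%C w).
  { intros w; apply ccont_plus; [apply ccont_const|].
    apply ccont_mult; [apply ccont_const|].
    apply ccont_minus; [apply continuous_id|apply ccont_const]. }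
  assert (Hh : forall v, CInt (fun t => c + l * ((t, v) - z))%C x x' = (P (x', v) - P (x, v))%C).
  { intros v; apply (CInt_derive (fun t => P (t, v))); intros t _.
    - apply Cder_x, HP.
    - apply (ccont_horizontal (fun w => c + l * (w - z))%C), HC. }
  assert (Hv : forall u, (Ci * CInt (fun t => c + l * ((u, t) - z))%C y y')%C = (P (u, y') - P (u, y))%C).
  { intros u.
    assert (E : ex_CInt (fun t => c + l * ((u, t) - z))%C y y').
    { apply ex_CInt_cont; intros t _.
      apply (ccont_vertical (fun w => c + l * (w - z))%C), HC. }
    rewrite <- (proj2 (CInt_scal Ci _ _ _ E)).
    apply (CInt_derive (fun t => P (u, t))); intros t _.
    - apply Cder_y, HP.
    - apply ccont_mult; [apply ccont_const|].
      apply (ccont_vertical (fun w => c + l * (w - z))%C), HC. }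
  unfold rect_int.
  replace (Ci * (CInt (fun t => c + l * ((x', t) - z))%C y y'
      - CInt (fun t => c + l * ((x, t) - z))%C y y'))%C
    with ((P (x', y') - P (x', y)) - (P (x, y') - P (x, y)))%C
    by (rewrite <- !Hv; ring).
  rewrite !Hh; ring.
Qed.

Lemma nested_intervals (u w : nat -> R) :
  (forall n, u n <= u (S n)) -> (forall n, u (S n) + w (S n) <= u n + w n) ->
  (forall n, 0 <= w n) -> exists X, forall n, u n <= X <= u n + w n.
Proof.
  intros Hu Hw H0.
  assert (Hu' : forall n k, u n <= u (n + k)%nat).
  { intros n k; induction k; [rewrite Nat.add_0_r; lra|].
    rewrite Nat.add_succ_r; specialize (Hu (n + k)%nat); lra. }
  assert (Hw' : forall n k, u (n + k)%nat + w (n + k)%nat <= u n + w n).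
  { intros n k; induction k; [rewrite Nat.add_0_r; lra|].
    rewrite Nat.add_succ_r; specialize (Hw (n + k)%nat); lra. }
  assert (Hm : forall n m, u n <= u m + w m).
  { intros n m.
    pose proof (Hu' n m); pose proof (Hw' m n); pose proof (H0 (m + n)%nat).
    rewrite (Nat.add_comm m n) in *; lra. }
  destruct (completeness (fun r => exists n, r = u n)) as [X [HX1 HX2]].
  - exists (u 0%nat + w 0%nat); intros r [n ->]; apply Hm.
  - exists (u 0%nat), 0%nat; reflexivity.
  - exists X; intros n; split.
    + apply HX1; exists n; reflexivity.
    + apply HX2; intros r [m ->]; apply Hm.
Qed.

Lemma half_pow_arch (K eps : R) : 0 < eps -> exists n, K * (1 / 2) ^ n < eps.
Proof.
  intros He.
  destruct (Rle_or_lt K 0) as [HK|HK].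
  { exists 0%nat; simpl; lra. }
  destruct (pow_lt_1_zero (1 / 2) ltac:(rewrite Rabs_pos_eq; lra) (eps / K)
    ltac:(apply Rdiv_lt_0_compat; lra)) as [n Hn].
  exists n; specialize (Hn n (Nat.le_refl n)).
  rewrite Rabs_pos_eq in Hn by (apply pow_le; lra).
  apply Rmult_lt_compat_l with (r := K) in Hn; [|exact HK].
  replace (K * (eps / K)) with eps in Hn by (field; lra). exact Hn.
Qed.

Lemma rect_int_minus G K x x' y y' :
  x <= x' -> y <= y' -> cont_rect G x x' y y' -> cont_rect K x x' y y' ->
  rect_int (fun w => G w - K w)%C x x' y y' =
  (rect_int G x x' y y' - rect_int K x x' y y')%C.
Proof.
  intros Hx Hy HG HK.
  assert (h : forall v, y <= v <= y' -> CInt (fun t => G (t, v) - K (t, v))%C x x'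
    = (CInt (fun t => G (t, v)) x x' - CInt (fun t => K (t, v)) x x')%C).
  { intros v Hv; apply (CInt_minus (fun t => G (t, v)) (fun t => K (t, v)));
      eapply cont_rect_h; try eassumption; lra. }
  assert (v : forall u, x <= u <= x' -> CInt (fun t => G (u, t) - K (u, t))%C y y'
    = (CInt (fun t => G (u, t)) y y' - CInt (fun t => K (u, t)) y y')%C).
  { intros u Hu; apply (CInt_minus (fun t => G (u, t)) (fun t => K (u, t)));
      eapply cont_rect_v; try eassumption; lra. }
  unfold rect_int.
  rewrite (h y ltac:(lra)), (h y' ltac:(lra)), (v x ltac:(lra)), (v x' ltac:(lra)); ring.
Qed.

(** Bisection: if the integral over the boundary were nonzero, nested quarters
    would carry at least [4^-n] of it, while near their common point the
    function is affine up to an error that is small against the diameter. *)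
Theorem goursat G x x' y y' :
  x <= x' -> y <= y' ->
  (forall u v, x <= u <= x' -> y <= v <= y' -> exists l, Cder G (u, v) l) ->
  rect_int G x x' y y' = 0%C.
Proof.
  intros Hx Hy HD.
  assert (HC : cont_rect G x x' y y').
  { intros u v Hu Hv; destruct (HD u v Hu Hv) as [l Hl]; eapply Cder_cont, Hl. }
  apply Cmod_eq_0.
  set (mu := Cmod (rect_int G x x' y y')).
  destruct (Rle_lt_or_eq_dec 0 mu (Cmod_ge_0 _)) as [Hmu|Hmu]; [exfalso|auto].
  set (W := fun n => (x' - x) * (1 / 2) ^ n).
  set (V := fun n => (y' - y) * (1 / 2) ^ n).
  assert (HW : forall n, 0 <= W n) by (intros; apply Rmult_le_pos; [lra|apply pow_le; lra]).
  assert (HV : forall n, 0 <= V n) by (intros; apply Rmult_le_pos; [lra|apply pow_le; lra]).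
  assert (WS : forall n, W n = W (S n) + W (S n)) by (intros; unfold W; simpl; lra).
  assert (VS : forall n, V n = V (S n) + V (S n)) by (intros; unfold V; simpl; lra).
  set (Inv := fun n (c : R * R) =>
    (x <= fst c /\ fst c + W n <= x') /\ (y <= snd c /\ snd c + V n <= y') /\
    mu * (1 / 4) ^ n <= Cmod (rect_int G (fst c) (fst c + W n) (snd c) (snd c + V n))).
  set (Rel := fun n (c c' : R * R) =>
    (fst c <= fst c' /\ fst c' + W (S n) <= fst c + W n) /\
    (snd c <= snd c' /\ snd c' + V (S n) <= snd c + V n)).
  assert (Hstep : forall n c, Inv n c -> exists c', Inv (S n) c' /\ Rel n c c').
  { intros n [u v] [H1 [H2 H3]]; simpl in *.
    pose proof (HW (S n)) as Hw; pose proof (HV (S n)) as Hv.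
    rewrite (rect_int_split G u (u + W (S n)) (u + W n) v (v + V (S n)) (v + V n)) in H3;
      [|intros p q Hp Hq; apply HC; lra|rewrite (WS n); lra|rewrite (VS n); lra].
    rewrite (WS n), (VS n), <- !Rplus_assoc in H3.
    set (A := rect_int G u (u + W (S n)) v (v + V (S n))) in *.
    set (B := rect_int G (u + W (S n)) (u + W (S n) + W (S n)) v (v + V (S n))) in *.
    set (D := rect_int G u (u + W (S n)) (v + V (S n)) (v + V (S n) + V (S n))) in *.
    set (E := rect_int G (u + W (S n)) (u + W (S n) + W (S n)) (v + V (S n))
      (v + V (S n) + V (S n))) in *.
    pose proof (Cmod_triangle (A + B + D) E). pose proof (Cmod_triangle (A + B) D).
    pose proof (Cmod_triangle A B).
    rewrite (WS n) in H1; rewrite (VS n) in H2.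
    set (k := mu * (1 / 4) ^ n) in *.
    assert (Hk : mu * (1 / 4) ^ (S n) = k / 4) by (unfold k; simpl; field).
    unfold Inv, Rel; rewrite Hk, (WS n), (VS n).
    destruct (Rle_or_lt (k / 4) (Cmod A)).
    { exists (u, v); simpl; repeat split; try assumption; lra. }
    destruct (Rle_or_lt (k / 4) (Cmod B)).
    { exists (u + W (S n), v); simpl; repeat split; try assumption; lra. }
    destruct (Rle_or_lt (k / 4) (Cmod D)).
    { exists (u, v + V (S n)); simpl; repeat split; try assumption; lra. }
    exists (u + W (S n), v + V (S n)); simpl; repeat split; fold E; lra. }
  set (c := fix c n := match n with O => (x, y) | S m =>
    epsilon (inhabits (x, y)) (fun c' => Inv (S m) c' /\ Rel m (c m) c') end).
  assert (Hc : forall n, Inv n (c n)).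
  { induction n as [|n IH].
    - unfold Inv; simpl; unfold W, V; simpl; rewrite !Rmult_1_r.
      replace (x + (x' - x)) with x' by ring; replace (y + (y' - y)) with y' by ring.
      fold mu; repeat split; lra.
    - destruct (epsilon_spec (inhabits (x, y)) _ (Hstep n _ IH)) as [H _]; exact H. }
  assert (Hr : forall n, Rel n (c n) (c (S n))).
  { intros n; destruct (epsilon_spec (inhabits (x, y)) _ (Hstep n _ (Hc n))) as [_ H]; exact H. }
  destruct (nested_intervals (fun n => fst (c n)) W) as [X HX]; [intros; apply Hr..|auto|].
  destruct (nested_intervals (fun n => snd (c n)) V) as [Y HY]; [intros; apply Hr..|auto|].
  assert (HX0 : x <= X <= x').
  { destruct (Hc 0%nat) as [H1 _]; specialize (HX 0%nat); simpl in *; lra. }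
  assert (HY0 : y <= Y <= y').
  { destruct (Hc 0%nat) as [_ [H1 _]]; specialize (HY 0%nat); simpl in *; lra. }
  destruct (HD X Y HX0 HY0) as [l Hl]; rewrite Cder_iff in Hl.
  set (S0 := (x' - x) + (y' - y)).
  assert (HS0 : 0 <= S0) by (unfold S0; lra).
  set (eps := mu / (4 * (S0 * S0 + 1))).
  assert (Heps : 0 < eps) by (unfold eps; apply Rdiv_lt_0_compat; nra).
  destruct (Hl eps Heps) as [d [Hd HP]].
  destruct (half_pow_arch S0 d Hd) as [n Hn].
  destruct (Hc n) as [H1 [H2 H3]].
  set (u := fst (c n)) in *; set (v := snd (c n)) in *.
  specialize (HX n); specialize (HY n); fold u in HX; fold v in HY.
  pose proof (HW n) as Hw0; pose proof (HV n) as Hv0.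
  set (L := (1 / 2) ^ n) in *.
  assert (HL : 0 <= L) by (apply pow_le; lra).
  set (Aff := fun w => (G (X, Y) + l * (w - (X, Y)))%C).
  assert (HCsub : cont_rect G u (u + W n) v (v + V n)).
  { intros p q Hp Hq; apply HC; lra. }
  assert (HCA : forall w, ccont Aff w).
  { intros w; apply ccont_plus; [apply ccont_const|]; apply ccont_mult; [apply ccont_const|].
    apply ccont_minus; [apply continuous_id|apply ccont_const]. }
  assert (HCAr : cont_rect Aff u (u + W n) v (v + V n)) by (intros p q _ _; apply HCA).
  assert (E : rect_int G u (u + W n) v (v + V n) =
              rect_int (fun w => G w - Aff w)%C u (u + W n) v (v + V n)).
  { transitivity (rect_int G u (u + W n) v (v + V n) - rect_int Aff u (u + W n) v (v + V n))%C.
    - unfold Aff at 1; rewrite rect_int_affine; ring.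
    - symmetry; apply rect_int_minus; [lra|lra|exact HCsub|exact HCAr]. }
  rewrite E in H3.
  assert (Hb : Cmod (rect_int (fun w => G w - Aff w)%C u (u + W n) v (v + V n)) <=
    2 * ((u + W n - u) + (v + V n - v)) * (eps * (S0 * L))).
  { apply rect_int_norm; try lra.
    - intros p q Hp Hq; apply ccont_minus; [apply HCsub; auto|apply HCA].
    - intros p q Hp Hq.
      assert (Hdist : Cmod ((p, q) - (X, Y))%C <= S0 * L).
      { eapply Rle_trans; [apply Cmod_le_sum|]; simpl.
        replace (S0 * L) with (W n + V n) by (unfold W, V, S0; fold L; ring).
        apply Rplus_le_compat; apply Rabs_le; lra. }
      unfold Aff. replace (G (p, q) - (G (X, Y) + l * ((p, q) - (X, Y))))%C with
        (G (p, q) - G (X, Y) - l * ((p, q) - (X, Y)))%C by ring.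
      eapply Rle_trans; [apply HP; lra|].
      apply Rmult_le_compat_l; lra. }
  replace ((u + W n - u) + (v + V n - v)) with (S0 * L) in Hb
    by (unfold W, V, S0; fold L; ring).
  assert (H4 : (1 / 4) ^ n = L * L).
  { unfold L; rewrite <- Rpow_mult_distr; f_equal; lra. }
  rewrite H4 in H3.
  assert (HLp : 0 < L) by (apply pow_lt; lra).
  assert (mu * (L * L) <= 2 * (eps * (S0 * S0)) * (L * L)) by lra.
  assert (mu <= 2 * (eps * (S0 * S0))).
  { apply Rmult_le_reg_r with (L * L); [nra|assumption]. }
  assert (eps * (S0 * S0) <= mu / 4).
  { unfold eps; replace (mu / 4) with (mu / (4 * (S0 * S0 + 1)) * (S0 * S0 + 1)) by (field; nra).
    apply Rmult_le_compat_l; [fold eps; lra|lra]. }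
  lra.
Qed.

Definition holo (G : C -> C) (a b l h : R) : Prop :=
  forall x y, a < x < b -> l < y < h -> exists d, Cder G (x, y) d.

Lemma holo_cont G a b l h x y :
  holo G a b l h -> a < x < b -> l < y < h -> ccont G (x, y).
Proof. intros H Hx Hy; destruct (H x y Hx Hy) as [d Hd]; eapply Cder_cont, Hd. Qed.

Definition primitive (G : C -> C) (c y0 : R) (z : C) : C :=
  (CInt (fun t => G (t, y0)) c (fst z) + Ci * CInt (fun s => G (fst z, s)) y0 (snd z))%C.

Lemma dC_CInt_upper (f : R -> C) (a b : R) :
  (exists d, 0 < d /\ forall x, Rmin a (b - d) <= x <= Rmax a (b + d) -> ccont f x) ->
  dC (fun x => CInt f a x) b (f b).
Proof.
  intros [d [Hd Hc]].
  apply (is_derive_RInt (V := C_R_NormedModule) f (fun x => CInt f a x) a b).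
  - apply locally_R; exists d; split; [exact Hd|]; intros y Hy.
    apply (RInt_correct (V := C_R_CompleteNormedModule)), ex_CInt_cont.
    apply Rabs_def2 in Hy.
    intros x Hx; apply Hc; split.
    + eapply Rle_trans; [|apply Hx]; apply Rle_min_compat_l; lra.
    + eapply Rle_trans; [apply Hx|]; apply Rle_max_compat_l; lra.
  - apply Hc; split; [eapply Rle_trans; [apply Rmin_r|]|eapply Rle_trans; [|apply Rmax_r]]; lra.
Qed.

Section Primitive.
Variables (G : C -> C) (a b l h c y0 : R).
Hypotheses (HG : holo G a b l h) (Hc : a < c < b) (Hy0 : l < y0 < h).

Lemma primitive_y x y :
  a < x < b -> l < y < h -> dC (fun s => primitive G c y0 (x, s)) y (Ci * G (x, y)).
Proof.
  intros Hx Hy; unfold primitive; simpl.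
  eapply dC_eq; [apply dC_plus; [apply dC_const|]|].
  - apply dC_scal, dC_CInt_upper.
    exists (Rmin (y - l) (h - y) / 2); split.
    { apply Rdiv_lt_0_compat; [|lra]; apply Rmin_glb_lt; lra. }
    intros s Hs; apply ccont_vertical; eapply holo_cont; [exact HG|exact Hx|].
    pose proof (Rmin_l (y - l) (h - y)); pose proof (Rmin_r (y - l) (h - y)).
    set (e := Rmin (y - l) (h - y)) in *.
    assert (l < Rmin y0 (y - e / 2)) by (apply Rmin_glb_lt; lra).
    assert (Rmax y0 (y + e / 2) < h) by (apply Rmax_lub_lt; lra).
    lra.
  - cbv beta; ring.
Qed.

(** By Goursat's theorem the path may run first vertically, then horizontally. *)
Lemma primitive_swap x y :
  c <= x < b -> y0 <= y < h ->
  primitive G c y0 (x, y) =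
  (CInt (fun t => G (t, y)) c x + Ci * CInt (fun s => G (c, s)) y0 y)%C.
Proof.
  intros Hx Hy; unfold primitive; simpl.
  assert (E : rect_int G c x y0 y = 0%C).
  { apply goursat; [lra|lra|]; intros u v Hu Hv; apply HG; lra. }
  unfold rect_int in E.
  set (A := CInt (fun t => G (t, y0)) c x) in *.
  set (B := CInt (fun t => G (t, y)) c x) in *.
  set (D := CInt (fun s => G (x, s)) y0 y) in *.
  set (K := CInt (fun s => G (c, s)) y0 y) in *.
  replace (A + Ci * D)%C with ((A - B + Ci * (D - K)) + (B + Ci * K))%C by ring.
  rewrite E; ring.
Qed.

Lemma primitive_x x y :
  c < x < b -> y0 <= y < h -> dC (fun t => primitive G c y0 (t, y)) x (G (x, y)).
Proof.
  intros Hx Hy.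
  apply (dC_ext_loc (fun t => CInt (fun t => G (t, y)) c t
    + Ci * CInt (fun s => G (c, s)) y0 y)%C).
  - apply locally_R; exists (Rmin (x - c) (b - x)); split; [apply Rmin_glb_lt; lra|].
    intros t Ht; pose proof (Rmin_l (x - c) (b - x)); pose proof (Rmin_r (x - c) (b - x)).
    apply Rabs_def2 in Ht; symmetry; apply primitive_swap; lra.
  - eapply dC_eq; [apply dC_plus; [|apply dC_const]|].
    + apply (dC_CInt_upper (fun t => G (t, y))).
      exists (Rmin (x - c) (b - x) / 2); split.
      { apply Rdiv_lt_0_compat; [|lra]; apply Rmin_glb_lt; lra. }
      intros t Ht; apply ccont_horizontal; eapply holo_cont; [exact HG| |lra].
      pose proof (Rmin_l (x - c) (b - x)); pose proof (Rmin_r (x - c) (b - x)).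
      set (e := Rmin (x - c) (b - x)) in *.
      assert (a < Rmin c (x - e / 2)) by (apply Rmin_glb_lt; lra).
      assert (Rmax c (x + e / 2) < b) by (apply Rmax_lub_lt; lra).
      lra.
    + cbv beta; ring.
Qed.

End Primitive.

(** * Pairings with a horizontal line as functions of the height *)

Lemma dC_CInt_param (Phi Psi : C -> C) c' d' l h c d y :
  c' < c -> c <= d -> d < d' -> l < y < h ->
  (forall t s, c' < t < d' -> l < s < h ->
     dC (fun u => Phi (t, u)) s (Psi (t, s)) /\ ccont Psi (t, s) /\
     ccont (fun u => Phi (u, s)) t) ->
  dC (fun s => CInt (fun t => Phi (t, s)) c d) y (CInt (fun t => Psi (t, y)) c d).
Proof.
  intros Hc Hcd Hd Hy H.
  assert (HPhi : forall s, l < s < h -> ex_CInt (fun t => Phi (t, s)) c d).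
  { intros s Hs; apply ex_CInt_cont; intros t Ht; rewrite Rmin_left, Rmax_right in Ht by lra.
    apply (H t s ltac:(lra) Hs). }
  assert (HPsi : ex_CInt (fun t => Psi (t, y)) c d).
  { apply ex_CInt_cont; intros t Ht; rewrite Rmin_left, Rmax_right in Ht by lra.
    apply (ccont_horizontal Psi), H; lra. }
  assert (Hloc : locally y (fun s => l < s < h)).
  { apply locally_R; exists (Rmin (y - l) (h - y)); split; [apply Rmin_glb_lt; lra|].
    intros s Hs; pose proof (Rmin_l (y - l) (h - y)); pose proof (Rmin_r (y - l) (h - y)).
    apply Rabs_def2 in Hs; lra. }
  apply (dC_ext_loc (fun s => (RInt (fun t => fst (Phi (t, s))) c d,
    RInt (fun t => snd (Phi (t, s))) c d))).
  { revert Hloc; apply filter_imp; intros s Hs; symmetry; apply CInt_components, HPhi, Hs. }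
  rewrite (CInt_components _ _ _ HPsi).
  assert (Hpart : forall p : C -> R,
    (forall g x k, dC g x k -> is_derive (fun t => p (g t)) x (p k)) ->
    (forall (g : C -> C) z, ccont g z -> continuous (fun t => p (g t)) z) ->
    (forall g u v, ex_CInt g u v -> ex_RInt (fun t => p (g t)) u v) ->
    is_derive (fun s => RInt (fun t => p (Phi (t, s))) c d) y (RInt (fun t => p (Psi (t, y))) c d)).
  { intros p p1 p2 p3.
    replace (RInt (fun t => p (Psi (t, y))) c d) with
      (RInt (fun t => Derive (fun u => p (Phi (t, u))) y) c d).
    - apply (is_derive_RInt_param (fun s t => p (Phi (t, s))) c d y).
      + revert Hloc; apply filter_imp; intros s Hs t Ht.
        rewrite Rmin_left, Rmax_right in Ht by lra.
        eexists; apply (p1 (fun u => Phi (t, u))), H; lra.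
      + intros t Ht; rewrite Rmin_left, Rmax_right in Ht by lra.
        apply (continuity_2d_pt_ext_loc (fun u v => p (Psi (v, u)))).
        * exists (mkposreal (Rmin (Rmin (y - l) (h - y)) (Rmin (t - c') (d' - t)))
            ltac:(repeat apply Rmin_glb_lt; lra)); simpl; intros u v Hu Hv.
          set (e1 := Rmin (y - l) (h - y)) in *; set (e2 := Rmin (t - c') (d' - t)) in *.
          pose proof (Rmin_l e1 e2); pose proof (Rmin_r e1 e2).
          pose proof (Rmin_l (y - l) (h - y)); pose proof (Rmin_r (y - l) (h - y)).
          pose proof (Rmin_l (t - c') (d' - t)); pose proof (Rmin_r (t - c') (d' - t)).
          fold e1 in H2, H3; fold e2 in H4, H5.
          apply Rabs_def2 in Hu; apply Rabs_def2 in Hv.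
          symmetry; apply is_derive_unique; apply (p1 (fun z => Phi (v, z))), H; lra.
        * apply continuity_2d_pt_filterlim.
          apply (continuous_comp (fun z : R * R => (snd z, fst z) : C) (fun z => p (Psi z))).
          -- apply ccont_pair; simpl; [apply continuous_snd|apply continuous_fst].
          -- simpl; apply p2, H; lra.
      + revert Hloc; apply filter_imp; intros s Hs; apply p3, HPhi, Hs.
    - apply RInt_ext; intros t Ht; rewrite Rmin_left, Rmax_right in Ht by lra.
      apply is_derive_unique; apply (p1 (fun z => Phi (t, z))), H; lra. }
  apply dC_pair; simpl.
  - apply (Hpart (fun z => fst z)).
    + intros; apply dC_fst; assumption.
    + intros; apply ccont_fst; assumption.
    + intros; apply ex_CInt_fst; assumption.
  - apply (Hpart (fun z => snd z)).
    + intros; apply dC_snd; assumption.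
    + intros; apply ccont_snd; assumption.
    + intros; apply ex_CInt_snd; assumption.
Qed.

(** The weak form of Cauchy's theorem: [d/dy] of the pairing of a horizontal
    line with a fixed function is [- i] times the pairing with its derivative,
    because both sides come from the same primitive after integration by parts. *)
Lemma dC_pairing (G : C -> C) (chi chi' : R -> C) a b l h c d y :
  holo G a b l h -> a < c -> c <= d -> d < b -> l < y < h ->
  (forall x, dC chi x (chi' x)) -> (forall x, ccont chi' x) ->
  chi c = 0%C -> chi d = 0%C ->
  dC (fun s => CInt (fun x => G (x, s) * chi x)%C c d) y
     (- Ci * CInt (fun x => G (x, y) * chi' x)%C c d)%C.
Proof.
  intros HG Hac Hcd Hdb Hy Hchi Hchi' c0 d0.
  set (c1 := (a + c) / 2); set (y0 := (l + y) / 2).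
  set (P := primitive G c1 y0).
  assert (Hc1 : a < c1 < c) by (unfold c1; lra).
  assert (Hy0 : l < y0 < y) by (unfold y0; lra).
  assert (Px : forall t s, c1 < t < b -> y0 < s < h -> dC (fun t => P (t, s)) t (G (t, s))).
  { intros t s Ht Hs; apply (primitive_x G a b l h); auto; lra. }
  assert (Py : forall t s, c1 < t < b -> y0 < s < h -> dC (fun s => P (t, s)) s (Ci * G (t, s))).
  { intros t s Ht Hs; apply (primitive_y G a b l h); auto; lra. }
  assert (Gc : forall t s, c1 < t < b -> y0 < s < h -> ccont G (t, s)).
  { intros t s Ht Hs; apply (holo_cont G a b l h); auto; lra. }
  assert (chic : forall x, ccont chi x) by (intros x; eapply dC_cont, Hchi).
  apply (dC_ext_loc (fun s => CInt (fun x => - P (x, s) * chi' x)%C c d)).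
  { apply locally_R; exists (Rmin (y - y0) (h - y)); split; [apply Rmin_glb_lt; lra|].
    intros s Hs; pose proof (Rmin_l (y - y0) (h - y)); pose proof (Rmin_r (y - y0) (h - y)).
    apply Rabs_def2 in Hs.
    assert (E : CInt (fun x => G (x, s) * chi x + P (x, s) * chi' x)%C c d = 0%C).
    { rewrite (CInt_derive (fun x => P (x, s) * chi x)%C).
      - rewrite c0, d0; ring.
      - intros x Hx; rewrite Rmin_left, Rmax_right in Hx by lra.
        apply dC_mult; [apply Px; lra|apply Hchi].
      - intros x Hx; rewrite Rmin_left, Rmax_right in Hx by lra.
        apply ccont_plus; apply ccont_mult; auto.
        + apply (ccont_horizontal G), Gc; lra.
        + eapply dC_cont, Px; lra. }
    assert (E1 : ex_CInt (fun x => G (x, s) * chi x)%C c d).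
    { apply ex_CInt_cont; intros x Hx; rewrite Rmin_left, Rmax_right in Hx by lra.
      apply ccont_mult; auto; apply (ccont_horizontal G), Gc; lra. }
    assert (E2 : ex_CInt (fun x => P (x, s) * chi' x)%C c d).
    { apply ex_CInt_cont; intros x Hx; rewrite Rmin_left, Rmax_right in Hx by lra.
      apply ccont_mult; auto; eapply dC_cont, Px; lra. }
    rewrite CInt_plus in E by assumption.
    transitivity (CInt (fun x => (-1) * (P (x, s) * chi' x))%C c d).
    { apply CInt_ext; intros x _; ring. }
    rewrite (proj2 (CInt_scal (-1) _ c d E2)).
    set (A := CInt (fun x => G (x, s) * chi x)%C c d) in *.
    set (B := CInt (fun x => P (x, s) * chi' x)%C c d) in *.
    replace A with ((A + B) + -1 * B)%C by ring. rewrite E; ring. }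
  assert (Hex : ex_CInt (fun x => G (x, y) * chi' x)%C c d).
  { apply ex_CInt_cont; intros x Hx; rewrite Rmin_left, Rmax_right in Hx by lra.
    apply ccont_mult; auto; apply (ccont_horizontal G), Gc; lra. }
  rewrite <- (proj2 (CInt_scal (- Ci) _ c d Hex)).
  apply (dC_CInt_param (fun z => - P z * chi' (fst z))%C
    (fun z => - Ci * (G z * chi' (fst z)))%C c1 b y0 h); try lra.
  intros t s Ht Hs; split; [|split].
  - simpl; eapply dC_eq; [apply dC_mult; [|apply dC_const]|].
    + apply dC_opp, Py; lra.
    + cbv beta; ring.
  - apply ccont_mult; [apply ccont_const|]; apply ccont_mult; [apply Gc; lra|].
    apply (continuous_comp (fun z : C => fst z) chi'); [apply continuous_fst|apply Hchi'].
  - simpl; apply ccont_mult; [|apply Hchi'].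
    apply ccont_opp; eapply dC_cont, Px; lra.
Qed.

(** * Cauchy's formula for a smoothly cut off contour *)

Lemma ccont_uniform_height (Phi : C -> C) c d q :
  (forall t, c <= t <= d -> ccont Phi (t, q)) ->
  forall eps, 0 < eps -> exists del, 0 < del /\
    forall t s, c <= t <= d -> Rabs (s - q) < del -> Cmod (Phi (t, s) - Phi (t, q)) < eps.
Proof.
  intros H eps He.
  set (e := mkposreal (eps / 2) ltac:(lra)).
  destruct (uniform_continuity_2d_1d (fun x y => fst (Phi (x, y))) c d q) with (eps := e)
    as [d1 H1].
  { intros x Hx; apply continuity_2d_pt_filterlim.
    apply (continuous_comp (fun z : R * R => (fst z, snd z) : C) (fun z => fst (Phi z))).
    - apply ccont_pair; simpl; [apply continuous_fst|apply continuous_snd].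
    - apply ccont_fst, H, Hx. }
  destruct (uniform_continuity_2d_1d (fun x y => snd (Phi (x, y))) c d q) with (eps := e)
    as [d2 H2].
  { intros x Hx; apply continuity_2d_pt_filterlim.
    apply (continuous_comp (fun z : R * R => (fst z, snd z) : C) (fun z => snd (Phi z))).
    - apply ccont_pair; simpl; [apply continuous_fst|apply continuous_snd].
    - apply ccont_snd, H, Hx. }
  exists (Rmin d1 d2); split; [apply Rmin_glb_lt; apply cond_pos|].
  intros t s Ht Hs.
  assert (Hs1 : Rabs (s - q) < d1) by (eapply Rlt_le_trans; [exact Hs|apply Rmin_l]).
  assert (Hs2 : Rabs (s - q) < d2) by (eapply Rlt_le_trans; [exact Hs|apply Rmin_r]).
  pose proof (cond_pos d1); pose proof (cond_pos d2).
  apply Rabs_def2 in Hs1; apply Rabs_def2 in Hs2.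
  assert (Hz1 : Rabs (t - t) < d1) by (rewrite Rminus_diag, Rabs_R0; apply cond_pos).
  assert (Hz2 : Rabs (t - t) < d2) by (rewrite Rminus_diag, Rabs_R0; apply cond_pos).
  specialize (H1 t q t s Ht ltac:(lra) Ht ltac:(lra) Hz1).
  specialize (H2 t q t s Ht ltac:(lra) Ht ltac:(lra) Hz2).
  simpl in H1, H2.
  eapply Rle_lt_trans; [apply Cmod_le_sum|]; simpl.
  unfold Rminus in *; lra.
Qed.

Lemma atan_le_id x : 0 <= x -> atan x <= x.
Proof.
  intros Hx.
  destruct (MVT_gen atan 0 x (fun u => / (1 + u ^ 2))) as [c [Hc E]].
  - intros u _. apply is_derive_Reals, derivable_pt_lim_atan.
  - intros u _; apply derivable_continuous_pt, derivable_pt_atan.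
  - rewrite atan_0 in E.
    assert (/ (1 + c ^ 2) <= 1).
    { rewrite <- Rinv_1; apply Rinv_le_contravar; [lra|]. pose proof (pow2_ge_0 c); lra. }
    nra.
Qed.

Lemma is_derive_atan_scaled (p s x : R) :
  0 < s -> is_derive (fun t => atan ((t - p) / s)) x (s / ((x - p) * (x - p) + s * s)).
Proof.
  intros Hs.
  eapply is_derive_eq.
  - apply (is_derive_comp (K := R_AbsRing) (V := R_NormedModule) atan (fun t => (t - p) / s) x).
    + apply is_derive_Reals, derivable_pt_lim_atan.
    + auto_derive; [trivial|reflexivity].
  - unfold scal; simpl; unfold mult; simpl.
    field. split; [|lra].
    assert (0 < s * s) by nra. pose proof (Rle_0_sqr (x - p)); unfold Rsqr in *. nra.
Qed.

(** The difference of the two kernels is [2 i] times the Poisson kernel of width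
    [s], of total mass [PI], which concentrates at [p]. *)
Lemma cauchy_kernel_jump (chi : R -> C) c d p eta :
  (forall x, ccont chi x) -> 0 < eta -> c < p - eta -> p + eta < d ->
  (forall x, p - eta <= x <= p + eta -> chi x = 1%C) ->
  forall eps, 0 < eps -> exists s0, 0 < s0 /\ forall s, 0 < s < s0 ->
    Cmod (CInt (fun x => (/ (x - p, - s)%R - / (x - p, s)%R) * chi x)%C c d
          - RtoC (2 * PI) * Ci) <= eps.
Proof.
  intros Hchi Heta Hc Hd H1 eps He.
  assert (HM : exists M, 0 <= M /\ forall x, c <= x <= d -> Cmod (chi x) <= M).
  { destruct (continuity_ab_maj (fun x => Cmod (chi x)) c d) as [m [Hm _]]; [lra| |].
    - intros x _; apply continuity_pt_filterlim.
      apply (continuous_ext (fun t => norm (V := C_R_NormedModule) (chi t)));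
        [intros; apply norm_C_R|].
      apply (continuous_comp chi); [apply Hchi|apply (filterlim_norm (V := C_R_NormedModule))].
    - exists (Cmod (chi m)); split; [apply Cmod_ge_0|exact Hm]. }
  destruct HM as [M [HM0 HM]].
  set (K := (d - c) * (2 / (eta * eta) * M) * 2 + 4 / eta).
  assert (He2 : 0 < eta * eta) by nra.
  assert (HK : 0 <= K).
  { assert (0 < 4 / eta) by (apply Rdiv_lt_0_compat; lra).
    assert (0 <= 2 / (eta * eta) * M).
    { apply Rmult_le_pos; [|lra]. left; apply Rdiv_lt_0_compat; lra. }
    unfold K; nra. }
  exists (eps / (K + 1)); split; [apply Rdiv_lt_0_compat; lra|].
  intros s [Hs Hs0].
  assert (Hss : 0 < s * s) by nra.
  assert (Hq : forall x, 0 < (x - p) * (x - p) + s * s).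
  { intros x; pose proof (Rle_0_sqr (x - p)); unfold Rsqr in *; lra. }
  assert (E : forall x, (/ (x - p, - s)%R - / (x - p, s)%R)%C
    = (Ci * RtoC (2 * (s / ((x - p) * (x - p) + s * s))))%C).
  { intros x; specialize (Hq x). unfold Cinv; simpl.
    assert ((x - p) * (x - p) + s * s <> 0) by lra.
    apply injective_projections; simpl; field; try split; intro; nra. }
  set (k := fun x => (Ci * RtoC (2 * (s / ((x - p) * (x - p) + s * s))) * chi x)%C).
  rewrite (CInt_ext _ k) by (intros; rewrite E; reflexivity).
  assert (Hkc : forall u v, ex_CInt k u v).
  { intros u v; apply ex_CInt_cont; intros x _; apply ccont_mult; [|apply Hchi].
    apply ccont_mult; [apply ccont_const|]; apply ccont_RtoC.
    apply (ex_derive_continuous (K := R_AbsRing) (V := R_NormedModule)).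
    auto_derive; specialize (Hq x); lra. }
  rewrite <- (CInt_Chasles k c (p - eta) d), <- (CInt_Chasles k (p - eta) (p + eta) d) by auto.
  assert (Hmid : CInt k (p - eta) (p + eta) = (Ci * RtoC (4 * atan (eta / s)))%C).
  { rewrite (CInt_ext _ (fun x => Ci * RtoC (2 * (s / ((x - p) * (x - p) + s * s))))%C).
    - rewrite (CInt_derive (fun x => Ci * RtoC (2 * atan ((x - p) / s)))%C).
      + replace (p + eta - p) with eta by ring.
        replace ((p - eta - p) / s) with (- (eta / s)) by (field; lra).
        rewrite atan_opp; apply injective_projections; simpl; ring.
      + intros x _; apply dC_scal, dC_RtoC.
        apply (is_derive_scal (fun x => atan ((x - p) / s))), is_derive_atan_scaled, Hs.
      + intros x _; apply ccont_mult; [apply ccont_const|]; apply ccont_RtoC.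
        apply (ex_derive_continuous (K := R_AbsRing) (V := R_NormedModule)).
        auto_derive; specialize (Hq x); lra.
    - intros x Hx; rewrite Rmin_left, Rmax_right in Hx by lra.
      unfold k; rewrite H1 by lra; ring. }
  assert (Hout : forall u v, c <= u -> u <= v -> v <= d ->
    (forall x, u <= x <= v -> eta * eta <= (x - p) * (x - p)) ->
    Cmod (CInt k u v) <= (d - c) * (2 / (eta * eta) * M) * s).
  { intros u v Hu Huv Hv Hfar.
    eapply Rle_trans; [apply (CInt_norm_const k (2 / (eta * eta) * M * s)); auto|].
    - intros x Hx; unfold k; rewrite !Cmod_mult, Cmod_Ci, Cmod_R, Rmult_1_l.
      specialize (Hfar x Hx); specialize (Hq x).
      rewrite Rabs_pos_eq by (apply Rmult_le_pos; [lra|]; left; apply Rdiv_lt_0_compat; lra).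
      replace (2 / (eta * eta) * M * s) with (2 * (s / (eta * eta)) * M) by (field; lra).
      apply Rmult_le_compat; [|apply Cmod_ge_0| |apply HM; lra].
      + apply Rmult_le_pos; [lra|]; left; apply Rdiv_lt_0_compat; lra.
      + apply Rmult_le_compat_l; [lra|]; apply Rmult_le_compat_l; [lra|].
        apply Rinv_le_contravar; lra.
    - assert (0 <= 2 / (eta * eta) * M).
      { apply Rmult_le_pos; [|lra]. left; apply Rdiv_lt_0_compat; lra. }
      assert (0 <= 2 / (eta * eta) * M * s) by nra.
      nra. }
  pose proof (Hout c (p - eta) ltac:(lra) ltac:(lra) ltac:(lra) ltac:(intros; nra)) as O1.
  pose proof (Hout (p + eta) d ltac:(lra) ltac:(lra) ltac:(lra) ltac:(intros; nra)) as O2.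
  assert (Hat : Rabs (4 * atan (eta / s) - 2 * PI) <= 4 / eta * s).
  { replace (eta / s) with (/ (s / eta)) by (field; lra).
    assert (0 < s / eta) by (apply Rdiv_lt_0_compat; lra).
    rewrite atan_inv by assumption.
    replace (4 * (PI / 2 - atan (s / eta)) - 2 * PI) with (- (4 * atan (s / eta))) by field.
    pose proof (atan_le_id (s / eta) ltac:(lra)).
    assert (0 < atan (s / eta)) by (rewrite <- atan_0; apply atan_increasing; lra).
    rewrite Rabs_Ropp, Rabs_pos_eq by lra.
    replace (4 / eta * s) with (4 * (s / eta)) by (field; lra). lra. }
  rewrite Hmid.
  match goal with |- Cmod ?X <= _ => replace X with
    (CInt k c (p - eta) + CInt k (p + eta) d
     + Ci * RtoC (4 * atan (eta / s) - 2 * PI))%C end.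
  2: { rewrite !RtoC_minus; ring. }
  eapply Rle_trans; [apply Cmod_triangle|].
  rewrite Cmod_mult, Cmod_Ci, Cmod_R, Rmult_1_l.
  pose proof (Cmod_triangle (CInt k c (p - eta)) (CInt k (p + eta) d)).
  assert (K * s <= eps).
  { apply Rle_trans with (K * (eps / (K + 1))); [apply Rmult_le_compat_l; lra|].
    apply Rle_trans with ((K + 1) * (eps / (K + 1))); [|right; field; lra].
    apply Rmult_le_compat_r; [left; apply Rdiv_lt_0_compat; lra|lra]. }
  unfold K in *; lra.
Qed.

Lemma Cminus_eq_0 (z w : C) : (z - w)%C = 0%C -> z = w.
Proof.
  intros E; replace z with ((z - w) + w)%C by ring; rewrite E; ring.
Qed.

Section Pole.
Variables (N : C -> C) (chi chi' : R -> C) (a b l h c d p q eta : R).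
Hypotheses (HN : holo N a b l h) (Hac : a < c) (Hdb : d < b)
  (Heta : 0 < eta) (Hcp : c < p - eta) (Hpd : p + eta < d) (Hq : l < q < h)
  (Hchi : forall x, dC chi x (chi' x)) (Hchi' : forall x, ccont chi' x)
  (Hc0 : chi c = 0%C) (Hd0 : chi d = 0%C)
  (H1 : forall x, p - eta <= x <= p + eta -> chi x = 1%C).

Let G (w : C) : C := (N w * / (w - (p, q)))%C.
Let J (y : R) : C := CInt (fun x => G (x, y) * chi x)%C c d.

Lemma Cder_pole_factor (w : C) : w <> (p, q) ->
  exists k, Cder (fun w => / (w - (p, q)))%C w k.
Proof.
  intros Hw; eexists; apply (Cder_comp (fun w => / w)%C (fun w => w - (p, q))%C).
  - apply Cder_inv; intros E; apply Hw, Cminus_eq_0, E.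
  - apply Cder_minus; [apply Cder_id|apply Cder_const].
Qed.

Lemma holo_pole_strip l' h' :
  l <= l' -> h' <= h -> (q <= l' \/ h' <= q) -> holo G a b l' h'.
Proof.
  intros Hl Hh Hs x y Hx Hy.
  destruct (HN x y Hx ltac:(lra)) as [k Hk].
  destruct (Cder_pole_factor (x, y)) as [k2 Hk2].
  { intros E; injection E; lra. }
  eexists; apply Cder_mult; [exact Hk|exact Hk2].
Qed.

(** With [N = N(p, q) + (N - N(p, q))], the first part jumps by the residue and
    the second, divided by [w - (p, q)], extends continuously across the pole. *)
Lemma pole_jump : forall eps, 0 < eps -> exists s0, 0 < s0 /\ forall s, 0 < s < s0 ->
  Cmod (J (q - s) - J (q + s) - RtoC (2 * PI) * Ci * N (p, q)) <= eps.
Proof.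
  intros eps He.
  destruct (HN p q ltac:(lra) Hq) as [k Hk].
  set (M := fun w => if excluded_middle_informative (w = (p, q)) then k
    else ((N w - N (p, q)) * / (w - (p, q)))%C).
  assert (M0 : M (p, q) = k).
  { unfold M; destruct excluded_middle_informative; congruence. }
  assert (M1 : forall w : C, w <> (p, q) -> M w = ((N w - N (p, q)) * / (w - (p, q)))%C).
  { intros w Hw; unfold M; destruct excluded_middle_informative; congruence. }
  clearbody M.
  assert (chic : forall x, ccont chi x) by (intros x; eapply dC_cont, Hchi).
  assert (Mc : forall x y, a < x < b -> l < y < h -> ccont M (x, y)).
  { intros x y Hx Hy.
    destruct (excluded_middle_informative ((x, y) = (p, q))) as [E|E].
    - injection E; intros -> ->; apply ccont_iff; intros e Hepos; apply locally_Cmod.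
      rewrite Cder_iff in Hk; destruct (Hk (e / 2) ltac:(lra)) as [dl [Hdl HP]].
      exists dl; split; [exact Hdl|]; intros w Hw; rewrite M0.
      destruct (excluded_middle_informative (w = (p, q))) as [Ew|Ew];
        [rewrite Ew, M0|rewrite (M1 w Ew)].
      + replace (k - k)%C with (RtoC 0) by ring; rewrite Cmod_0; exact Hepos.
      + assert (Hw0 : (w - (p, q))%C <> 0%C).
        { intros E0; apply Ew, Cminus_eq_0, E0. }
        replace ((N w - N (p, q)) * / (w - (p, q)) - k)%C with
          ((N w - N (p, q) - k * (w - (p, q))) / (w - (p, q)))%C by (field; exact Hw0).
        rewrite Cmod_div by exact Hw0.
        specialize (HP w Hw). assert (0 < Cmod (w - (p, q))) by (apply Cmod_gt_0, Hw0).
        apply Rle_lt_trans with (e / 2); [|lra].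
        apply Rmult_le_reg_r with (Cmod (w - (p, q))); [assumption|].
        unfold Rdiv at 1; rewrite Rmult_assoc, Rinv_l, Rmult_1_r by lra. exact HP.
    - apply (ccont_comp_ext (fun w => (N w - N (p, q)) * / (w - (p, q)))%C).
      + assert (Hpos : 0 < Cmod ((x, y) - (p, q))).
        { apply Cmod_gt_0; intros E0; apply E.
          apply Cminus_eq_0, E0. }
        apply locally_Cmod; exists (Cmod ((x, y) - (p, q))); split; [exact Hpos|].
        intros w Hw; symmetry; apply M1; intros Ew.
        rewrite Ew, Cmod_minus_sym in Hw; lra.
      + apply ccont_mult.
        * apply ccont_minus; [|apply ccont_const].
          destruct (HN x y Hx Hy) as [k1 Hk1]; eapply Cder_cont, Hk1.
        * destruct (Cder_pole_factor (x, y) E) as [k1 Hk1]; eapply Cder_cont, Hk1. }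
  set (Phi := fun w => (M w * chi (fst w))%C).
  assert (Phic : forall x y, a < x < b -> l < y < h -> ccont Phi (x, y)).
  { intros x y Hx Hy; apply ccont_mult; [apply Mc; auto|].
    apply (continuous_comp (fun z : C => fst z) chi); [apply continuous_fst|apply chic]. }
  set (L := d - c). assert (HL : 0 < L) by (unfold L; lra).
  destruct (ccont_uniform_height Phi c d q) with (eps := eps / (4 * L)) as [s1 [Hs1 U]].
  { intros t Ht; apply Phic; lra. }
  { apply Rdiv_lt_0_compat; lra. }
  pose proof (Cmod_ge_0 (N (p, q))) as HN0.
  destruct (cauchy_kernel_jump chi c d p eta chic Heta Hcp Hpd H1
    (eps / (2 * (Cmod (N (p, q)) + 1)))) as [s2 [Hs2 Kj]].
  { apply Rdiv_lt_0_compat; lra. }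
  exists (Rmin (Rmin s1 s2) (Rmin (q - l) (h - q))); split.
  { repeat apply Rmin_glb_lt; lra. }
  intros s [Hs0 Hs].
  pose proof (Rmin_l (Rmin s1 s2) (Rmin (q - l) (h - q))).
  pose proof (Rmin_r (Rmin s1 s2) (Rmin (q - l) (h - q))).
  pose proof (Rmin_l s1 s2); pose proof (Rmin_r s1 s2).
  pose proof (Rmin_l (q - l) (h - q)); pose proof (Rmin_r (q - l) (h - q)).
  assert (Hex : forall y, l < y < h -> ex_CInt (fun x => Phi (x, y)) c d).
  { intros y Hy; apply ex_CInt_cont; intros x Hx; rewrite Rmin_left, Rmax_right in Hx by lra.
    apply (ccont_horizontal Phi), Phic; lra. }
  assert (Hexk : forall y, y <> 0 -> ex_CInt (fun x => / (x - p, y)%R * chi x)%C c d).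
  { intros y Hy; apply ex_CInt_cont; intros x _; apply ccont_mult; [|apply chic].
    apply ccont_inv; [apply ccont_pair; simpl|].
    - apply (continuous_minus (V := R_NormedModule)); [apply continuous_id|apply continuous_const].
    - apply continuous_const.
    - intros E; injection E; lra. }
  assert (Jd : forall y, l < y < h -> y <> q -> J y =
    (CInt (fun x => Phi (x, y)) c d + N (p, q) * CInt (fun x => / (x - p, y - q)%R * chi x)%C c d)%C).
  { intros y Hy Hyq.
    assert (Hy0 : y - q <> 0) by lra.
    rewrite <- (proj2 (CInt_scal (N (p, q)) _ c d (Hexk _ Hy0))).
    rewrite <- CInt_plus; [|apply Hex, Hy|apply CInt_scal, Hexk, Hy0].
    apply CInt_ext; intros x _; unfold G, Phi; simpl.
    rewrite M1 by (intros E; injection E; lra).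
    replace ((x, y) - (p, q))%C with ((x - p, y - q) : C)
      by (apply injective_projections; simpl; ring).
    ring. }
  rewrite (Jd (q - s)), (Jd (q + s)) by lra.
  replace (q - s - q) with (- s) by ring; replace (q + s - q) with s by ring.
  set (A1 := CInt (fun x => Phi (x, q - s)) c d).
  set (A2 := CInt (fun x => Phi (x, q + s)) c d).
  set (B1 := CInt (fun x => / (x - p, - s)%R * chi x)%C c d).
  set (B2 := CInt (fun x => / (x - p, s)%R * chi x)%C c d).
  assert (HA : Cmod (A1 - A2) <= eps / 2).
  { unfold A1, A2; rewrite <- CInt_minus by (apply Hex; lra).
    eapply Rle_trans; [apply (CInt_norm_const _ (eps / (2 * L)))|].
    - lra.
    - intros x Hx.
      pose proof (U x (q - s) Hx ltac:(apply Rabs_def1; lra)).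
      pose proof (U x (q + s) Hx ltac:(apply Rabs_def1; lra)).
      replace (Phi (x, (q - s)%R) - Phi (x, (q + s)%R))%C with
        ((Phi (x, (q - s)%R) - Phi (x, q)) - (Phi (x, (q + s)%R) - Phi (x, q)))%C by ring.
      eapply Rle_trans; [apply Cmod_triangle_minus|].
      replace (eps / (2 * L)) with (eps / (4 * L) + eps / (4 * L)) by (field; lra). lra.
    - apply (ex_RInt_minus (V := C_R_NormedModule)); apply Hex; lra.
    - fold L; right; field; lra. }
  assert (HB : Cmod (B1 - B2 - RtoC (2 * PI) * Ci) <= eps / (2 * (Cmod (N (p, q)) + 1))).
  { unfold B1, B2; rewrite <- CInt_minus by (apply Hexk; lra).
    rewrite (CInt_ext _ (fun x => (/ (x - p, - s)%R - / (x - p, s)%R) * chi x)%C)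
      by (intros; ring).
    apply Kj; lra. }
  replace (A1 + N (p, q) * B1 - (A2 + N (p, q) * B2) - RtoC (2 * PI) * Ci * N (p, q))%C
    with ((A1 - A2) + N (p, q) * (B1 - B2 - RtoC (2 * PI) * Ci))%C by ring.
  eapply Rle_trans; [apply Cmod_triangle|]; rewrite Cmod_mult.
  assert (Cmod (N (p, q)) * Cmod (B1 - B2 - RtoC (2 * PI) * Ci) <= eps / 2).
  { apply Rle_trans with ((Cmod (N (p, q)) + 1) * (eps / (2 * (Cmod (N (p, q)) + 1)))).
    - apply Rmult_le_compat; [lra|apply Cmod_ge_0|lra|exact HB].
    - right; field; lra. }
  lra.
Qed.

(** On each side of the pole the derivative in [y] of the pairing [J] is a
    pairing with [chi'], so [J] moves little when the contour is shifted; crossing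
    the pole adds the residue. *)
Lemma cauchy_estimate y1 y2 B :
  l < y1 < q -> q < y2 < h ->
  (forall y, y1 <= y <= y2 -> y <> q -> Cmod (CInt (fun x => G (x, y) * chi' x)%C c d) <= B) ->
  Cmod (J y1 - RtoC (2 * PI) * Ci * N (p, q)) <= Cmod (J y2) + (y2 - y1) * B.
Proof.
  intros Hy1 Hy2 HB.
  assert (mv : forall u v l' h', u <= v -> l <= l' -> h' <= h -> (q <= l' \/ h' <= q) ->
    l' < u -> v < h' -> y1 <= u -> v <= y2 -> Cmod (J v - J u) <= B * (v - u)).
  { intros u v l' h' Huv Hl Hh Hs Hu Hv Hu' Hv'.
    apply (dC_mean_value J (fun y => - Ci * CInt (fun x => G (x, y) * chi' x)%C c d)%C);
      [exact Huv| |].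
    - intros y Hy; unfold J.
      apply (dC_pairing G chi chi' a b l' h'); auto; try lra.
      apply holo_pole_strip; auto.
    - intros y Hy; rewrite Cmod_mult, Cmod_opp, Cmod_Ci, Rmult_1_l; apply HB; lra. }
  apply le_epsilon; intros eps He.
  destruct (pole_jump eps He) as [s0 [Hs0 Hj]].
  set (s := Rmin s0 (Rmin (q - y1) (y2 - q)) / 2).
  assert (0 < Rmin s0 (Rmin (q - y1) (y2 - q))) by (repeat apply Rmin_glb_lt; lra).
  pose proof (Rmin_l s0 (Rmin (q - y1) (y2 - q))); pose proof (Rmin_r s0 (Rmin (q - y1) (y2 - q))).
  pose proof (Rmin_l (q - y1) (y2 - q)); pose proof (Rmin_r (q - y1) (y2 - q)).
  assert (Hs : 0 < s < s0) by (unfold s; lra).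
  assert (Hs1 : s < q - y1) by (unfold s; lra).
  assert (Hs2 : s < y2 - q) by (unfold s; lra).
  specialize (Hj s Hs).
  pose proof (mv y1 (q - s) l q ltac:(lra) ltac:(lra) ltac:(lra) ltac:(lra) ltac:(lra)
    ltac:(lra) ltac:(lra) ltac:(lra)) as m1.
  pose proof (mv (q + s) y2 q h ltac:(lra) ltac:(lra) ltac:(lra) ltac:(lra) ltac:(lra)
    ltac:(lra) ltac:(lra) ltac:(lra)) as m2.
  assert (HB0 : 0 <= B).
  { eapply Rle_trans; [apply Cmod_ge_0|apply (HB y1); lra]. }
  set (T := (RtoC (2 * PI) * Ci * N (p, q))%C) in *.
  replace (J y1 - T)%C with
    ((J (q - s)%R - J (q + s)%R - T) + (J y2 - ((J (q - s)%R - J y1) + (J y2 - J (q + s)%R))))%C by ring.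
  eapply Rle_trans; [apply Cmod_triangle|].
  pose proof (Cmod_triangle_minus (J y2) ((J (q - s)%R - J y1) + (J y2 - J (q + s)%R))%C).
  pose proof (Cmod_triangle (J (q - s) - J y1) (J y2 - J (q + s))).
  assert (B * (q - s - y1) + B * (y2 - (q + s)) <= (y2 - y1) * B) by nra.
  lra.
Qed.

End Pole.

(** * Functions with bounded iterated derivatives *)

(** The operator iterated is [f |-> m * f']. For [m = 1] these are the
    [C^n]-norms; for [m x = x - x0] it is the derivative in the variable
    [log |x - x0|], which commutes with dilations about [x0]. The bound is a
    function, so that estimates of different kinds on different parts of the
    line are carried at once. *)
Fixpoint dbound (m : R -> R) (n : nat) (f : R -> C) (w : R -> R) : Prop :=
  (forall x, Cmod (f x) <= w x) /\
  match n with
  | O => True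
  | S k => exists f', (forall x, dC f x (f' x)) /\ dbound m k (fun x => m x * f' x)%C w
  end.

Definition one_field (x : R) : R := 1.

Lemma dbound_value m n f w x : dbound m n f w -> Cmod (f x) <= w x.
Proof. destruct n; intros [H _]; apply H. Qed.

Lemma dbound_pos m n f w x : dbound m n f w -> 0 <= w x.
Proof. intros H; eapply Rle_trans; [apply Cmod_ge_0|eapply dbound_value, H]. Qed.

Lemma dbound_weaken m n f w w' : (forall x, w x <= w' x) -> dbound m n f w -> dbound m n f w'.
Proof.
  intros Hw; revert f; induction n as [|n IH]; intros f [H1 H2]; split;
    try (intros x; eapply Rle_trans; [apply H1|apply Hw]); [exact I|].
  destruct H2 as [f' [Hf H]]; exists f'; auto.
Qed.

Lemma dbound_pred m n f w : dbound m (S n) f w -> dbound m n f w.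
Proof.
  revert f; induction n as [|n IH]; intros f [H1 [f' [Hf H]]]; split; auto.
  exists f'; auto.
Qed.

Lemma dbound_le m k n f w : (k <= n)%nat -> dbound m n f w -> dbound m k f w.
Proof. intros H; induction H; auto using dbound_pred. Qed.

Lemma dbound_plus m n f g w1 w2 : dbound m n f w1 -> dbound m n g w2 ->
  dbound m n (fun x => f x + g x)%C (fun x => w1 x + w2 x).
Proof.
  revert f g; induction n as [|n IH]; intros f g [F1 F2] [G1 G2]; split;
    try (intros x; eapply Rle_trans; [apply Cmod_triangle|];
         apply Rplus_le_compat; auto); [exact I|].
  destruct F2 as [f' [Hf F]]; destruct G2 as [g' [Hg G]].
  exists (fun x => f' x + g' x)%C; split; [intros x; apply dC_plus; auto|].
  replace (fun x => m x * (f' x + g' x))%C with (fun x => m x * f' x + m x * g' x)%C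
    by (extensionality x; ring).
  apply IH; assumption.
Qed.

Lemma dbound_scal m n f w c : dbound m n f w ->
  dbound m n (fun x => c * f x)%C (fun x => Cmod c * w x).
Proof.
  revert f; induction n as [|n IH]; intros f [F1 F2]; split;
    try (intros x; rewrite Cmod_mult; apply Rmult_le_compat_l; [apply Cmod_ge_0|auto]);
    [exact I|].
  destruct F2 as [f' [Hf F]].
  exists (fun x => c * f' x)%C; split; [intros x; apply dC_scal; auto|].
  replace (fun x => m x * (c * f' x))%C with (fun x => c * (m x * f' x))%C
    by (extensionality x; ring).
  apply IH; assumption.
Qed.

Lemma dbound_mult m n f g w1 w2 : dbound m n f w1 -> dbound m n g w2 ->
  dbound m n (fun x => f x * g x)%C (fun x => 2 ^ n * (w1 x * w2 x)).
Proof.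
  assert (B : forall n (f g : R -> C) x, 0 <= w1 x -> 0 <= w2 x ->
    Cmod (f x) <= w1 x -> Cmod (g x) <= w2 x ->
    Cmod (f x * g x) <= 2 ^ n * (w1 x * w2 x)).
  { intros k p q x P1 P2 A1 A2; rewrite Cmod_mult.
    apply Rle_trans with (1 * (w1 x * w2 x)).
    - rewrite Rmult_1_l; apply Rmult_le_compat; auto using Cmod_ge_0.
    - apply Rmult_le_compat_r; [apply Rmult_le_pos; auto|].
      apply pow_R1_Rle; lra. }
  revert f g; induction n as [|n IH]; intros f g F G.
  - split; [intros x|exact I].
    apply (B 0%nat); eauto using dbound_pos, dbound_value.
  - pose proof F as [F1 [f' [Hf F']]]; pose proof G as [G1 [g' [Hg G']]].
    split; [intros x; apply (B (S n)); eauto using dbound_pos, dbound_value|].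
    exists (fun x => f' x * g x + f x * g' x)%C; split; [intros x; apply dC_mult; auto|].
    replace (fun x => m x * (f' x * g x + f x * g' x))%C
      with (fun x => (m x * f' x) * g x + f x * (m x * g' x))%C
      by (extensionality x; ring).
    apply (dbound_weaken m n _ (fun x => 2 ^ n * (w1 x * w2 x) + 2 ^ n * (w1 x * w2 x))).
    + intros x; simpl; lra.
    + apply dbound_plus; apply IH; auto using dbound_pred.
Qed.

Lemma dbound_zero m n w : (forall x, 0 <= w x) -> dbound m n (fun _ => 0%C) w.
Proof.
  intros Hw; induction n as [|n IH]; split; try (intros x; rewrite Cmod_0; auto); [exact I|].
  exists (fun _ => 0%C); split; [intros x; apply dC_const|].
  replace (fun x => m x * 0)%C with (fun _ : R => RtoC 0) by (extensionality x; ring).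
  exact IH.
Qed.

Lemma dbound_const m n c : dbound m n (fun _ => c) (fun _ => Cmod c).
Proof.
  destruct n; split; try (intros x; lra); [exact I|].
  exists (fun _ => 0%C); split; [intros x; apply dC_const|].
  replace (fun x => m x * 0)%C with (fun _ : R => RtoC 0) by (extensionality x; ring).
  apply dbound_zero; intros; apply Cmod_ge_0.
Qed.

(** On an open set where [f] vanishes all its iterated derivatives vanish too,
    so there the weight may be replaced by any nonnegative one. *)
Lemma dbound_localize m n (f : R -> C) w w' (U : R -> Prop) :
  (forall x, U x -> locally x U) -> (forall x, U x -> f x = 0%C) ->
  (forall x, 0 <= w' x) -> (forall x, ~ U x -> w x <= w' x) ->
  dbound m n f w -> dbound m n f w'.
Proof.
  intros HU Hf Hpos Hle.
  assert (B : forall (f : R -> C) x, (forall x, U x -> f x = 0%C) -> Cmod (f x) <= w x -> Cmod (f x) <= w' x).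
  { intros g x Hg Hx; destruct (excluded_middle_informative (U x)) as [Ux|Ux].
    - rewrite (Hg x Ux), Cmod_0; auto.
    - eapply Rle_trans; [exact Hx|auto]. }
  revert f Hf; induction n as [|n IH]; intros f Hf [F1 F2]; split; auto.
  destruct F2 as [f' [Hd F]]; exists f'; split; [exact Hd|].
  apply IH; [|exact F].
  intros x Ux; replace (f' x) with (RtoC 0); [ring|].
  apply (dC_unique (fun _ => 0%C) x); [apply dC_const|].
  apply (dC_ext_loc f); [|apply Hd].
  generalize (HU x Ux); apply filter_imp; exact Hf.
Qed.

Lemma dbound_affine m1 m2 n (f : R -> C) w c x0 k :
  (forall x, m2 x * c = k * m1 (c * (x - x0))) -> dbound m1 n f w ->
  dbound m2 n (fun x => f (c * (x - x0))) (fun x => (1 + Rabs k) ^ n * w (c * (x - x0))).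
Proof.
  intros Hm.
  assert (Hk : 1 <= 1 + Rabs k) by (pose proof (Rabs_pos k); lra).
  assert (B : forall n (f : R -> C) x, 0 <= w (c * (x - x0)) ->
    Cmod (f (c * (x - x0))) <= w (c * (x - x0)) ->
    Cmod (f (c * (x - x0))) <= (1 + Rabs k) ^ n * w (c * (x - x0))).
  { intros i g x Hw H; eapply Rle_trans; [exact H|].
    rewrite <- (Rmult_1_l (w _)) at 1; apply Rmult_le_compat_r; [exact Hw|].
    apply pow_R1_Rle; exact Hk. }
  revert f; induction n as [|n IH]; intros f F.
  - split; [intros x|exact I]; apply (B 0%nat); eauto using dbound_pos, dbound_value.
  - split; [intros x; apply (B (S n)); eauto using dbound_pos, dbound_value|].
    destruct F as [F1 [f' [Hf F]]].
    exists (fun x => RtoC c * f' (c * (x - x0))%R)%C; split.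
    + intros x; apply (dC_comp f (fun x => c * (x - x0))); [apply Hf|].
      auto_derive; [trivial|ring].
    + replace (fun x => m2 x * (c * f' (c * (x - x0))%R))%C
        with (fun x => RtoC k * ((m1 (c * (x - x0))%R) * f' (c * (x - x0))%R))%C.
      2: { extensionality x; rewrite !Cmult_assoc, <- !RtoC_mult, Hm; reflexivity. }
      apply (dbound_weaken m2 n _ (fun x => Cmod k * ((1 + Rabs k) ^ n * w (c * (x - x0))))).
      * intros x; rewrite Cmod_R; simpl.
        assert (0 <= (1 + Rabs k) ^ n * w (c * (x - x0))).
        { apply Rmult_le_pos; [apply pow_le; lra|]. eapply dbound_pos, F. }
        lra.
      * apply dbound_scal, (IH (fun x => m1 x * f' x)%C F).
Qed.

(** * Smooth functions and test functions *)

Definition Smooth (f : R -> C) : Prop := forall n, exists w, dbound one_field n f w.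

Lemma one_mult (f : R -> C) : (fun x => one_field x * f x)%C = f.
Proof. extensionality x; unfold one_field; ring. Qed.

Lemma Smooth_deriv f : Smooth f -> exists f', (forall x, dC f x (f' x)) /\ Smooth f'.
Proof.
  intros H; destruct (H 1%nat) as [w [_ [f' [Hf _]]]].
  exists f'; split; [exact Hf|]; intros n.
  destruct (H (S n)) as [w2 [_ [f2 [Hf2 F]]]]; exists w2.
  rewrite one_mult in F.
  replace f' with f2; [exact F|].
  extensionality x; eapply dC_unique; [apply Hf2|apply Hf].
Qed.

Lemma Smooth_intro f f' : (forall x, dC f x (f' x)) -> Smooth f' -> Smooth f.
Proof.
  intros Hf H [|n].
  - exists (fun x => Cmod (f x)); split; [intros; lra|exact I].
  - destruct (H n) as [w Hw]; exists (fun x => Cmod (f x) + w x); split.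
    + intros x; pose proof (dbound_pos _ _ _ _ x Hw); lra.
    + exists f'; split; [exact Hf|]; rewrite one_mult.
      revert Hw; apply dbound_weaken; intros x; pose proof (Cmod_ge_0 (f x)); lra.
Qed.

Lemma Smooth_cont f x : Smooth f -> ccont f x.
Proof. intros H; destruct (Smooth_deriv f H) as [f' [Hf _]]; eapply dC_cont, Hf. Qed.

Lemma Smooth_plus f g : Smooth f -> Smooth g -> Smooth (fun x => f x + g x)%C.
Proof.
  intros F G n; destruct (F n) as [w1 H1]; destruct (G n) as [w2 H2].
  eexists; apply dbound_plus; eassumption.
Qed.

Lemma Smooth_mult f g : Smooth f -> Smooth g -> Smooth (fun x => f x * g x)%C.
Proof.
  intros F G n; destruct (F n) as [w1 H1]; destruct (G n) as [w2 H2].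
  eexists; apply dbound_mult; eassumption.
Qed.

Lemma Smooth_scal c f : Smooth f -> Smooth (fun x => c * f x)%C.
Proof. intros F n; destruct (F n) as [w H]; eexists; apply dbound_scal; eassumption. Qed.

Lemma Smooth_const c : Smooth (fun _ => c).
Proof. intros n; eexists; apply dbound_const. Qed.

Lemma Smooth_affine f c x0 : Smooth f -> Smooth (fun x => f (c * (x - x0))).
Proof.
  intros F n; destruct (F n) as [w H]; eexists.
  apply (dbound_affine one_field one_field n f w c x0 c); [intros; unfold one_field; ring|exact H].
Qed.

Lemma Smooth_id x0 : Smooth (fun x => RtoC (x - x0)).
Proof.
  apply (Smooth_intro _ (fun _ => RtoC 1)); [|apply Smooth_const].
  intros x; apply dC_RtoC; auto_derive; [trivial|ring].
Qed.

Lemma Smooth_compact_bound (f : R -> C) A : Smooth f -> 0 <= A ->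
  (forall x, ~ (- A <= x <= A) -> f x = 0%C) -> exists M, 0 <= M /\ forall x, Cmod (f x) <= M.
Proof.
  intros F HA Hf.
  destruct (continuity_ab_maj (fun x => Cmod (f x)) (- A) A) as [m [Hm _]]; [lra| |].
  - intros x _; apply continuity_pt_filterlim, continuous_Cmod, Smooth_cont, F.
  - exists (Cmod (f m)); split; [apply Cmod_ge_0|]; intros x.
    destruct (excluded_middle_informative (- A <= x <= A)) as [H|H]; [auto|].
    rewrite (Hf x H), Cmod_0; apply Cmod_ge_0.
Qed.

Lemma deriv_support (f f' : R -> C) c d :
  (forall x, dC f x (f' x)) -> (forall x, ~ (c <= x <= d) -> f x = 0%C) ->
  forall x, ~ (c <= x <= d) -> f' x = 0%C.
Proof.
  intros Hd Hf x Hx.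
  apply (dC_unique f x); [apply Hd|].
  apply (dC_ext_loc (fun _ => 0%C)); [|apply dC_const].
  generalize (locally_off_interval c d x Hx); apply filter_imp.
  intros y Hy; symmetry; apply Hf, Hy.
Qed.

Lemma dbound_compact m n (f : R -> C) A : Smooth (fun x => RtoC (m x)) -> Smooth f -> 0 <= A ->
  (forall x, ~ (- A <= x <= A) -> f x = 0%C) -> exists M, 0 <= M /\ dbound m n f (fun _ => M).
Proof.
  intros Hm F HA; revert f F; induction n as [|n IH]; intros f F Hf;
    destruct (Smooth_compact_bound f A F HA Hf) as [M [HM0 HM]].
  - exists M; repeat split; auto.
  - destruct (Smooth_deriv f F) as [f' [Hd F']].
    destruct (IH (fun x => m x * f' x)%C) as [M2 [HM2 H2]].
    + apply Smooth_mult; assumption.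
    + intros x Hx; rewrite (deriv_support f f' _ _ Hd Hf x Hx); ring.
    + exists (M + M2); split; [lra|]; split; [intros x; specialize (HM x); lra|].
      exists f'; split; [exact Hd|]; revert H2; apply dbound_weaken; intros; lra.
Qed.

Lemma smooth_Smooth phi : smooth phi -> Smooth phi.
Proof.
  intros H n.
  assert (G : forall n k, exists w, dbound one_field n (CDerive_n phi k) w).
  { clear n; induction n as [|n IH]; intros k.
    - exists (fun x => Cmod (CDerive_n phi k x)); split; [intros; lra|exact I].
    - destruct (IH (S k)) as [w Hw].
      exists (fun x => Cmod (CDerive_n phi k x) + w x); split.
      + intros x; pose proof (dbound_pos _ _ _ _ x Hw); lra.
      + exists (CDerive_n phi (S k)); split.
        * intros x; destruct (H (S k) x) as [H1 H2].
          apply dC_pair; simpl; apply Derive_correct; [exact H1|exact H2].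
        * rewrite one_mult; revert Hw; apply dbound_weaken; intros x.
          pose proof (Cmod_ge_0 (CDerive_n phi k x)); lra. }
  destruct (G n 0%nat) as [w Hw]; exists w.
  replace phi with (CDerive_n phi 0); [exact Hw|].
  extensionality x; unfold CDerive_n; simpl; destruct (phi x); reflexivity.
Qed.

Lemma Smooth_smooth phi : Smooth phi -> smooth phi.
Proof.
  intros H.
  assert (G : forall k, exists g, Smooth g /\
    Derive_n (fun t => Re (phi t)) k = (fun x => fst (g x)) /\
    Derive_n (fun t => Im (phi t)) k = (fun x => snd (g x))).
  { induction k as [|k [g [Hg [E1 E2]]]].
    - exists phi; repeat split; auto.
    - destruct (Smooth_deriv g Hg) as [g' [Hd Hg']]; exists g'; split; [exact Hg'|].
      simpl; rewrite E1, E2; split; extensionality x; apply is_derive_unique.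
      + apply dC_fst, Hd.
      + apply dC_snd, Hd. }
  intros [|k] x; [split; exact I|].
  destruct (G k) as [g [Hg [E1 E2]]]; destruct (Smooth_deriv g Hg) as [g' [Hd _]].
  simpl; split.
  - exists (fst (g' x)); apply (is_derive_ext (fun x => fst (g x))).
    + intros t; symmetry; exact (f_equal (fun h => h t) E1).
    + apply dC_fst, Hd.
  - exists (snd (g' x)); apply (is_derive_ext (fun x => snd (g x))).
    + intros t; symmetry; exact (f_equal (fun h => h t) E2).
    + apply dC_snd, Hd.
Qed.

Lemma CDerive_n_1 f f' : (forall x, dC f x (f' x)) -> CDerive_n f 1 = f'.
Proof.
  intros H; extensionality x; unfold CDerive_n; simpl.
  apply injective_projections; simpl; apply is_derive_unique.
  - apply (dC_fst f), H.
  - apply (dC_snd f), H.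
Qed.

Definition D_on (c d : R) (phi : R -> C) : Prop :=
  Smooth phi /\ forall x, ~ (c <= x <= d) -> phi x = 0%C.

Lemma support_D_on c d phi x : D_on c d phi -> support phi x -> c <= x <= d.
Proof.
  intros [_ Hz] Hx.
  destruct (Rlt_or_le x c) as [H|H]; [|destruct (Rlt_or_le d x) as [H'|H']; [|lra]]; exfalso.
  - destruct (Hx (fun y => y < c)) as [y [Hy1 Hy2]].
    + exists (mkposreal (c - x) ltac:(lra)); intros y Hy; unfold disc in Hy; simpl in Hy.
      apply Rabs_def2 in Hy; lra.
    + apply Hy2, Hz; lra.
  - destruct (Hx (fun y => d < y)) as [y [Hy1 Hy2]].
    + exists (mkposreal (x - d) ltac:(lra)); intros y Hy; unfold disc in Hy; simpl in Hy.
      apply Rabs_def2 in Hy; lra.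
    + apply Hy2, Hz; lra.
Qed.

Lemma D_on_test c d phi (U : R -> Prop) :
  D_on c d phi -> (forall x, c <= x <= d -> U x) -> test_function U phi.
Proof.
  intros HD HU; split; [apply Smooth_smooth, HD|split].
  - apply (compact_P4 (fun x => c <= x <= d)); [apply compact_P3| |].
    + apply adherence_P3.
    + intros x Hx; eapply support_D_on; eassumption.
  - intros x Hx; apply HU; eapply support_D_on; eassumption.
Qed.

Lemma test_D_on U phi : test_function U phi -> exists A, 0 < A /\ D_on (- A) A phi.
Proof.
  intros [Hs [Hc _]].
  destruct (compact_P1 _ Hc) as [m [M HM]].
  exists (Rabs m + Rabs M + 1).
  pose proof (Rabs_pos m); pose proof (Rabs_pos M).
  split; [lra|]; split; [apply smooth_Smooth, Hs|].
  intros x Hx.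
  destruct (excluded_middle_informative (phi x = 0%C)) as [E|E]; [exact E|exfalso].
  assert (Hsup : support phi x) by (apply adherence_P1, E).
  specialize (HM x Hsup). apply Hx.
  pose proof (Rle_abs M); pose proof (Rle_abs (- m)) as Hm; rewrite Rabs_Ropp in Hm; lra.
Qed.

Lemma D_on_deriv c d phi phi' :
  D_on c d phi -> (forall x, dC phi x (phi' x)) -> D_on c d phi'.
Proof.
  intros [H1 H2] Hd; split.
  - destruct (Smooth_deriv phi H1) as [g [Hg HS]].
    replace phi' with g; [exact HS|]; extensionality x; eapply dC_unique; eauto.
  - apply (deriv_support phi phi' c d Hd H2).
Qed.

Lemma D_on_mult_r c d phi g : D_on c d phi -> Smooth g -> D_on c d (fun x => g x * phi x)%C.
Proof.
  intros [H1 H2] G; split; [apply Smooth_mult; assumption|].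
  intros x Hx; rewrite (H2 x Hx); ring.
Qed.

Lemma D_on_plus c d f g : D_on c d f -> D_on c d g -> D_on c d (fun x => f x + g x)%C.
Proof.
  intros [F1 F2] [G1 G2]; split; [apply Smooth_plus; assumption|].
  intros x Hx; rewrite (F2 x Hx), (G2 x Hx); ring.
Qed.

Lemma D_on_widen c d c' d' f : c' <= c -> d <= d' -> D_on c d f -> D_on c' d' f.
Proof. intros Hc Hd [F1 F2]; split; [exact F1|]; intros x Hx; apply F2; lra. Qed.

(** * Uniform boundedness on spaces of test functions *)

Lemma third_pow_pos n : 0 < (1 / 3) ^ n.
Proof. apply pow_lt; lra. Qed.

Lemma third_pow_arch (K eps : R) : 0 < eps -> exists n0, forall n, (n0 <= n)%nat -> K * (1 / 3) ^ n < eps.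
Proof.
  intros He.
  destruct (Rle_or_lt K 0) as [HK|HK].
  { exists 0%nat; intros n _; pose proof (third_pow_pos n); nra. }
  destruct (pow_lt_1_zero (1 / 3) ltac:(rewrite Rabs_pos_eq; lra) (eps / K)
    ltac:(apply Rdiv_lt_0_compat; lra)) as [n0 Hn0].
  exists n0; intros n Hn; specialize (Hn0 n Hn).
  rewrite Rabs_pos_eq in Hn0 by (left; apply third_pow_pos).
  apply Rmult_lt_compat_l with (r := K) in Hn0; [|exact HK].
  replace (K * (eps / K)) with eps in Hn0 by (field; lra). exact Hn0.
Qed.

Lemma geometric_limit_R (u : nat -> R) J :
  (forall n, (J <= n)%nat -> Rabs (u (S n) - u n) <= (1 / 3) ^ n) ->
  exists l, forall n, (J <= n)%nat -> Rabs (l - u n) <= 3 / 2 * (1 / 3) ^ n.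
Proof.
  intros H.
  destruct (nested_intervals (fun n => u (J + n)%nat - 3 / 2 * (1 / 3) ^ (J + n))
    (fun n => 3 * (1 / 3) ^ (J + n))) as [X HX].
  - intros n; rewrite Nat.add_succ_r; specialize (H (J + n)%nat ltac:(lia)).
    apply Rabs_le_between in H; simpl; lra.
  - intros n; rewrite Nat.add_succ_r; specialize (H (J + n)%nat ltac:(lia)).
    apply Rabs_le_between in H; simpl; lra.
  - intros n; pose proof (third_pow_pos (J + n)); lra.
  - exists X; intros n Hn; specialize (HX (n - J)%nat).
    replace (J + (n - J))%nat with n in HX by lia.
    apply Rabs_le; lra.
Qed.

Lemma geometric_limit (u : nat -> C) J :
  (forall n, (J <= n)%nat -> Cmod (u (S n) - u n) <= (1 / 3) ^ n) ->
  exists l, forall n, (J <= n)%nat -> Cmod (l - u n) <= 3 * (1 / 3) ^ n.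
Proof.
  intros H.
  destruct (geometric_limit_R (fun n => fst (u n)) J) as [l1 H1].
  { intros n Hn; eapply Rle_trans; [|apply H, Hn].
    apply (fst_le_Cmod (u (S n) - u n)%C). }
  destruct (geometric_limit_R (fun n => snd (u n)) J) as [l2 H2].
  { intros n Hn; eapply Rle_trans; [|apply H, Hn].
    apply (snd_le_Cmod (u (S n) - u n)%C). }
  exists (l1, l2); intros n Hn; eapply Rle_trans; [apply Cmod_le_sum|]; simpl.
  specialize (H1 n Hn); specialize (H2 n Hn); unfold Rminus in *; lra.
Qed.

Fixpoint psum (phi : nat -> R -> C) (n : nat) (x : R) : C :=
  match n with O => 0%C | S k => (psum phi k x + phi k x)%C end.

Lemma psum_derive phi phi' n x : (forall j x, dC (phi j) x (phi' j x)) ->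
  dC (psum phi n) x (psum phi' n x).
Proof.
  intros H; induction n as [|n IH]; simpl; [apply dC_const|].
  apply dC_plus; [exact IH|apply H].
Qed.

Lemma psum_tail phi J x : (forall j, (J <= j)%nat -> Cmod (phi j x) <= (1 / 3) ^ j) ->
  forall n k, (J <= n)%nat -> Cmod (psum phi (n + k) x - psum phi n x) <= 3 / 2 * (1 / 3) ^ n.
Proof.
  intros H n k Hn.
  assert (G : Cmod (psum phi (n + k) x - psum phi n x) <= 3 / 2 * ((1 / 3) ^ n - (1 / 3) ^ (n + k))).
  { induction k as [|k IH].
    - rewrite Nat.add_0_r; replace (_ - _)%C with (RtoC 0) by ring; rewrite Cmod_0; lra.
    - rewrite Nat.add_succ_r; simpl psum.
      replace (psum phi (n + k) x + phi (n + k)%nat x - psum phi n x)%C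
        with ((psum phi (n + k) x - psum phi n x) + phi (n + k)%nat x)%C by ring.
      eapply Rle_trans; [apply Cmod_triangle|].
      specialize (H (n + k)%nat ltac:(lia)); simpl pow; lra. }
  pose proof (third_pow_pos (n + k)); lra.
Qed.

(** Termwise differentiation of a geometrically convergent series. *)
Lemma series_derive phi phi' (Phi Psi : R -> C) J :
  (forall j x, dC (phi j) x (phi' j x)) ->
  (forall j x, (J <= j)%nat -> Cmod (phi' j x) <= (1 / 3) ^ j) ->
  (forall n x, (J <= n)%nat -> Cmod (Phi x - psum phi n x) <= 3 * (1 / 3) ^ n) ->
  (forall n x, (J <= n)%nat -> Cmod (Psi x - psum phi' n x) <= 3 * (1 / 3) ^ n) ->
  forall x, dC Phi x (Psi x).
Proof.
  intros Hd Hb HPhi HPsi x; apply dC_eps; intros eps He.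
  destruct (third_pow_arch 5 (eps / 2) ltac:(lra)) as [n0 Hn0].
  set (n := Nat.max n0 J). specialize (Hn0 n ltac:(lia)).
  assert (HnJ : (J <= n)%nat) by lia.
  (* the tail is Lipschitz, being a limit of sums with small derivative *)
  assert (T : forall y, Cmod ((Phi y - psum phi n y) - (Phi x - psum phi n x))
    <= 2 * (1 / 3) ^ n * Rabs (y - x)).
  { intros y; apply le_epsilon; intros e Hepos.
    destruct (third_pow_arch 6 e Hepos) as [m0 Hm0].
    set (m := (n + m0)%nat). specialize (Hm0 m ltac:(lia)).
    assert (HmJ : (J <= m)%nat) by lia.
    assert (MV : Cmod ((psum phi m y - psum phi n y) - (psum phi m x - psum phi n x))
      <= 3 / 2 * (1 / 3) ^ n * Rabs (y - x)).
    { assert (D : forall t, dC (fun t => psum phi m t - psum phi n t)%C t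
        (psum phi' m t - psum phi' n t)%C) by (intros; apply dC_minus; apply psum_derive; auto).
      assert (B : forall t, Cmod (psum phi' m t - psum phi' n t) <= 3 / 2 * (1 / 3) ^ n).
      { intros t; apply (psum_tail phi' J); auto. }
      destruct (Rle_or_lt x y) as [Hxy|Hxy].
      - rewrite Rabs_pos_eq by lra.
        apply (dC_mean_value (fun t => psum phi m t - psum phi n t)%C
          (fun t => psum phi' m t - psum phi' n t)%C); auto.
      - rewrite Rabs_minus_sym, Rabs_pos_eq by lra. rewrite Cmod_minus_sym.
        apply (dC_mean_value (fun t => psum phi m t - psum phi n t)%C
          (fun t => psum phi' m t - psum phi' n t)%C); auto; lra. }
    pose proof (HPhi m x HmJ) as P1; pose proof (HPhi m y HmJ) as P2.
    replace (Phi y - psum phi n y - (Phi x - psum phi n x))%C with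
      (((psum phi m y - psum phi n y) - (psum phi m x - psum phi n x))
       + ((Phi y - psum phi m y) - (Phi x - psum phi m x)))%C by ring.
    eapply Rle_trans; [apply Cmod_triangle|].
    pose proof (Cmod_triangle_minus (Phi y - psum phi m y) (Phi x - psum phi m x)).
    pose proof (third_pow_pos n); pose proof (Rabs_pos (y - x)).
    assert (0 <= (1 / 3) ^ n * Rabs (y - x)) by (apply Rmult_le_pos; lra).
    lra. }
  assert (D := psum_derive phi phi' n x Hd).
  destruct D as [_ D].
  specialize (D x (fun P HP => HP) (mkposreal (eps / 2) ltac:(lra))).
  destruct D as [dl Hdl]; exists dl; split; [apply cond_pos|]; intros y Hy.
  specialize (Hdl y Hy); rewrite norm_C_R in Hdl.
  match type of Hdl with Cmod ?A <= _ => replace A with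
    (psum phi n y - psum phi n x - RtoC (y - x) * psum phi' n x)%C in Hdl end.
  2: { apply injective_projections; simpl; unfold scal, minus, plus, opp; simpl;
       unfold mult; simpl; ring. }
  change (norm (minus y x)) with (Rabs (y - x)) in Hdl; simpl in Hdl.
  replace (Phi y - Phi x - (y - x)%R * Psi x)%C with
    (((Phi y - psum phi n y) - (Phi x - psum phi n x))
     + (psum phi n y - psum phi n x - (y - x)%R * psum phi' n x)
     - (y - x)%R * (Psi x - psum phi' n x))%C by ring.
  eapply Rle_trans; [apply Cmod_triangle_minus|].
  eapply Rle_trans; [apply Rplus_le_compat_r, Cmod_triangle|].
  rewrite Cmod_mult, Cmod_R.
  specialize (T y); pose proof (HPsi n x HnJ) as P3.
  pose proof (Rabs_pos (y - x)).
  assert (Rabs (y - x) * Cmod (Psi x - psum phi' n x) <= Rabs (y - x) * (3 * (1 / 3) ^ n))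
    by (apply Rmult_le_compat_l; lra).
  assert (Rabs (y - x) * (5 * (1 / 3) ^ n) <= Rabs (y - x) * (eps / 2))
    by (apply Rmult_le_compat_l; lra).
  lra.
Qed.

Lemma series_limit phi J :
  (forall j x, (J <= j)%nat -> Cmod (phi j x) <= (1 / 3) ^ j) ->
  exists Phi : R -> C, forall n x, (J <= n)%nat -> Cmod (Phi x - psum phi n x) <= 3 * (1 / 3) ^ n.
Proof.
  intros H.
  assert (G : forall x, exists l, forall n, (J <= n)%nat -> Cmod (l - psum phi n x) <= 3 * (1 / 3) ^ n).
  { intros x; apply (geometric_limit (fun n => psum phi n x)); intros n Hn; simpl.
    replace (psum phi n x + phi n x - psum phi n x)%C with (phi n x) by ring; auto. }
  exists (fun x => proj1_sig (constructive_indefinite_description _ (G x))).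
  intros n x; destruct (constructive_indefinite_description _ (G x)); simpl; auto.
Qed.

Lemma series_smooth phi (Phi : R -> C) J :
  (forall j, Smooth (phi j)) ->
  (forall k j, (J + k <= j)%nat -> dbound one_field k (phi j) (fun _ => (1 / 3) ^ j)) ->
  (forall n x, (J <= n)%nat -> Cmod (Phi x - psum phi n x) <= 3 * (1 / 3) ^ n) ->
  Smooth Phi.
Proof.
  intros HS HB HP n; revert phi Phi J HS HB HP.
  induction n as [|n IH]; intros phi Phi J HS HB HP.
  - exists (fun x => Cmod (Phi x)); split; [intros; lra|exact I].
  - assert (G : forall j, exists g, (forall x, dC (phi j) x (g x)) /\ Smooth g)
      by (intros j; apply Smooth_deriv, HS).
    set (phi' := fun j => proj1_sig (constructive_indefinite_description _ (G j))).
    assert (Hd : forall j x, dC (phi j) x (phi' j x)).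
    { intros j; unfold phi'; destruct constructive_indefinite_description as [g [H1 H2]]; exact H1. }
    assert (HS' : forall j, Smooth (phi' j)).
    { intros j; unfold phi'; destruct constructive_indefinite_description as [g [H1 H2]]; exact H2. }
    clearbody phi'.
    assert (HB' : forall k j, (S J + k <= j)%nat -> dbound one_field k (phi' j) (fun _ => (1 / 3) ^ j)).
    { intros k j Hj; destruct (HB (S k) j ltac:(lia)) as [_ [g [Hg H]]].
      rewrite one_mult in H; replace (phi' j) with g; [exact H|].
      extensionality x; eapply dC_unique; [apply Hg|apply Hd]. }
    destruct (series_limit phi' (S J)) as [Psi HPsi].
    { intros j x Hj; apply (dbound_value _ _ _ _ x (HB' 0%nat j ltac:(lia))). }
    destruct (IH phi' Psi (S J) HS' HB' HPsi) as [w Hw].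
    exists (fun x => Cmod (Phi x) + w x); split.
    + intros x; pose proof (dbound_pos _ _ _ _ x Hw); lra.
    + exists Psi; split.
      * apply (series_derive phi phi' Phi Psi (S J)); auto.
        -- intros j x Hj; apply (dbound_value _ _ _ _ x (HB' 0%nat j ltac:(lia))).
        -- intros m x Hm; apply HP; lia.
      * rewrite one_mult; revert Hw; apply dbound_weaken; intros x.
        pose proof (Cmod_ge_0 (Phi x)); lra.
Qed.

(** A gliding hump with signs: if the bounds fail for every order [n], pick
    functionals of norm at least [6 ^ n] for the [C^n]-norm and unit vectors
    [phi_n] where this norm is almost attained. One of the two signs in
    [x_n = x_(n-1) +- 3 ^ -n phi_n] makes the [n]-th functional large on
    [x_n]; with [3 / 4] of the norm attained, the later terms, of total size
    [1 / 2 * 3 ^ -n], leave a quarter of [6 ^ n * 3 ^ -n = 2 ^ n]. *)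
Theorem uniform_boundedness (I : Type) (T : I -> (R -> C) -> C) (c d : R) :
  (forall i phi psi, D_on c d phi -> D_on c d psi ->
     T i (fun x => phi x + psi x)%C = (T i phi + T i psi)%C) ->
  (forall i (k : R) phi, D_on c d phi -> T i (fun x => k * phi x)%C = (k * T i phi)%C) ->
  (forall i, exists A, 0 <= A /\ forall phi M, D_on c d phi ->
     (forall x, Cmod (phi x) <= M) -> Cmod (T i phi) <= A * M) ->
  (forall phi, D_on c d phi -> exists B, forall i, Cmod (T i phi) <= B) ->
  exists A N, 0 <= A /\ forall i phi M, D_on c d phi -> dbound one_field N phi (fun _ => M) ->
     Cmod (T i phi) <= A * M.
Proof.
  intros Tadd Tscal T0 Tbd.
  apply NNPP; intros Hno.
  set (Ball := fun n phi => D_on c d phi /\ dbound one_field n phi (fun _ => 1)).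
  assert (Hbig : forall n, exists i phi, Ball n phi /\ 6 ^ n < Cmod (T i phi)).
  { intros n; apply NNPP; intros Hn; apply Hno; exists (6 ^ n), n.
    split; [apply pow_le; lra|].
    intros i phi M HD HM.
    destruct (Rle_or_lt (Cmod (T i phi)) (6 ^ n * M)) as [H|H]; [exact H|exfalso].
    assert (HM0 : 0 <= M) by (apply (dbound_pos _ _ _ _ 0 HM)).
    destruct (Req_dec M 0) as [E|E].
    - destruct (T0 i) as [A [HA H0]]; specialize (H0 phi 0 HD).
      rewrite Rmult_0_r in H0. rewrite E, Rmult_0_r in H.
      assert (Cmod (T i phi) <= 0); [|lra].
      apply H0; intros x; rewrite <- E; apply (dbound_value _ _ _ _ x HM).
    - apply Hn; exists i, (fun x => RtoC (/ M) * phi x)%C.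
      assert (0 < M) by lra. assert (0 < / M) by (apply Rinv_0_lt_compat; lra).
      repeat split.
      + apply Smooth_scal, HD.
      + intros x Hx; rewrite (proj2 HD x Hx); ring.
      + apply (dbound_weaken _ _ _ (fun x => Cmod (RtoC (/ M)) * M)); [|apply dbound_scal, HM].
        intros x; rewrite Cmod_R, Rabs_pos_eq by lra; right; field; lra.
      + rewrite Tscal, Cmod_mult, Cmod_R, Rabs_pos_eq by (auto; lra).
        apply Rmult_lt_reg_l with M; [lra|].
        replace (M * (/ M * Cmod (T i phi))) with (Cmod (T i phi)) by (field; lra).
        lra. }
  assert (Hsup : forall n, exists i phi s, Ball n phi /\ 6 ^ n <= s /\
    3 / 4 * s <= Cmod (T i phi) /\ (forall psi, Ball n psi -> Cmod (T i psi) <= s)).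
  { intros n; destruct (Hbig n) as [i [phi0 [HB0 Hphi0]]].
    destruct (T0 i) as [A [HA H0]].
    destruct (completeness (fun r => exists phi, Ball n phi /\ r = Cmod (T i phi))) as [s [Hs1 Hs2]].
    - exists (A * 1); intros r [phi [[HD HX] ->]]; apply H0; [exact HD|].
      intros x; apply (dbound_value _ _ _ _ x HX).
    - eexists; exists phi0; split; [exact HB0|reflexivity].
    - assert (Hs : 6 ^ n <= s).
      { left; eapply Rlt_le_trans; [exact Hphi0|]; apply Hs1; exists phi0; auto. }
      assert (0 < 6 ^ n) by (apply pow_lt; lra).
      assert (Hphi : exists phi, Ball n phi /\ 3 / 4 * s <= Cmod (T i phi)).
      { apply NNPP; intros Hn.
        assert (s <= 3 / 4 * s); [|lra].
        apply Hs2; intros r [phi [HB ->]].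
        destruct (Rle_or_lt (3 / 4 * s) (Cmod (T i phi))) as [H1|H1]; [|lra].
        exfalso; apply Hn; exists phi; auto. }
      destruct Hphi as [phi [HB Hphi]].
      exists i, phi, s; repeat split; auto; try apply HB.
      intros psi Hpsi; apply Hs1; exists psi; auto. }
  set (ch := fun n => constructive_indefinite_description _ (Hsup n)).
  set (ii := fun n => proj1_sig (ch n)).
  assert (Hi : forall n, exists phi s, Ball n phi /\ 6 ^ n <= s /\
    3 / 4 * s <= Cmod (T (ii n) phi) /\ (forall psi, Ball n psi -> Cmod (T (ii n) psi) <= s))
    by (intros n; exact (proj2_sig (ch n))).
  clearbody ii; clear ch.
  set (ch := fun n => constructive_indefinite_description _ (Hi n)).
  set (ph := fun n => proj1_sig (ch n)).
  assert (Hph : forall n, exists s, Ball n (ph n) /\ 6 ^ n <= s /\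
    3 / 4 * s <= Cmod (T (ii n) (ph n)) /\ (forall psi, Ball n psi -> Cmod (T (ii n) psi) <= s))
    by (intros n; exact (proj2_sig (ch n))).
  clearbody ph; clear ch.
  assert (HDph : forall n, D_on c d (ph n)) by (intros n; destruct (Hph n) as [s [[H _] _]]; exact H).
  (* the sign of the coefficient at n depends on the partial sum before n *)
  set (coef := fun n (S0 : R -> C) =>
    if Rle_dec (Cmod (T (ii n) (fun x => S0 x + RtoC (- (1 / 3) ^ n) * ph n x)%C))
               (Cmod (T (ii n) (fun x => S0 x + RtoC ((1 / 3) ^ n) * ph n x)%C))
    then (1 / 3) ^ n else - (1 / 3) ^ n).
  set (X := fix X n : R -> C := match n with O => fun _ => 0%C
    | S k => fun x => (X k x + RtoC (coef k (X k)) * ph k x)%C end).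
  set (term := fun n x => (RtoC (coef n (X n)) * ph n x)%C).
  assert (HX : forall n x, X n x = psum term n x).
  { induction n as [|n IH]; intros x; [reflexivity|]. simpl; rewrite <- IH; reflexivity. }
  assert (Hcoef : forall n S0, Cmod (RtoC (coef n S0)) = (1 / 3) ^ n).
  { intros n S0; rewrite Cmod_R; unfold coef; pose proof (third_pow_pos n).
    destruct Rle_dec; [|rewrite Rabs_Ropp]; apply Rabs_pos_eq; lra. }
  assert (HDX : forall n, D_on c d (X n)).
  { induction n as [|n IH].
    - split; [apply (Smooth_const 0%C)|reflexivity].
    - apply D_on_plus; [exact IH|]; apply D_on_mult_r; [apply HDph|apply Smooth_const]. }
  assert (HXB : forall k j, (k <= j)%nat -> dbound one_field k (term j) (fun _ => (1 / 3) ^ j)).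
  { intros k j Hkj; destruct (Hph j) as [s [[_ HB] _]].
    apply (dbound_weaken _ _ _ (fun x => Cmod (RtoC (coef j (X j))) * 1)).
    - intros x; rewrite Hcoef; lra.
    - apply dbound_scal, (dbound_le _ _ j); assumption. }
  destruct (series_limit term 0) as [Phi HPhi].
  { intros j x _; apply (dbound_value _ _ _ _ x (HXB 0%nat j ltac:(lia))). }
  assert (HDPhi : D_on c d Phi).
  { split.
    - apply (series_smooth term Phi 0); auto.
      + intros j; apply Smooth_scal, HDph.
    - intros x Hx.
      apply Cmod_eq_0, Rle_antisym; [|apply Cmod_ge_0].
      apply le_epsilon; intros e He.
      destruct (third_pow_arch 3 e He) as [n Hn]; specialize (Hn n (Nat.le_refl n)).
      specialize (HPhi n x ltac:(lia)).
      rewrite <- HX, (proj2 (HDX n) x Hx) in HPhi.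
      replace (Phi x - 0)%C with (Phi x) in HPhi by ring. lra. }
  destruct (Tbd Phi HDPhi) as [B HB].
  assert (Hgrow : forall n, 2 ^ n / 4 <= B).
  { intros n; destruct (Hph n) as [s [HBall [Hs [Hbig1 Hmax]]]].
    pose proof (third_pow_pos n) as H3.
    assert (L1 : 3 / 4 * s * (1 / 3) ^ n <= Cmod (T (ii n) (X (S n)))).
    { assert (Tp : T (ii n) (fun x => X n x + RtoC ((1 / 3) ^ n) * ph n x)%C
        = (T (ii n) (X n) + RtoC ((1 / 3) ^ n) * T (ii n) (ph n))%C).
      { rewrite <- Tscal by auto; apply Tadd; [apply HDX|].
        apply D_on_mult_r; [apply HDph|apply Smooth_const]. }
      assert (Tm : T (ii n) (fun x => X n x + RtoC (- (1 / 3) ^ n) * ph n x)%C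
        = (T (ii n) (X n) + RtoC (- (1 / 3) ^ n) * T (ii n) (ph n))%C).
      { rewrite <- Tscal by auto; apply Tadd; [apply HDX|].
        apply D_on_mult_r; [apply HDph|apply Smooth_const]. }
      assert (Hsum : 2 * ((1 / 3) ^ n * Cmod (T (ii n) (ph n))) <=
        Cmod (T (ii n) (fun x => X n x + RtoC ((1 / 3) ^ n) * ph n x)%C)
        + Cmod (T (ii n) (fun x => X n x + RtoC (- (1 / 3) ^ n) * ph n x)%C)).
      { eapply Rle_trans; [|apply Cmod_triangle_minus]. rewrite Tp, Tm.
        right; replace (_ - _)%C with (RtoC (2 * (1 / 3) ^ n) * T (ii n) (ph n))%C
          by (rewrite RtoC_opp, RtoC_mult; ring).
        rewrite Cmod_mult, Cmod_R, Rabs_pos_eq by lra. ring. }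
      assert (Hsel : (1 / 3) ^ n * Cmod (T (ii n) (ph n)) <= Cmod (T (ii n) (X (S n)))).
      { simpl; unfold coef; destruct Rle_dec; lra. }
      eapply Rle_trans; [|exact Hsel]. rewrite (Rmult_comm _ ((1 / 3) ^ n)).
      apply Rmult_le_compat_l; lra. }
    assert (L2 : forall k, Cmod (T (ii n) (X (S n + k)%nat) - T (ii n) (X (S n)))
      <= s * (1 / 2 * ((1 / 3) ^ n - (1 / 3) ^ (n + k)))).
    { induction k as [|k IH].
      - rewrite !Nat.add_0_r; replace (_ - _)%C with (RtoC 0) by ring; rewrite Cmod_0; lra.
      - replace (S n + S k)%nat with (S (S n + k)) by lia.
        change (X (S (S n + k))) with
          (fun x => X (S n + k)%nat x + RtoC (coef (S n + k)%nat (X (S n + k)%nat)) * ph (S n + k)%nat x)%C.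
        rewrite Tadd, Tscal; [|apply HDph|apply HDX|
          apply D_on_mult_r; [apply HDph|apply Smooth_const]].
        assert (Hb : Cmod (T (ii n) (ph (S n + k)%nat)) <= s).
        { apply Hmax; split; [apply HDph|].
          destruct (Hph (S n + k)%nat) as [s' [[_ Hx] _]].
          apply (dbound_le _ n (S n + k)); [lia|exact Hx]. }
        match goal with |- Cmod (?a + ?b - ?e) <= _ =>
          replace (a + b - e)%C with ((a - e) + b)%C by ring end.
        eapply Rle_trans; [apply Cmod_triangle|]; rewrite Cmod_mult, Hcoef.
        pose proof (third_pow_pos (n + k)).
        replace (n + S k)%nat with (S (n + k)) by lia.
        replace (S n + k)%nat with (S (n + k)) in * by lia.
        simpl pow.
        assert ((1 / 3 * (1 / 3) ^ (n + k)) * Cmod (T (ii n) (ph (S (n + k))))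
          <= (1 / 3 * (1 / 3) ^ (n + k)) * s) by (apply Rmult_le_compat_l; lra).
        lra. }
    destruct (T0 (ii n)) as [A [HA H0]].
    assert (L3 : forall k, Cmod (T (ii n) Phi - T (ii n) (X (S n + k)%nat)) <= A * (3 * (1 / 3) ^ (S n + k))).
    { intros k.
      replace (T (ii n) Phi - T (ii n) (X (S n + k)%nat))%C
        with (T (ii n) (fun x => Phi x + RtoC (-1) * X (S n + k)%nat x)%C).
      - apply H0.
        + apply D_on_plus; [exact HDPhi|]; apply D_on_mult_r; [apply HDX|apply Smooth_const].
        + intros x; replace (Phi x + -1 * X (S n + k)%nat x)%C with (Phi x - psum term (S n + k) x)%C
            by (rewrite <- HX; ring).
          apply HPhi; lia.
      - rewrite Tadd, Tscal; [ring|apply HDX|exact HDPhi|].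
        apply D_on_mult_r; [apply HDX|apply Smooth_const]. }
    assert (L4 : 1 / 4 * s * (1 / 3) ^ n <= B).
    { apply le_epsilon; intros e He.
      destruct (third_pow_arch (A * 3) e He) as [k Hk].
      specialize (Hk (S n + k)%nat ltac:(lia)).
      specialize (L2 k); specialize (L3 k).
      set (a1 := T (ii n) (X (S n))) in *.
      set (a2 := T (ii n) (X (S n + k)%nat)) in *.
      pose proof (Cmod_triangle_rev a1 (a1 - T (ii n) Phi)) as Q1.
      replace (a1 - (a1 - T (ii n) Phi))%C with (T (ii n) Phi) in Q1 by ring.
      pose proof (Cmod_triangle (a1 - a2) (a2 - T (ii n) Phi)) as Q2.
      replace (a1 - a2 + (a2 - T (ii n) Phi))%C with (a1 - T (ii n) Phi)%C in Q2 by ring.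
      rewrite (Cmod_minus_sym a1 a2), (Cmod_minus_sym a2 (T (ii n) Phi)) in Q2.
      specialize (HB (ii n)).
      assert (0 <= s * (1 / 3) ^ (n + k)).
      { apply Rmult_le_pos; [|left; apply third_pow_pos].
        assert (0 < 6 ^ n) by (apply pow_lt; lra). lra. }
      lra. }
    apply Rle_trans with (1 / 4 * 6 ^ n * (1 / 3) ^ n).
    - right. replace (2 ^ n) with ((6 * (1 / 3)) ^ n) by (f_equal; lra).
      rewrite Rpow_mult_distr; field.
    - eapply Rle_trans; [|exact L4]. apply Rmult_le_compat_r; lra. }
  destruct (Pow_x_infinity 2 ltac:(rewrite Rabs_pos_eq; lra) (4 * (Rabs B + 1))) as [n Hn].
  specialize (Hn n (Nat.le_refl n)); rewrite Rabs_pos_eq in Hn by (apply pow_le; lra).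
  specialize (Hgrow n); pose proof (Rle_abs B); lra.
Qed.

(** * A smooth step *)

(** The derivatives of [exp (- 1 / x)] are combinations of the functions
    [x ^ -k * exp (- 1 / x)], so smoothness at [0] is one estimate for all [k]. *)
Definition flat (k : nat) (x : R) : R :=
  if Rlt_dec 0 x then / x ^ k * exp (- / x) else 0.

(** The term of degree [k + 2] of the series of [exp (1 / x)] is below its sum. *)
Lemma flat_bound k x : Rabs (flat k x) <= INR (Factorial.fact (k + 2)) * (x * x).
Proof.
  unfold flat; destruct Rlt_dec as [Hx|Hx].
  - assert (Hi : 0 < / x) by (apply Rinv_0_lt_compat; exact Hx).
    assert (Hk : 0 < x ^ k) by (apply pow_lt; exact Hx).
    assert (Hf : 0 < INR (Factorial.fact (k + 2))) by apply INR_fact_lt_0.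
    pose proof (pow_fact_le_exp (/ x) (k + 2) ltac:(lra)) as He.
    rewrite Rabs_pos_eq.
    2: { apply Rmult_le_pos; left; [apply Rinv_0_lt_compat; exact Hk|apply exp_pos]. }
    rewrite exp_Ropp.
    assert (Hp : 0 < (/ x) ^ (k + 2) / INR (Factorial.fact (k + 2))).
    { apply Rdiv_lt_0_compat; [apply pow_lt; exact Hi|exact Hf]. }
    apply Rle_trans with (/ x ^ k * / ((/ x) ^ (k + 2) / INR (Factorial.fact (k + 2)))).
    + apply Rmult_le_compat_l; [left; apply Rinv_0_lt_compat, Hk|].
      apply Rinv_le_contravar; assumption.
    + right; rewrite pow_inv, pow_add; simpl; field; repeat split; lra.
  - rewrite Rabs_R0; apply Rmult_le_pos; [apply pos_INR|nra].
Qed.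

Lemma flat_derive k x :
  dC (fun t => RtoC (flat k t)) x
     (RtoC (- INR k) * RtoC (flat (S k) x) + RtoC (flat (S (S k)) x))%C.
Proof.
  destruct (Rtotal_order x 0) as [Hx|[Hx|Hx]].
  - apply (dC_ext_loc (fun _ => 0%C)).
    + apply locally_R; exists (- x); split; [lra|]; intros y Hy; apply Rabs_def2 in Hy.
      unfold flat; destruct Rlt_dec; [lra|reflexivity].
    + eapply dC_eq; [apply dC_const|]; unfold flat; destruct Rlt_dec; [lra|]; ring.
  - subst x.
    apply dC_eps; intros eps He.
    assert (F0 : forall j, flat j 0 = 0) by (intros j; unfold flat; destruct Rlt_dec; [lra|auto]).
    rewrite !F0.
    pose proof (INR_fact_lt_0 (k + 2)) as Hf.
    exists (eps / INR (Factorial.fact (k + 2))); split; [apply Rdiv_lt_0_compat; lra|].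
    intros y Hy; rewrite Rminus_0_r in *.
    replace (RtoC (flat k y) - 0 - y * (RtoC (- INR k) * 0 + 0))%C with (RtoC (flat k y)) by ring.
    rewrite Cmod_R; eapply Rle_trans; [apply flat_bound|].
    rewrite <- (Rabs_pos_eq (y * y)), Rabs_mult by nra.
    rewrite <- Rmult_assoc; apply Rmult_le_compat_r; [apply Rabs_pos|].
    apply Rle_trans with (INR (Factorial.fact (k + 2)) * (eps / INR (Factorial.fact (k + 2)))).
    + apply Rmult_le_compat_l; lra.
    + right; field; lra.
  - apply (dC_ext_loc (fun t => RtoC (/ t ^ k * exp (- / t)))).
    + apply locally_R; exists x; split; [lra|]; intros y Hy; apply Rabs_def2 in Hy.
      unfold flat; destruct Rlt_dec; [reflexivity|lra].
    + assert (Hk : x ^ k <> 0) by (apply pow_nonzero; lra).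
      eapply dC_eq; [apply dC_RtoC|].
      * auto_derive; [split; [exact Hk|split; [lra|trivial]]|reflexivity].
      * rewrite <- RtoC_mult, <- RtoC_plus; f_equal.
        unfold flat; destruct Rlt_dec; [|lra].
        destruct k as [|k]; [simpl; field; lra|].
        set (K := INR (S k)); simpl pred; simpl pow.
        assert (x ^ k <> 0) by (apply pow_nonzero; lra).
        field; split; lra.
Qed.

Lemma flat_smooth k : Smooth (fun x => RtoC (flat k x)).
Proof.
  intros n; revert k; induction n as [|n IH]; intros k.
  - exists (fun x => Cmod (RtoC (flat k x))); split; [intros; lra|exact I].
  - destruct (IH (S k)) as [w1 H1]; destruct (IH (S (S k))) as [w2 H2].
    assert (H := dbound_plus _ _ _ _ _ _ (dbound_scal _ _ _ _ (RtoC (- INR k)) H1) H2).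
    exists (fun x => Cmod (RtoC (flat k x)) + (Cmod (RtoC (- INR k)) * w1 x + w2 x)).
    split.
    + intros x; pose proof (dbound_pos _ _ _ _ x H); simpl in *; lra.
    + eexists; split; [intros x; apply flat_derive|]; rewrite one_mult.
      revert H; apply dbound_weaken; intros x; pose proof (Cmod_ge_0 (RtoC (flat k x))); lra.
Qed.

Definition bump (x : R) : R := flat 0 (x - 1) * flat 0 (2 - x).

Lemma bump_smooth : Smooth (fun x => RtoC (bump x)).
Proof.
  replace (fun x => RtoC (bump x)) with
    (fun x => RtoC (flat 0 (1 * (x - 1))) * RtoC (flat 0 (-1 * (x - 2))))%C.
  - apply Smooth_mult; apply (Smooth_affine (fun x => RtoC (flat 0 x))), flat_smooth.
  - extensionality x; rewrite <- RtoC_mult; unfold bump; do 3 f_equal; ring.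
Qed.

Lemma bump_zero x : x <= 1 \/ 2 <= x -> bump x = 0.
Proof.
  intros H; unfold bump, flat; destruct (Rlt_dec 0 (x - 1)), (Rlt_dec 0 (2 - x));
    try ring; lra.
Qed.

Lemma bump_cont x : continuous bump x.
Proof. apply (ccont_fst (fun x => RtoC (bump x))), Smooth_cont, bump_smooth. Qed.

Lemma ex_RInt_bump u v : ex_RInt bump u v.
Proof. apply (ex_RInt_continuous (V := R_CompleteNormedModule)); intros; apply bump_cont. Qed.

Lemma bump_mass : 0 < RInt bump 1 2.
Proof.
  apply RInt_gt_0; [lra| |intros; apply bump_cont].
  intros x Hx; unfold bump, flat.
  destruct (Rlt_dec 0 (x - 1)), (Rlt_dec 0 (2 - x)); try lra.
  simpl; rewrite Rinv_1, !Rmult_1_l; apply Rmult_lt_0_compat; apply exp_pos.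
Qed.

Definition step (x : R) : C := RtoC (RInt bump 1 x / RInt bump 1 2).

Lemma step_derive x : dC step x (RtoC (/ RInt bump 1 2) * RtoC (bump x))%C.
Proof.
  pose proof bump_mass.
  eapply dC_eq; [apply dC_RtoC|].
  - apply (is_derive_ext (fun x => / RInt bump 1 2 * RInt bump 1 x)).
    { intros t; unfold Rdiv; apply Rmult_comm. }
    apply (is_derive_scal (fun x => RInt bump 1 x)).
    apply (is_derive_RInt (V := R_NormedModule) bump (fun x => RInt bump 1 x) 1 x).
    + apply filter_forall; intros y; apply (RInt_correct (V := R_CompleteNormedModule)), ex_RInt_bump.
    + apply bump_cont.
  - apply RtoC_mult.
Qed.

Lemma step_smooth : Smooth step.
Proof.
  eapply Smooth_intro; [apply step_derive|]; apply Smooth_scal, bump_smooth.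
Qed.

Lemma step_0 x : x <= 1 -> step x = 0%C.
Proof.
  intros H; unfold step.
  rewrite (RInt_ext bump (fun _ => 0)).
  - rewrite RInt_const; unfold scal; simpl; unfold mult; simpl.
    rewrite Rmult_0_r; unfold Rdiv; rewrite Rmult_0_l; reflexivity.
  - intros y Hy; rewrite Rmax_left in Hy by lra; apply bump_zero; lra.
Qed.

Lemma step_1 x : 2 <= x -> step x = 1%C.
Proof.
  intros H; unfold step.
  assert (E : RInt bump 2 x = 0).
  { rewrite (RInt_ext bump (fun _ => 0)).
    - rewrite RInt_const; unfold scal; simpl; unfold mult; simpl; ring.
    - intros y Hy; rewrite Rmin_left in Hy by lra; apply bump_zero; lra. }
  pose proof (RInt_Chasles bump 1 2 x (ex_RInt_bump _ _) (ex_RInt_bump _ _)) as E2.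
  rewrite E in E2; unfold plus in E2; simpl in E2.
  rewrite <- E2, Rplus_0_r; pose proof bump_mass; f_equal; field; lra.
Qed.

Lemma step_dbound m n : Smooth (fun x => RtoC (m x)) -> exists M, 0 <= M /\ dbound m n step (fun _ => M).
Proof.
  intros Hm.
  assert (HB : exists M, 0 <= M /\ forall x, Cmod (step x) <= M).
  { destruct (continuity_ab_maj (fun x => Cmod (step x)) 1 2) as [t [Ht _]]; [lra| |].
    - intros x _; apply continuity_pt_filterlim, continuous_Cmod, Smooth_cont, step_smooth.
    - exists (Cmod (step t) + 1); pose proof (Cmod_ge_0 (step t)); split; [lra|].
      intros x; destruct (Rle_or_lt x 1); [rewrite step_0, Cmod_0 by lra; lra|].
      destruct (Rle_or_lt 2 x); [rewrite step_1, Cmod_1 by lra; lra|].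
      specialize (Ht x ltac:(lra)); lra. }
  destruct HB as [M [HM0 HM]].
  destruct n as [|n]; [exists M; repeat split; auto|].
  destruct (dbound_compact m n (fun x => m x * (RtoC (/ RInt bump 1 2) * RtoC (bump x)))%C 2)
    as [M2 [HM2 H2]]; [exact Hm| |lra| |].
  - apply Smooth_mult; [exact Hm|]; apply Smooth_scal, bump_smooth.
  - intros x Hx; rewrite bump_zero by lra; ring.
  - exists (M + M2); split; [lra|]; split; [intros x; specialize (HM x); lra|].
    eexists; split; [apply step_derive|].
    revert H2; apply dbound_weaken; intros; lra.
Qed.

(** * Iterated derivatives of poles and of solutions of P' = g P *)

(** Both [1 / (x - p)], for the operator [d/dx], and [x / (x - p)], for
    [x d/dx], satisfy a Riccati equation, so all their iterated derivatives are
    polynomials in the function itself. *)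
Lemma dbound_riccati (alpha : R) (n : nat) : exists A k, 0 <= A /\
  forall (m : R -> R) (v v' : R -> C) (w : R -> R),
    (forall x, dC v x (v' x)) ->
    (forall x, (m x * v' x = alpha * v x - v x * v x)%C) ->
    (forall x, Cmod (v x) <= w x) -> (forall x, 1 <= w x) ->
    dbound m n v (fun x => A * w x ^ k).
Proof.
  induction n as [|n [A [k [HA IH]]]].
  - exists 1, 1%nat; split; [lra|]; intros m v v' w _ _ Hw _; split; [|exact I].
    intros x; specialize (Hw x); lra.
  - set (B := 1 + (Rabs alpha * A + 2 ^ n * (A * A))).
    assert (H2n : 0 <= 2 ^ n) by (apply pow_le; lra).
    pose proof (Rabs_pos alpha).
    assert (HB : 0 <= Rabs alpha * A + 2 ^ n * (A * A)).
    { apply Rplus_le_le_0_compat; apply Rmult_le_pos; auto; apply Rmult_le_pos; auto. }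
    exists B, (S (k + k)); split; [unfold B; lra|].
    intros m v v' w Hd Hr Hw H1.
    assert (Hp : forall x i j, (i <= j)%nat -> w x ^ i <= w x ^ j)
      by (intros; apply Rle_pow; auto).
    assert (Hp0 : forall x i, 0 <= w x ^ i)
      by (intros x i; apply pow_le; specialize (H1 x); lra).
    split.
    + intros x; apply Rle_trans with (1 * w x ^ 1); [specialize (Hw x); lra|].
      apply Rmult_le_compat; [lra|apply Hp0|unfold B; lra|apply Hp; lia].
    + exists v'; split; [exact Hd|].
      replace (fun x => m x * v' x)%C with (fun x => RtoC alpha * v x + RtoC (-1) * (v x * v x))%C
        by (extensionality x; rewrite Hr; ring).
      assert (F := IH m v v' w Hd Hr Hw H1).
      generalize (dbound_plus _ _ _ _ _ _ (dbound_scal _ _ _ _ (RtoC alpha) F)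
        (dbound_scal _ _ _ _ (RtoC (-1)) (dbound_mult _ _ _ _ _ _ F F))).
      apply dbound_weaken; intros x; rewrite !Cmod_R, (Rabs_left (-1)) by lra.
      assert (E : w x ^ k * w x ^ k = w x ^ (k + k)) by (rewrite pow_add; ring).
      pose proof (Hp x k (S (k + k)) ltac:(lia)) as P1.
      pose proof (Hp x (k + k)%nat (S (k + k)) ltac:(lia)) as P2.
      pose proof (Hp0 x (S (k + k))) as P3.
      assert (Q1 : Rabs alpha * (A * w x ^ k) <= Rabs alpha * A * w x ^ S (k + k)).
      { rewrite <- Rmult_assoc; apply Rmult_le_compat_l; [apply Rmult_le_pos; auto|exact P1]. }
      assert (Q2 : 2 ^ n * (A * w x ^ k * (A * w x ^ k)) <= 2 ^ n * (A * A) * w x ^ S (k + k)).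
      { replace (2 ^ n * (A * w x ^ k * (A * w x ^ k)))
          with (2 ^ n * (A * A) * w x ^ (k + k)) by (rewrite <- E; ring).
        apply Rmult_le_compat_l; [apply Rmult_le_pos; auto; apply Rmult_le_pos; auto|exact P2]. }
      unfold B; lra.
Qed.

(** The bound is relative to [P] itself: each application of [m d/dx] to [P]
    multiplies it by a function controlled by [m * g]. *)
Lemma dbound_log_derivative m n (P g : R -> C) w :
  (forall x, dC P x (g x * P x)%C) -> dbound m n (fun x => m x * g x)%C w ->
  dbound m n P (fun x => (1 + 2 ^ n * w x) ^ n * Cmod (P x)).
Proof.
  intros Hd Hg.
  assert (Hw : forall x, 0 <= w x) by (intros x; apply (dbound_pos _ _ _ _ x Hg)).
  assert (H2 : forall i, 1 <= 2 ^ i) by (intros; apply pow_R1_Rle; lra).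
  assert (Hc : forall x, 1 <= 1 + 2 ^ n * w x).
  { intros x; specialize (Hw x); specialize (H2 n). nra. }
  assert (G : forall k, (k <= n)%nat -> dbound m k P (fun x => (1 + 2 ^ n * w x) ^ k * Cmod (P x))).
  { induction k as [|k IH]; intros Hk.
    - split; [intros x; simpl; lra|exact I].
    - split.
      + intros x; rewrite <- (Rmult_1_l (Cmod (P x))) at 1.
        apply Rmult_le_compat_r; [apply Cmod_ge_0|apply pow_R1_Rle, Hc].
      + exists (fun x => g x * P x)%C; split; [exact Hd|].
        replace (fun x => m x * (g x * P x))%C with (fun x => (m x * g x) * P x)%C
          by (extensionality x; ring).
        generalize (dbound_mult _ _ _ _ _ _ (dbound_le m k n _ w ltac:(lia) Hg) (IH ltac:(lia))).
        apply dbound_weaken; intros x; simpl.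
        replace (2 ^ k * (w x * ((1 + 2 ^ n * w x) ^ k * Cmod (P x))))
          with ((2 ^ k * w x) * ((1 + 2 ^ n * w x) ^ k * Cmod (P x))) by ring.
        rewrite (Rmult_assoc (1 + 2 ^ n * w x)); apply Rmult_le_compat_r.
        * apply Rmult_le_pos; [apply pow_le; specialize (Hc x); lra|apply Cmod_ge_0].
        * assert (2 ^ k <= 2 ^ n) by (apply Rle_pow; [lra|lia]).
          specialize (Hw x); nra. }
  apply G; lia.
Qed.

(** * Imaginary powers in the upper half plane *)

Definition arg (z : C) : R := PI / 2 - atan (fst z / snd z).

(** The power [z ^ (i lam) = exp (- lam * arg z + i * lam * log |z|)]; its modulus
    depends on the argument of [z] only. *)
Definition ipow (lam : R) (z : C) : C :=
  (exp (- lam * arg z) * cos (lam * (ln (fst z * fst z + snd z * snd z) / 2)),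
   exp (- lam * arg z) * sin (lam * (ln (fst z * fst z + snd z * snd z) / 2))).

Lemma ipow_mod lam z : Cmod (ipow lam z) = exp (- lam * arg z).
Proof.
  unfold Cmod, ipow; simpl.
  set (e := exp _); set (t := lam * _).
  pose proof (sin2_cos2 t) as H; unfold Rsqr in H.
  replace (e * cos t * (e * cos t * 1) + e * sin t * (e * sin t * 1)) with (e * e) by
    (replace (e * e) with (e * e * (sin t * sin t + cos t * cos t)) by (rewrite H; ring); ring).
  apply sqrt_square; left; apply exp_pos.
Qed.

Lemma arg_bounds z : 0 < arg z < PI.
Proof. unfold arg; pose proof (atan_bound (fst z / snd z)); lra. Qed.

Lemma ipow_cont lam z : 0 < snd z -> ccont (ipow lam) z.
Proof.
  intros Hz.
  assert (Hf : continuous (fun z : C => fst z) z) by (destruct z; apply continuous_fst).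
  assert (Hs : continuous (fun z : C => snd z) z) by (destruct z; apply continuous_snd).
  assert (D : forall (g : R -> R) (u : C -> R), ex_derive g (u z) -> continuous u z ->
    continuous (fun t => g (u t)) z).
  { intros g u Hg Hu; apply (continuous_comp u g); [exact Hu|].
    apply (ex_derive_continuous (K := R_AbsRing) (V := R_NormedModule)), Hg. }
  assert (M : forall u v : C -> R, continuous u z -> continuous v z ->
    continuous (fun t => u t * v t) z)
    by (intros u v Hu Hv; apply (continuous_mult (K := R_AbsRing)); assumption).
  assert (Ha : continuous arg z).
  { unfold arg; apply (D (fun t => PI / 2 - t) (fun z => atan (fst z / snd z))).
    { auto_derive; trivial. }
    apply (D atan).
    { exists (/ (1 + (fst z / snd z) ^ 2)); apply is_derive_Reals, derivable_pt_lim_atan. }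
    apply M; [exact Hf|]; apply (D Rinv); [auto_derive; lra|exact Hs]. }
  assert (He : continuous (fun z => exp (- lam * arg z)) z).
  { apply (D (fun t => exp (- lam * t)) arg); [auto_derive; trivial|exact Ha]. }
  assert (Hn : continuous (fun z : C => fst z * fst z + snd z * snd z) z).
  { apply (continuous_plus (V := R_NormedModule)); apply M; assumption. }
  assert (Hpos : 0 < fst z * fst z + snd z * snd z) by nra.
  apply ccont_pair; simpl; (apply M; [exact He|]).
  - apply (D (fun t => cos (lam * (ln t / 2))) (fun z => fst z * fst z + snd z * snd z));
      [auto_derive; lra|exact Hn].
  - apply (D (fun t => sin (lam * (ln t / 2))) (fun z => fst z * fst z + snd z * snd z));
      [auto_derive; lra|exact Hn].
Qed.

(** The Cauchy-Riemann equations with continuous partial derivatives: go from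
    [(x, y)] to [(u, v)] first vertically, then horizontally, and apply the mean
    value inequality to both steps. *)
Lemma Cder_of_partials (G D : C -> C) x y d :
  0 < d ->
  (forall u v, Rabs (u - x) < d -> Rabs (v - y) < d ->
    dC (fun t => G (t, v)) u (D (u, v)) /\ dC (fun t => G (u, t)) v (Ci * D (u, v))) ->
  ccont D (x, y) -> Cder G (x, y) (D (x, y)).
Proof.
  intros Hd HP HD; apply Cder_iff; intros eps He.
  rewrite ccont_iff in HD; specialize (HD (eps / 2) ltac:(lra)); apply locally_Cmod in HD.
  destruct HD as [d2 [Hd2 HD]].
  exists (Rmin d (d2 / 2)); split; [apply Rmin_glb_lt; lra|]; intros [u v] Hw.
  set (q := ((u, v) - (x, y))%C) in *.
  pose proof (Rmin_l d (d2 / 2)); pose proof (Rmin_r d (d2 / 2)).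
  pose proof (fst_le_Cmod q) as Q1; pose proof (snd_le_Cmod q) as Q2.
  assert (Eq : q = (u - x, v - y)) by reflexivity.
  rewrite Eq in Q1, Q2; simpl in Q1, Q2; rewrite <- Eq in Q1, Q2.
  assert (Near : forall s t, Rabs (s - x) <= Cmod q -> Rabs (t - y) <= Cmod q ->
    Cmod (D (s, t) - D (x, y)) <= eps / 2).
  { intros s t Hs Ht; left; apply HD.
    eapply Rle_lt_trans; [apply Cmod_le_sum|]; simpl. unfold Rminus in *; lra. }
  assert (MV : forall (g : R -> C) (g' : R -> C) (k : C) s0 s1,
    (forall s, Rabs (s - s0) <= Rabs (s1 - s0) -> dC g s (g' s) /\ Cmod (g' s - k) <= eps / 2) ->
    Cmod (g s1 - g s0 - RtoC (s1 - s0) * k) <= eps / 2 * Rabs (s1 - s0)).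
  { intros g g' k s0 s1 H1.
    assert (Dg : forall s, Rabs (s - s0) <= Rabs (s1 - s0) ->
      dC (fun t => g t - RtoC (t - s0) * k)%C s (g' s - k)%C).
    { intros s Hs; destruct (H1 s Hs) as [H2 _].
      eapply dC_eq; [apply dC_minus; [exact H2|]|].
      - apply dC_mult; [apply dC_RtoC|apply dC_const].
        auto_derive; [trivial|reflexivity].
      - cbv beta; ring. }
    destruct (Rle_or_lt s0 s1) as [Hs|Hs].
    - rewrite (Rabs_pos_eq (s1 - s0)) in * by lra.
      pose proof (dC_mean_value (fun t => g t - RtoC (t - s0) * k)%C (fun s => g' s - k)%C
        (eps / 2) s0 s1 Hs) as Q.
      cbv beta in Q. replace (s0 - s0) with 0 in Q by ring.
      replace (g s1 - (s1 - s0)%R * k - (g s0 - 0 * k))%C with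
        (g s1 - g s0 - (s1 - s0)%R * k)%C in Q by ring.
      apply Q; intros s Hs'; [apply Dg|apply H1]; rewrite Rabs_pos_eq; lra.
    - rewrite Rabs_minus_sym in *; rewrite (Rabs_pos_eq (s0 - s1)) in * by lra.
      pose proof (dC_mean_value (fun t => g t - RtoC (t - s0) * k)%C (fun s => g' s - k)%C
        (eps / 2) s1 s0 ltac:(lra)) as Q.
      cbv beta in Q. replace (s0 - s0) with 0 in Q by ring.
      replace (g s0 - 0 * k - (g s1 - (s1 - s0)%R * k))%C with
        (- (g s1 - g s0 - (s1 - s0)%R * k))%C in Q by ring.
      rewrite Cmod_opp in Q.
      apply Q; intros s Hs'; [apply Dg|apply H1]; rewrite Rabs_minus_sym, Rabs_pos_eq; lra. }
  assert (A1 := MV (fun t => G (t, v)) (fun t => D (t, v)) (D (x, y)) x u).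
  assert (A2 := MV (fun t => G (x, t)) (fun t => Ci * D (x, t))%C (Ci * D (x, y))%C y v).
  assert (Z : Rabs (x - x) = 0) by (rewrite Rminus_diag; apply Rabs_R0).
  pose proof (Cmod_ge_0 q).
  specialize (A1 ltac:(intros s Hs; split; [apply HP; lra|apply Near; lra])).
  specialize (A2 ltac:(intros s Hs; split;
    [apply (HP x s); lra|
     replace (Ci * D (x, s) - Ci * D (x, y))%C with (Ci * (D (x, s) - D (x, y)))%C by ring;
     rewrite Cmod_mult, Cmod_Ci, Rmult_1_l; apply Near; lra])).
  cbv beta in A1, A2.
  replace (G (u, v) - G (x, y) - D (x, y) * q)%C with
    ((G (u, v) - G (x, v) - RtoC (u - x) * D (x, y))
     + (G (x, v) - G (x, y) - RtoC (v - y) * (Ci * D (x, y))))%C.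
  2: { rewrite Eq; replace ((u - x, v - y) : C) with (RtoC (u - x) + Ci * RtoC (v - y))%C
         by (apply injective_projections; simpl; ring). ring. }
  eapply Rle_trans; [apply Cmod_triangle|].
  assert (eps / 2 * Rabs (u - x) <= eps / 2 * Cmod q) by (apply Rmult_le_compat_l; lra).
  assert (eps / 2 * Rabs (v - y) <= eps / 2 * Cmod q) by (apply Rmult_le_compat_l; lra).
  lra.
Qed.

Lemma Cder_ipow lam z : 0 < snd z -> Cder (ipow lam) z (RtoC lam * Ci * / z * ipow lam z)%C.
Proof.
  destruct z as [x y]; simpl; intros Hy.
  apply (Cder_of_partials (ipow lam) (fun z => RtoC lam * Ci * / z * ipow lam z)%C x y y Hy).
  - intros u v _ Hv; apply Rabs_def2 in Hv.
    assert (Hv0 : 0 < v) by lra.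
    assert (Hp : 0 < u * u + v * v) by nra.
    assert (Hp2 : u * (u * 1) + v * (v * 1) <> 0) by lra.
    assert (Hat : forall t, is_derive atan t (/ (1 + t ^ 2)))
      by (intros; apply is_derive_Reals, derivable_pt_lim_atan).
    assert (Aux : forall t, is_derive (fun w => arg (w, v)) t (- (v / (t * t + v * v))) /\
      (0 < t -> is_derive (fun w => arg (u, w)) t (u / (u * u + t * t)))).
    { intros t; unfold arg; simpl; split; [|intros Ht].
      - eapply is_derive_eq.
        + apply (is_derive_minus (V := R_NormedModule) (fun _ => PI / 2) (fun w => atan (w / v))).
          * apply (is_derive_const (K := R_AbsRing) (V := R_NormedModule)).
          * apply (is_derive_comp (K := R_AbsRing) (V := R_NormedModule) atan (fun w => w / v));
              [apply Hat|auto_derive; [trivial|reflexivity]].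
        + unfold minus, plus, opp, zero, scal; simpl; unfold mult; simpl.
          field; split; [|lra]. assert (0 < t * t + v * v) by nra. nra.
      - eapply is_derive_eq.
        + apply (is_derive_minus (V := R_NormedModule) (fun _ => PI / 2) (fun w => atan (u / w))).
          * apply (is_derive_const (K := R_AbsRing) (V := R_NormedModule)).
          * apply (is_derive_comp (K := R_AbsRing) (V := R_NormedModule) atan (fun w => u / w));
              [apply Hat|auto_derive; [lra|reflexivity]].
        + unfold minus, plus, opp, zero, scal; simpl; unfold mult; simpl.
          field; split; [|lra]. assert (0 < u * u + t * t) by nra. nra. }
    split; apply dC_pair; simpl.
    + eapply is_derive_eq.
      * apply (is_derive_mult (K := R_AbsRing) (fun t => exp (- lam * arg (t, v)))
          (fun t => cos (lam * (ln (t * t + v * v) / 2))));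
          [|auto_derive; [exact Hp|reflexivity]|intros; apply Rmult_comm].
        apply (is_derive_comp (K := R_AbsRing) (V := R_NormedModule) (fun s => exp (- lam * s))
          (fun t => arg (t, v))); [auto_derive; [trivial|reflexivity]|apply (proj1 (Aux u))].
      * unfold plus, scal; simpl; unfold mult; simpl; unfold Rdiv; field; lra.
    + eapply is_derive_eq.
      * apply (is_derive_mult (K := R_AbsRing) (fun t => exp (- lam * arg (t, v)))
          (fun t => sin (lam * (ln (t * t + v * v) / 2))));
          [|auto_derive; [exact Hp|reflexivity]|intros; apply Rmult_comm].
        apply (is_derive_comp (K := R_AbsRing) (V := R_NormedModule) (fun s => exp (- lam * s))
          (fun t => arg (t, v))); [auto_derive; [trivial|reflexivity]|apply (proj1 (Aux u))].
      * unfold plus, scal; simpl; unfold mult; simpl; unfold Rdiv; field; lra.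
    + eapply is_derive_eq.
      * apply (is_derive_mult (K := R_AbsRing) (fun t => exp (- lam * arg (u, t)))
          (fun t => cos (lam * (ln (u * u + t * t) / 2))));
          [|auto_derive; [exact Hp|reflexivity]|intros; apply Rmult_comm].
        apply (is_derive_comp (K := R_AbsRing) (V := R_NormedModule) (fun s => exp (- lam * s))
          (fun t => arg (u, t))); [auto_derive; [trivial|reflexivity]|apply (proj2 (Aux v)), Hv0].
      * unfold plus, scal; simpl; unfold mult; simpl; unfold Rdiv; field; lra.
    + eapply is_derive_eq.
      * apply (is_derive_mult (K := R_AbsRing) (fun t => exp (- lam * arg (u, t)))
          (fun t => sin (lam * (ln (u * u + t * t) / 2))));
          [|auto_derive; [exact Hp|reflexivity]|intros; apply Rmult_comm].
        apply (is_derive_comp (K := R_AbsRing) (V := R_NormedModule) (fun s => exp (- lam * s))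
          (fun t => arg (u, t))); [auto_derive; [trivial|reflexivity]|apply (proj2 (Aux v)), Hv0].
      * unfold plus, scal; simpl; unfold mult; simpl; unfold Rdiv; field; lra.
  - apply ccont_mult; [|apply ipow_cont; exact Hy].
    apply ccont_mult; [apply ccont_const|]; apply ccont_inv; [apply continuous_id|].
    intros E; injection E; lra.
Qed.

(** * A Cauchy kernel with decay and a harmonic weight *)

Definition pole (p z : C) : C := (/ (z - p))%C.

Definition shifted_ipow (lam del : R) (z : C) : C := ipow lam (z + (0, del))%C.

(** The numerator of the kernel. The factor [z / (z + i) ^ 2] vanishes at the
    origin, where the boundary distribution is not under control, and gives
    decay at infinity; the last factor makes the positive half-axis heavier
    than the negative one, and the shift [del > 0] keeps it smooth on the real
    line. *)
Definition numer (lam del : R) (z : C) : C :=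
  (z * pole (- Ci) z * pole (- Ci) z * shifted_ipow lam del z)%C.

Definition idR (x : R) : R := x.

Lemma Cder_pole p z : z <> p -> Cder (pole p) z (- (pole p z * pole p z))%C.
Proof.
  intros H; eapply Cder_eq.
  - apply (Cder_comp (fun w => / w)%C (fun w => w - p)%C).
    + apply Cder_inv; intros E; apply H, Cminus_eq_0, E.
    + apply Cder_minus; [apply Cder_id|apply Cder_const].
  - unfold pole; ring.
Qed.

Lemma dC_pole p y x : (x, y) <> p -> dC (fun t => pole p (t, y)) x (- (pole p (x, y) * pole p (x, y)))%C.
Proof. intros H; apply Cder_x, Cder_pole, H. Qed.

Lemma Cder_shifted_ipow lam del z : 0 < snd z + del ->
  Cder (shifted_ipow lam del) z (RtoC lam * Ci * pole (0, - del)%R z * shifted_ipow lam del z)%C.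
Proof.
  intros H; eapply Cder_eq.
  - apply (Cder_comp (ipow lam) (fun w => w + (0, del))%C).
    + apply Cder_ipow; simpl; lra.
    + apply Cder_plus; [apply Cder_id|apply Cder_const].
  - unfold pole, shifted_ipow; replace (z - (0, - del)%R)%C with (z + (0, del))%C; [ring|].
    apply injective_projections; simpl; ring.
Qed.

Lemma shifted_ipow_mod lam del z : Cmod (shifted_ipow lam del z) = exp (- lam * arg (z + (0, del))%C).
Proof. apply ipow_mod. Qed.

Lemma shifted_ipow_pos lam del z : 0 < Cmod (shifted_ipow lam del z).
Proof. rewrite shifted_ipow_mod; apply exp_pos. Qed.

Lemma exp_le_compat x y : x <= y -> exp x <= exp y.
Proof. intros [H| ->]; [left; apply exp_increasing, H|lra]. Qed.

Lemma shifted_ipow_le_1 lam del z : 0 <= lam -> Cmod (shifted_ipow lam del z) <= 1.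
Proof.
  intros H; rewrite shifted_ipow_mod; pose proof (arg_bounds (z + (0, del))%C).
  rewrite <- exp_0; apply exp_le_compat; nra.
Qed.

Lemma shifted_ipow_ge lam del z : 0 <= lam -> exp (- lam * PI) <= Cmod (shifted_ipow lam del z).
Proof.
  intros H; rewrite shifted_ipow_mod; pose proof (arg_bounds (z + (0, del))%C).
  apply exp_le_compat; nra.
Qed.

Lemma pole_mod_im p x y : snd p <> y -> Cmod (pole p (x, y)) <= / Rabs (y - snd p).
Proof.
  intros H; unfold pole.
  assert (Hp : 0 < Rabs (y - snd p)) by (apply Rabs_pos_lt; lra).
  assert (Hm : Rabs (y - snd p) <= Cmod ((x, y) - p)) by apply (snd_le_Cmod ((x, y) - p)%C).
  rewrite Cmod_inv by (apply Cmod_neq_0; lra).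
  apply Rinv_le_contravar; lra.
Qed.

Lemma pole_mod_re p x y : fst p <> x -> Cmod (pole p (x, y)) <= / Rabs (x - fst p).
Proof.
  intros H; unfold pole.
  assert (Hp : 0 < Rabs (x - fst p)) by (apply Rabs_pos_lt; lra).
  assert (Hm : Rabs (x - fst p) <= Cmod ((x, y) - p)) by apply (fst_le_Cmod ((x, y) - p)%C).
  rewrite Cmod_inv by (apply Cmod_neq_0; lra).
  apply Rinv_le_contravar; lra.
Qed.

Lemma off_axis p x : snd p <> 0 -> RtoC x <> p.
Proof. intros H E; apply H; rewrite <- E; reflexivity. Qed.

(** For [x d/dx], which is invariant under dilations, one bound for the function
    [x / (x - p)] controls all its iterated derivatives. *)
Lemma dbound_x_pole n : exists A k, 0 <= A /\ forall p Q, snd p <> 0 -> 1 <= Q ->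
  (forall x, Cmod (RtoC x * pole p (RtoC x)) <= Q) ->
  dbound idR n (fun x => RtoC x * pole p (RtoC x))%C (fun _ => A * Q ^ k).
Proof.
  destruct (dbound_riccati 1 n) as [A [k [HA H]]].
  exists A, k; split; [exact HA|]; intros p Q Hp HQ Hb.
  apply (H idR (fun x => RtoC x * pole p (RtoC x))%C
    (fun x => 1 * pole p (RtoC x) + RtoC x * - (pole p (RtoC x) * pole p (RtoC x)))%C); auto.
  - intros x; apply dC_mult.
    + apply (dC_RtoC (fun t => t)); auto_derive; [trivial|ring].
    + apply (dC_pole p 0), off_axis, Hp.
  - intros x; unfold idR; ring.
Qed.

Lemma dbound_pole n : exists A k, 0 <= A /\ forall p Q, snd p <> 0 -> 1 <= Q ->
  (forall x, Cmod (RtoC x * pole p (RtoC x)) <= Q) ->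
  dbound idR n (fun x => pole p (RtoC x)) (fun x => A * Q ^ k * Cmod (pole p (RtoC x))).
Proof.
  destruct (dbound_x_pole n) as [A [k [HA H]]].
  assert (H2 : 0 < 2 ^ n) by (apply pow_lt; lra).
  exists ((1 + 2 ^ n * A) ^ n), (k * n)%nat; split; [apply pow_le; nra|]; intros p Q Hp HQ Hb.
  assert (HQk : 1 <= Q ^ k) by (apply pow_R1_Rle, HQ).
  apply (dbound_weaken _ _ _ (fun x => (1 + 2 ^ n * (A * Q ^ k)) ^ n * Cmod (pole p (RtoC x)))).
  - intros x; apply Rmult_le_compat_r; [apply Cmod_ge_0|].
    rewrite pow_mult, <- Rpow_mult_distr; apply pow_incr.
    assert (0 <= 2 ^ n * A) by nra. nra.
  - apply (dbound_log_derivative idR n _ (fun x => - pole p (RtoC x))%C).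
    + intros x; eapply dC_eq; [apply (dC_pole p 0), off_axis, Hp|]; unfold RtoC; ring.
    + replace (fun x => idR x * - pole p (RtoC x))%C
        with (fun x => RtoC (-1) * (RtoC x * pole p (RtoC x)))%C
        by (extensionality x; unfold idR; ring).
      apply (dbound_weaken _ _ _ (fun _ => Cmod (RtoC (-1)) * (A * Q ^ k))).
      * intros x; rewrite Cmod_R, Rabs_left by lra; lra.
      * apply dbound_scal, H; assumption.
Qed.

Lemma x_pole_imag del x : 0 < del -> Cmod (RtoC x * pole (0, - del)%R (RtoC x)) <= 1.
Proof.
  intros Hd; unfold pole.
  assert (Hm : Rabs x <= Cmod (RtoC x - ((0, - del)%R : C))).
  { replace (Rabs x) with (Rabs (fst (RtoC x - (0, - del)%R)%C)) by (simpl; f_equal; ring).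
    apply fst_le_Cmod. }
  assert (Hp : 0 < Cmod (RtoC x - (0, - del)%R)).
  { apply Cmod_gt_0; intros E; injection E; intros E1 _; simpl in E1; lra. }
  rewrite Cmod_mult, Cmod_inv, Cmod_R by (apply Cmod_gt_0, Hp).
  apply Rmult_le_reg_r with (Cmod (RtoC x - (0, - del)%R)); [exact Hp|].
  rewrite Rmult_assoc, Rinv_l by lra; lra.
Qed.

Lemma minus_Ci : (- Ci)%C = (0, - (1))%R.
Proof. apply injective_projections; simpl; ring. Qed.

Lemma pole_Ci_mod x : Cmod (pole (- Ci) (RtoC x)) * Cmod (pole (- Ci) (RtoC x)) = / (1 + x * x).
Proof.
  unfold pole; assert (Hx : 0 < 1 + x * x) by nra.
  assert (E : Cmod (RtoC x - - Ci) * Cmod (RtoC x - - Ci) = 1 + x * x).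
  { transitivity (Cmod (RtoC x - - Ci) ^ 2); [simpl; ring|].
    rewrite Cmod2_alt; unfold Re, Im; simpl; ring. }
  assert (Hp : (RtoC x - - Ci <> 0)%C).
  { intros H; rewrite H, Cmod_0 in E; lra. }
  rewrite Cmod_inv by exact Hp. rewrite <- E.
  assert (0 < Cmod (RtoC x - - Ci)) by (apply Cmod_gt_0, Hp).
  field; lra.
Qed.

Section UnitPoint.
Variable p : C.
Hypotheses (Hp1 : Cmod p = 1) (Hp2 : 0 < snd p).

Lemma unit_im_le : snd p <= 1.
Proof. pose proof (snd_le_Cmod p); pose proof (Rle_abs (snd p)); lra. Qed.

Lemma unit_inv_im : 1 <= / snd p.
Proof.
  pose proof unit_im_le; rewrite <- Rinv_1; apply Rinv_le_contravar; lra.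
Qed.

Lemma pole_unit_mod x : Cmod (pole p (RtoC x)) <= / snd p.
Proof.
  eapply Rle_trans; [apply pole_mod_im; lra|].
  rewrite Rminus_0_l, Rabs_Ropp, Rabs_pos_eq by lra; lra.
Qed.

Lemma unit_minus_neq x : (RtoC x - p <> 0)%C.
Proof. intros E; apply Cminus_eq_0 in E; revert E; apply off_axis; lra. Qed.

Lemma x_pole_unit x : Cmod (RtoC x * pole p (RtoC x)) <= 3 * / snd p.
Proof.
  replace (RtoC x * pole p (RtoC x))%C with (1 + p * pole p (RtoC x))%C
    by (unfold pole; field; apply unit_minus_neq).
  eapply Rle_trans; [apply Cmod_triangle|]; rewrite Cmod_1, Cmod_mult, Hp1.
  pose proof (pole_unit_mod x); pose proof unit_inv_im; lra.
Qed.

(** Comparison with the pole at [- i] expresses the decay of the kernel through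
    [1 / (1 + x ^ 2)] alone. *)
Lemma pole_unit_decay x : Cmod (pole p (RtoC x)) <= 3 * / snd p * Cmod (pole (- Ci) (RtoC x)).
Proof.
  assert (Hx : (RtoC x - - Ci <> 0)%C).
  { intros E; apply Cminus_eq_0 in E; revert E; apply off_axis; simpl; lra. }
  replace (pole p (RtoC x)) with ((1 + (p + Ci) * pole p (RtoC x)) * pole (- Ci) (RtoC x))%C.
  2: { unfold pole; field; split; [apply unit_minus_neq|exact Hx]. }
  rewrite Cmod_mult; apply Rmult_le_compat_r; [apply Cmod_ge_0|].
  eapply Rle_trans; [apply Cmod_triangle|]; rewrite Cmod_1, Cmod_mult.
  assert (Cmod (p + Ci) <= 2) by (eapply Rle_trans; [apply Cmod_triangle|]; rewrite Hp1, Cmod_Ci; lra).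
  pose proof (pole_unit_mod x); pose proof unit_inv_im.
  assert (Cmod (p + Ci) * Cmod (pole p (RtoC x)) <= 2 * / snd p)
    by (apply Rmult_le_compat; auto using Cmod_ge_0).
  lra.
Qed.

Lemma numer_unit lam del : 0 <= lam ->
  numer lam del p <> 0%C /\ Cmod (/ numer lam del p) <= 4 / Cmod (shifted_ipow lam del p).
Proof.
  intros Hl; unfold numer, pole.
  assert (Hq : (p - - Ci <> 0)%C).
  { intros E; apply Cminus_eq_0 in E; rewrite E in Hp2; simpl in Hp2; lra. }
  assert (Hw : shifted_ipow lam del p <> 0%C) by (apply Cmod_gt_0, shifted_ipow_pos).
  assert (Hp0 : p <> 0%C) by (intros E; rewrite E, Cmod_0 in Hp1; lra).
  assert (E : (/ (p * / (p - - Ci) * / (p - - Ci) * shifted_ipow lam del p))%C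
    = ((p - - Ci) * (p - - Ci) * / p * / shifted_ipow lam del p)%C) by (field; auto).
  split.
  - repeat apply Cmult_neq_0; auto; apply Cmod_gt_0; rewrite Cmod_inv by exact Hq;
      apply Rinv_0_lt_compat, Cmod_gt_0, Hq.
  - rewrite E, !Cmod_mult, !Cmod_inv, Hp1, Rinv_1, Rmult_1_r by assumption.
    apply Rmult_le_compat_r; [left; apply Rinv_0_lt_compat, shifted_ipow_pos|].
    assert (Cmod (p - - Ci) <= 2).
    { eapply Rle_trans; [apply Cmod_triangle_minus|]; rewrite Cmod_opp, Hp1, Cmod_Ci; lra. }
    pose proof (Cmod_ge_0 (p - - Ci)); nra.
Qed.

End UnitPoint.

Lemma dbound_shifted_ipow_axis n : exists A, 0 <= A /\ forall lam del, 0 <= lam -> 0 < del ->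
  dbound idR n (fun x => shifted_ipow lam del (RtoC x)) (fun x => A * (1 + lam) ^ n * Cmod (shifted_ipow lam del (RtoC x))).
Proof.
  destruct (dbound_x_pole n) as [A [k [HA H]]].
  assert (H2 : 0 < 2 ^ n) by (apply pow_lt; lra).
  exists ((1 + 2 ^ n * A) ^ n); split; [apply pow_le; nra|]; intros lam del Hl Hd.
  apply (dbound_weaken _ _ _ (fun x => (1 + 2 ^ n * (lam * A)) ^ n * Cmod (shifted_ipow lam del (RtoC x)))).
  - intros x; apply Rmult_le_compat_r; [apply Cmod_ge_0|].
    rewrite <- Rpow_mult_distr; apply pow_incr.
    assert (0 <= 2 ^ n * A) by nra.
    assert (0 <= 2 ^ n * A * lam) by nra. split; [nra|]. nra.
  - apply (dbound_log_derivative idR n _ (fun x => RtoC lam * Ci * pole (0, - del)%R (RtoC x))%C).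
    + intros x; apply (Cder_x (shifted_ipow lam del) x 0), Cder_shifted_ipow; simpl; lra.
    + replace (fun x => idR x * (RtoC lam * Ci * pole (0, - del)%R (RtoC x)))%C
        with (fun x => RtoC lam * Ci * (RtoC x * pole (0, - del)%R (RtoC x)))%C
        by (extensionality x; unfold idR; ring).
      apply (dbound_weaken _ _ _ (fun _ => Cmod (RtoC lam * Ci) * (A * 1 ^ k))).
      * intros x; rewrite pow1, Cmod_mult, Cmod_Ci, Cmod_R, Rabs_pos_eq by lra; lra.
      * apply dbound_scal, H; [simpl; lra|lra|intros; apply x_pole_imag, Hd].
Qed.

Lemma dbound_numer n : exists A, 0 <= A /\ forall lam del, 0 <= lam -> 0 < del ->
  dbound idR n (fun x => numer lam del (RtoC x))
    (fun x => A * (1 + lam) ^ n * (Cmod (pole (- Ci) (RtoC x)) * Cmod (shifted_ipow lam del (RtoC x)))).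
Proof.
  destruct (dbound_x_pole n) as [A1 [k1 [HA1 H1]]].
  destruct (dbound_pole n) as [A2 [k2 [HA2 H2]]].
  destruct (dbound_shifted_ipow_axis n) as [A3 [HA3 H3]].
  exists (2 ^ n * (2 ^ n * (A1 * A2) * A3)); split.
  { assert (0 <= 2 ^ n) by (apply pow_le; lra). repeat apply Rmult_le_pos; auto. }
  intros lam del Hl Hd.
  assert (Hi : snd (- Ci)%C <> 0) by (simpl; lra).
  assert (Hq : forall x, Cmod (RtoC x * pole (- Ci) (RtoC x)) <= 1).
  { intros x; rewrite minus_Ci; apply x_pole_imag; lra. }
  generalize (dbound_mult _ _ _ _ _ _ (dbound_mult _ _ _ _ _ _
    (H1 (- Ci)%C 1 Hi ltac:(lra) Hq) (H2 (- Ci)%C 1 Hi ltac:(lra) Hq)) (H3 lam del Hl Hd)).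
  apply dbound_weaken; intros x; rewrite !pow1; right; ring.
Qed.

Lemma dbound_pole_unit n : exists A k, 0 <= A /\ forall p, Cmod p = 1 -> 0 < snd p ->
  dbound idR n (fun x => pole p (RtoC x)) (fun x => A * (/ snd p) ^ k * Cmod (pole p (RtoC x))).
Proof.
  destruct (dbound_pole n) as [A [k [HA H]]].
  exists (A * 3 ^ k), k; split; [apply Rmult_le_pos; [auto|apply pow_le; lra]|].
  intros p Hp1 Hp2; pose proof (unit_inv_im p Hp1 Hp2).
  generalize (H p (3 * / snd p) ltac:(lra) ltac:(lra) (x_pole_unit p Hp1 Hp2)).
  apply dbound_weaken; intros x; rewrite Rpow_mult_distr; right; ring.
Qed.

(** Normalised so that the residue at [p] is [1]. *)
Definition kernel (lam del : R) (p z : C) : C :=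
  (/ numer lam del p * (numer lam del z * pole p z))%C.

(** The quotient of the weights is small where the argument of [x + i del]
    exceeds that of [p + i del]; the price is polynomial in [lam] and in
    [1 / snd p]. *)
Lemma kernel_axis_bound n : exists A k, 0 <= A /\ forall lam del p,
  0 <= lam -> 0 < del -> Cmod p = 1 -> 0 < snd p ->
  dbound idR n (fun x => kernel lam del p (RtoC x))
    (fun x => A * (1 + lam) ^ n * (/ snd p) ^ k *
      (Cmod (shifted_ipow lam del (RtoC x)) / Cmod (shifted_ipow lam del p)) * / (1 + x * x)).
Proof.
  destruct (dbound_numer n) as [A1 [HA1 H1]].
  destruct (dbound_pole_unit n) as [A2 [k2 [HA2 H2]]].
  assert (H2n : 0 <= 2 ^ n) by (apply pow_le; lra).
  exists (4 * (2 ^ n * (A1 * A2 * 3))), (S k2); split.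
  { repeat apply Rmult_le_pos; auto; lra. }
  intros lam del p Hl Hd Hp1 Hp2.
  destruct (numer_unit p Hp1 Hp2 lam del Hl) as [_ Hk].
  generalize (dbound_scal _ _ _ _ (/ numer lam del p)%C
    (dbound_mult _ _ _ _ _ _ (H1 lam del Hl Hd) (H2 p Hp1 Hp2))).
  apply dbound_weaken; intros x.
  pose proof (pole_unit_decay p Hp1 Hp2 x) as Hdec.
  set (c1 := Cmod (pole (- Ci) (RtoC x))) in *.
  pose proof (pole_Ci_mod x) as Hc; fold c1 in Hc.
  set (P := Cmod (shifted_ipow lam del (RtoC x))) in *.
  assert (HP : 0 < P) by apply shifted_ipow_pos.
  assert (Hc1 : 0 <= c1) by apply Cmod_ge_0.
  pose proof (shifted_ipow_pos lam del p) as Hpp.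
  set (Pp := Cmod (shifted_ipow lam del p)) in *.
  assert (Hil : 0 < / snd p) by (apply Rinv_0_lt_compat; lra).
  set (s := / snd p) in *.
  assert (HL : 0 <= (1 + lam) ^ n) by (apply pow_le; lra).
  assert (Hs : 0 <= s ^ k2) by (apply pow_le; lra).
  rewrite <- Hc.
  apply Rle_trans with (4 / Pp * (2 ^ n * (A1 * (1 + lam) ^ n * (c1 * P) * (A2 * s ^ k2 * (3 * s * c1))))).
  - assert (H0 : 0 <= A1 * (1 + lam) ^ n * (c1 * P)) by (repeat apply Rmult_le_pos; auto; lra).
    apply Rmult_le_compat; [apply Cmod_ge_0| |exact Hk|].
    + repeat apply Rmult_le_pos; auto; try lra; apply Cmod_ge_0.
    + apply Rmult_le_compat_l; [exact H2n|]; apply Rmult_le_compat_l; [exact H0|].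
      apply Rmult_le_compat_l; [apply Rmult_le_pos; auto|exact Hdec].
  - right; simpl; field; lra.
Qed.

(** By the resolvent identity the difference of the kernels with poles [p] and
    [p'] is [p - p'] times a product of the same type. *)
Lemma numer_pole_lipschitz n lam sig : 0 <= lam -> 0 < sig -> exists L, 0 <= L /\
  forall del p p', 0 < del ->
  Cmod p = 1 -> sig <= snd p -> Cmod p' = 1 -> sig <= snd p' ->
  dbound idR n (fun x => numer lam del (RtoC x) * pole p (RtoC x) - numer lam del (RtoC x) * pole p' (RtoC x))%C
    (fun x => L * Cmod (p - p') * / (1 + x * x)).
Proof.
  intros Hl Hsig.
  destruct (dbound_numer n) as [A1 [HA1 H1]].
  destruct (dbound_pole_unit n) as [A2 [k2 [HA2 H2]]].
  assert (H2n : 0 <= 2 ^ n) by (apply pow_le; lra).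
  assert (Hs1 : 0 < / sig) by (apply Rinv_0_lt_compat; lra).
  set (B := A2 * (/ sig) ^ k2).
  assert (HB : 0 <= B) by (apply Rmult_le_pos; [auto|apply pow_le; lra]).
  assert (HL : 0 <= (1 + lam) ^ n) by (apply pow_le; lra).
  exists (2 ^ n * (2 ^ n * (A1 * (1 + lam) ^ n * (B * (3 * / sig))) * (B * / sig))); split.
  { repeat apply Rmult_le_pos; auto; try lra; apply pow_le; lra. }
  intros del p p' Hd Hp1 Hp2 Hq1 Hq2.
  assert (Hpp : 0 < snd p) by lra. assert (Hqq : 0 < snd p') by lra.
  replace (fun x => numer lam del (RtoC x) * pole p (RtoC x) - numer lam del (RtoC x) * pole p' (RtoC x))%C
    with (fun x => (p - p') * ((numer lam del (RtoC x) * pole p (RtoC x)) * pole p' (RtoC x)))%C.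
  2: { extensionality x; unfold pole; field; split; apply unit_minus_neq; lra. }
  generalize (dbound_scal _ _ _ _ (p - p')%C (dbound_mult _ _ _ _ _ _ (dbound_mult _ _ _ _ _ _
    (H1 lam del Hl Hd) (H2 p Hp1 Hpp)) (H2 p' Hq1 Hqq))).
  apply dbound_weaken; intros x.
  pose proof (pole_unit_decay p Hp1 Hpp x) as Hdec.
  pose proof (pole_unit_mod p' Hqq x) as Hm.
  set (c1 := Cmod (pole (- Ci) (RtoC x))) in *.
  pose proof (pole_Ci_mod x) as Hc; fold c1 in Hc.
  assert (Hc1 : 0 <= c1) by apply Cmod_ge_0.
  pose proof (shifted_ipow_le_1 lam del (RtoC x) Hl) as HP1.
  pose proof (shifted_ipow_pos lam del (RtoC x)) as HP.
  set (P := Cmod (shifted_ipow lam del (RtoC x))) in *.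
  assert (Hi1 : / snd p <= / sig) by (apply Rinv_le_contravar; lra).
  assert (Hi2 : / snd p' <= / sig) by (apply Rinv_le_contravar; lra).
  assert (Hj1 : 0 < / snd p) by (apply Rinv_0_lt_compat; lra).
  assert (Hj2 : 0 < / snd p') by (apply Rinv_0_lt_compat; lra).
  assert (HB1 : A2 * (/ snd p) ^ k2 <= B).
  { apply Rmult_le_compat_l; [auto|]; apply pow_incr; lra. }
  assert (HB2 : A2 * (/ snd p') ^ k2 <= B).
  { apply Rmult_le_compat_l; [auto|]; apply pow_incr; lra. }
  assert (HB10 : 0 <= A2 * (/ snd p) ^ k2) by (apply Rmult_le_pos; [auto|apply pow_le; lra]).
  assert (HB20 : 0 <= A2 * (/ snd p') ^ k2) by (apply Rmult_le_pos; [auto|apply pow_le; lra]).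
  rewrite <- Hc.
  assert (HK0 : 0 <= A1 * (1 + lam) ^ n) by (apply Rmult_le_pos; auto).
  assert (S1 : A1 * (1 + lam) ^ n * (c1 * P) <= A1 * (1 + lam) ^ n * c1).
  { apply Rmult_le_compat_l; [auto|]; nra. }
  assert (S10 : 0 <= A1 * (1 + lam) ^ n * (c1 * P)) by (repeat apply Rmult_le_pos; auto; lra).
  assert (S2 : A2 * (/ snd p) ^ k2 * Cmod (pole p (RtoC x)) <= B * (3 * / sig * c1)).
  { apply Rmult_le_compat; auto using Cmod_ge_0.
    eapply Rle_trans; [exact Hdec|]; apply Rmult_le_compat_r; lra. }
  assert (S20 : 0 <= A2 * (/ snd p) ^ k2 * Cmod (pole p (RtoC x)))
    by (apply Rmult_le_pos; auto using Cmod_ge_0).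
  assert (S3 : A2 * (/ snd p') ^ k2 * Cmod (pole p' (RtoC x)) <= B * / sig).
  { apply Rmult_le_compat; auto using Cmod_ge_0. lra. }
  assert (S30 : 0 <= A2 * (/ snd p') ^ k2 * Cmod (pole p' (RtoC x)))
    by (apply Rmult_le_pos; auto using Cmod_ge_0).
  apply Rle_trans with (Cmod (p - p') *
    (2 ^ n * (2 ^ n * (A1 * (1 + lam) ^ n * c1 * (B * (3 * / sig * c1))) * (B * / sig)))).
  - apply Rmult_le_compat_l; [apply Cmod_ge_0|].
    apply Rmult_le_compat_l; [auto|]; apply Rmult_le_compat; auto.
    + apply Rmult_le_pos; [auto|apply Rmult_le_pos; [exact S10|exact S20]].
    + apply Rmult_le_compat_l; [auto|]; apply Rmult_le_compat; auto.
  - right; ring.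
Qed.

(** * Cauchy's formula for the boundary distribution *)

Definition cutoff (t : R) : C := (1 - step t - step (- t))%C.

Lemma cutoff_1 t : -1 <= t <= 1 -> cutoff t = 1%C.
Proof. intros H; unfold cutoff; rewrite !step_0 by lra; ring. Qed.

Lemma cutoff_0 t : t <= -2 \/ 2 <= t -> cutoff t = 0%C.
Proof.
  intros [H|H]; unfold cutoff.
  - rewrite step_0, step_1 by lra; ring.
  - rewrite step_1, step_0 by lra; ring.
Qed.

Lemma cutoff_eq : cutoff = (fun t => 1 + (RtoC (-1) * step t + RtoC (-1) * step (-1 * (t - 0))%R))%C.
Proof.
  extensionality t; unfold cutoff; replace (-1 * (t - 0)) with (- t) by ring; ring.
Qed.

Lemma cutoff_smooth : Smooth cutoff.
Proof.
  rewrite cutoff_eq; apply Smooth_plus; [apply Smooth_const|].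
  apply Smooth_plus; apply Smooth_scal; [apply step_smooth|].
  apply Smooth_affine, step_smooth.
Qed.

Lemma Smooth_idR : Smooth (fun x => RtoC (idR x)).
Proof.
  replace (fun x => RtoC (idR x)) with (fun x => RtoC (x - 0))
    by (extensionality x; unfold idR; f_equal; ring).
  apply Smooth_id.
Qed.

Lemma cutoff_dbound_idR n : exists M, 0 <= M /\ dbound idR n cutoff (fun _ => M).
Proof.
  destruct (step_dbound idR n Smooth_idR) as [M [HM H]].
  assert (H' := dbound_affine idR idR n step (fun _ => M) (-1) 0 1
    ltac:(intros; unfold idR; ring) H).
  rewrite cutoff_eq.
  eexists; split; [|apply (dbound_weaken _ _ _ _ _ (fun x => Rle_refl _)
    (dbound_plus _ _ _ _ _ _ (dbound_const idR n 1%C)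
      (dbound_plus _ _ _ _ _ _ (dbound_scal _ _ _ _ (RtoC (-1)) H) (dbound_scal _ _ _ _ (RtoC (-1)) H'))))].
  cbv beta.
  assert (0 <= (1 + Rabs 1) ^ n) by (apply pow_le; rewrite Rabs_R1; lra).
  rewrite Cmod_1, Cmod_R, Rabs_left by lra; nra.
Qed.

Lemma D_on_ends c d phi : c <= d -> D_on c d phi -> phi c = 0%C /\ phi d = 0%C.
Proof.
  intros Hcd [HS Hz].
  assert (G : forall x0, (forall e, 0 < e -> exists y, Rabs (y - x0) < e /\ phi y = 0%C) -> phi x0 = 0%C).
  { intros x0 H; apply Cmod_eq_0, Rle_antisym; [|apply Cmod_ge_0].
    apply le_epsilon; intros e He.
    pose proof (Smooth_cont phi x0 HS) as Hc; rewrite ccont_iff in Hc.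
    specialize (Hc e He); apply locally_R in Hc; destruct Hc as [d0 [Hd0 Hc]].
    destruct (H d0 Hd0) as [y [Hy E]]; specialize (Hc y Hy); rewrite E in Hc.
    replace (0 - phi x0)%C with (- phi x0)%C in Hc by ring; rewrite Cmod_opp in Hc; lra. }
  split; apply G; intros e He.
  - exists (c - e / 2); split; [|apply Hz; lra].
    rewrite Rabs_left; lra.
  - exists (d + e / 2); split; [|apply Hz; lra].
    rewrite Rabs_pos_eq; lra.
Qed.

(** In the unscaled variable the pole is at [x0 + rho * p] and has residue [rho]. *)
Definition scaled_kernel (x0 rho lam del : R) (p z : C) : C :=
  kernel lam del p (RtoC (/ rho) * (z - RtoC x0))%C.

Section Scaled.
Variables (x0 rho lam del : R) (p : C).
Hypotheses (Hrho : 0 < rho) (Hl : 0 <= lam) (Hdel : 0 < del) (Hp1 : Cmod p = 1) (Hp2 : 0 < snd p).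

Let u1 (z : C) := pole (x0, - rho)%R z.
Let u2 (z : C) := pole (x0 + rho * fst p, rho * snd p)%R z.
Let u3 (z : C) := pole (x0, - (rho * del))%R z.
Let Zs (z : C) : C := (RtoC (/ rho) * (z - RtoC x0))%C.
Let P (z : C) := shifted_ipow lam del (Zs z).

Lemma scaled_pole (q z : C) : pole q (Zs z) = (rho * pole (RtoC x0 + rho * q) z)%C.
Proof.
  unfold pole, Zs.
  assert (Hr : RtoC rho <> 0%C) by (intros E; injection E; lra).
  replace (RtoC (/ rho) * (z - RtoC x0) - q)%C with (/ rho * (z - (RtoC x0 + rho * q)))%C.
  2: { rewrite RtoC_inv by lra; field; exact Hr. }
  destruct (excluded_middle_informative (z - (RtoC x0 + rho * q) = 0)%C) as [E|E].
  - rewrite E, Cmult_0_r. unfold Cinv; simpl. unfold Rdiv; rewrite Ropp_0, !Rmult_0_l.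
    apply injective_projections; simpl; ring.
  - field; auto.
Qed.

Lemma scaled_points : (RtoC x0 + rho * - Ci)%C = (x0, - rho)%R /\
  (RtoC x0 + rho * p)%C = (x0 + rho * fst p, rho * snd p)%R /\
  (RtoC x0 + rho * (0, - del)%R)%C = (x0, - (rho * del))%R.
Proof. repeat split; apply injective_projections; simpl; ring. Qed.

Lemma Zs_im z : snd (Zs z) = / rho * snd z.
Proof. unfold Zs; simpl; ring. Qed.

(** In the unscaled variable every pole brings out a factor [rho]; the factor
    [X / (X + i)] is rewritten as [1 - i / (X + i)], which stays bounded. *)
Lemma scaled_kernel_eq z : - rho < snd z ->
  scaled_kernel x0 rho lam del p z =
  (/ numer lam del p * (RtoC (rho * rho) * ((1 + RtoC (- rho) * (Ci * u1 z)) * u1 z * u2 z * P z)))%C.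
Proof.
  intros Hz; unfold scaled_kernel, kernel, numer; fold (Zs z); fold (P z).
  destruct scaled_points as [E1 [E2 _]].
  assert (R1 : pole (- Ci) (Zs z) = (rho * u1 z)%C) by (rewrite scaled_pole, E1; reflexivity).
  assert (R2 : pole p (Zs z) = (rho * u2 z)%C) by (rewrite scaled_pole, E2; reflexivity).
  assert (Hne : (Zs z - - Ci <> 0)%C).
  { intros E; apply (f_equal snd) in E; simpl in E.
    assert (0 < / rho) by (apply Rinv_0_lt_compat; lra).
    assert (/ rho * snd z > -1).
    { apply Rmult_gt_reg_l with rho; [lra|]. rewrite <- Rmult_assoc, Rinv_r by lra; lra. }
    lra. }
  assert (R3 : (Zs z * pole (- Ci) (Zs z) = 1 - Ci * pole (- Ci) (Zs z))%C).
  { unfold pole; field; exact Hne. }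
  rewrite R3, R2, R1, RtoC_mult, RtoC_opp; ring.
Qed.

Lemma Cder_P z : - (rho * del) < snd z -> Cder P z (RtoC lam * Ci * u3 z * P z)%C.
Proof.
  intros Hz; eapply Cder_eq.
  - apply (Cder_comp (shifted_ipow lam del) Zs).
    + apply Cder_shifted_ipow; rewrite Zs_im.
      apply Rmult_lt_reg_l with rho; [lra|].
      replace (rho * (/ rho * snd z + del)) with (snd z + rho * del) by (field; lra); lra.
    + unfold Zs; apply Cder_mult; [apply Cder_const|].
      apply Cder_minus; [apply Cder_id|apply Cder_const].
  - rewrite scaled_pole; destruct scaled_points as [_ [_ E3]]; rewrite E3.
    fold (u3 z); unfold P. rewrite RtoC_inv by lra.
    field. intros E; injection E; lra.
Qed.

End Scaled.

Lemma dbound_pole_line n : exists A k, 0 <= A /\ forall q y, snd q <> y ->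
  dbound one_field n (fun x => pole q (x, y)) (fun x => A * (1 + Cmod (pole q (x, y))) ^ k).
Proof.
  destruct (dbound_riccati 0 n) as [A [k [HA H]]]; exists A, k; split; [exact HA|].
  intros q y Hq.
  apply (H one_field _ (fun x => - (pole q (x, y) * pole q (x, y)))%C (fun x => 1 + Cmod (pole q (x, y)))).
  - intros x; apply dC_pole; intros E; apply Hq; rewrite <- E; reflexivity.
  - intros x; unfold one_field; ring.
  - intros x; lra.
  - intros x; pose proof (Cmod_ge_0 (pole q (x, y))); lra.
Qed.

(** Away from the pole, and at distance comparable to [1] from [x0], the kernel
    of scale [rho] is of size [rho ^ 2] with all its derivatives, because two of its
    poles bring out a factor [rho] each, uniformly in [p] and [del]. *)
Lemma scaled_kernel_far n lam K : 0 <= lam -> 0 <= K -> exists B, 0 <= B /\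
  forall x0 rho del p y, 0 < rho <= 1 -> 0 < del -> Cmod p = 1 -> 0 < snd p ->
    0 <= y -> y <> rho * snd p ->
    exists w, dbound one_field n (fun x => scaled_kernel x0 rho lam del p (x, y)) w /\
      forall x, Cmod (pole (x0, - rho)%R (x, y)) <= K ->
        Cmod (pole (x0 + rho * fst p, rho * snd p)%R (x, y)) <= K ->
        Cmod (pole (x0, - (rho * del))%R (x, y)) <= K -> w x <= B * (rho * rho).
Proof.
  intros Hl HK.
  destruct (dbound_pole_line n) as [A [k [HA Hu]]].
  assert (H2 : 0 <= 2 ^ n) by (apply pow_le; lra).
  set (U := A * (1 + K) ^ k).
  assert (HU : 0 <= U) by (apply Rmult_le_pos; [auto|apply pow_le; lra]).
  assert (HUle : A * (1 + K) ^ k <= U) by (unfold U; lra).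
  clearbody U.
  set (V := (1 + 2 ^ n * (lam * U)) ^ n).
  assert (HlU : 0 <= 2 ^ n * (lam * U)) by (repeat apply Rmult_le_pos; auto).
  assert (HV : 0 <= V) by (apply pow_le; lra).
  set (E0 := 4 * / exp (- lam * PI)).
  assert (HE0 : 0 <= E0).
  { pose proof (exp_pos (- lam * PI)). assert (0 < / exp (- lam * PI)) by (apply Rinv_0_lt_compat; auto).
    unfold E0; lra. }
  exists (E0 * (2 ^ n * (2 ^ n * (2 ^ n * ((1 + U) * U) * U) * V))); split.
  { apply Rmult_le_pos; [exact HE0|]; repeat apply Rmult_le_pos; auto; lra. }
  intros x0 rho del p y [Hr0 Hr1] Hd Hp1 Hp2 Hy Hyp.
  set (q1 := (x0, - rho)%R); set (q2 := (x0 + rho * fst p, rho * snd p)%R);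
    set (q3 := (x0, - (rho * del))%R).
  assert (Hrd : 0 < rho * del) by nra.
  assert (Hu1 := Hu q1 y ltac:(simpl; lra)).
  assert (Hu2 := Hu q2 y ltac:(simpl; lra)).
  assert (Hu3 := Hu q3 y ltac:(simpl; lra)).
  set (P := fun x => shifted_ipow lam del (RtoC (/ rho) * ((x, y) - RtoC x0))%C).
  assert (HP : dbound one_field n P (fun x => (1 + 2 ^ n * (Cmod (RtoC lam * Ci)
      * (A * (1 + Cmod (pole q3 (x, y))) ^ k))) ^ n * Cmod (P x))).
  { apply (dbound_log_derivative one_field n P (fun x => RtoC lam * Ci * pole q3 (x, y))%C).
    - intros x; apply (Cder_x (fun z => shifted_ipow lam del (RtoC (/ rho) * (z - RtoC x0))%C)).
      apply (Cder_P x0 rho lam del p); simpl; lra.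
    - rewrite one_mult; apply dbound_scal, Hu3. }
  assert (H1 := dbound_plus _ _ _ _ _ _ (dbound_const one_field n 1%C)
    (dbound_scal _ _ _ _ (RtoC (- rho)) (dbound_scal _ _ _ _ Ci Hu1))).
  assert (Hall := dbound_scal _ _ _ _ (/ numer lam del p)%C (dbound_scal _ _ _ _ (RtoC (rho * rho))
    (dbound_mult _ _ _ _ _ _ (dbound_mult _ _ _ _ _ _ (dbound_mult _ _ _ _ _ _ H1 Hu1) Hu2) HP))).
  eexists; split.
  - replace (fun x => scaled_kernel x0 rho lam del p (x, y)) with
      (fun x => (/ numer lam del p * (RtoC (rho * rho) *
        ((1 + RtoC (- rho) * (Ci * pole q1 (x, y))) * pole q1 (x, y) * pole q2 (x, y) * P x)))%C).
    + exact Hall.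
    + extensionality x; symmetry; apply scaled_kernel_eq; auto; simpl; lra.
  - intros x B1 B2 B3; cbv beta.
    rewrite Cmod_1, !Cmod_R, Cmod_Ci, Cmod_mult, Cmod_Ci, Cmod_R.
    rewrite Rabs_Ropp, (Rabs_pos_eq rho), (Rabs_pos_eq lam), (Rabs_pos_eq (rho * rho)) by nra.
    assert (Bu : forall q, Cmod (pole q (x, y)) <= K -> 0 <= A * (1 + Cmod (pole q (x, y))) ^ k <= U).
    { intros q Hq; pose proof (Cmod_ge_0 (pole q (x, y))); split.
      - apply Rmult_le_pos; [auto|apply pow_le; lra].
      - eapply Rle_trans; [|exact HUle].
        apply Rmult_le_compat_l; [auto|apply pow_incr; lra]. }
    pose proof (Bu q1 B1) as C1; pose proof (Bu q2 B2) as C2; pose proof (Bu q3 B3) as C3.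
    set (a1 := A * (1 + Cmod (pole q1 (x, y))) ^ k) in *.
    set (a2 := A * (1 + Cmod (pole q2 (x, y))) ^ k) in *.
    set (a3 := A * (1 + Cmod (pole q3 (x, y))) ^ k) in *.
    pose proof (shifted_ipow_le_1 lam del (RtoC (/ rho) * ((x, y) - RtoC x0))%C Hl) as P1; fold (P x) in P1.
    pose proof (Cmod_ge_0 (P x)) as P0.
    destruct (numer_unit p Hp1 Hp2 lam del Hl) as [_ Hk].
    assert (Hk2 : Cmod (/ numer lam del p) <= E0).
    { eapply Rle_trans; [exact Hk|]; apply Rmult_le_compat_l; [lra|].
      apply Rinv_le_contravar; [apply exp_pos|apply shifted_ipow_ge, Hl]. }
    assert (G1 : 0 <= 1 + rho * (1 * a1) <= 1 + U) by nra.
    assert (G2 : 0 <= 2 ^ n * ((1 + rho * (1 * a1)) * a1) <= 2 ^ n * ((1 + U) * U)).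
    { split; [apply Rmult_le_pos; [auto|apply Rmult_le_pos; lra]|].
      apply Rmult_le_compat_l; [auto|apply Rmult_le_compat; lra]. }
    assert (G3 : 0 <= 2 ^ n * (2 ^ n * ((1 + rho * (1 * a1)) * a1) * a2)
      <= 2 ^ n * (2 ^ n * ((1 + U) * U) * U)).
    { split; [apply Rmult_le_pos; [auto|apply Rmult_le_pos; lra]|].
      apply Rmult_le_compat_l; [auto|apply Rmult_le_compat; lra]. }
    assert (G4 : 0 <= (1 + 2 ^ n * (lam * 1 * a3)) ^ n * Cmod (P x) <= V).
    { assert (0 <= 2 ^ n * (lam * 1 * a3) <= 2 ^ n * (lam * U)).
      { split; [apply Rmult_le_pos; [auto|apply Rmult_le_pos; lra]|].
        apply Rmult_le_compat_l; [auto|]; nra. }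
      split; [apply Rmult_le_pos; [apply pow_le; lra|auto]|].
      rewrite <- (Rmult_1_r V); apply Rmult_le_compat; auto; [apply pow_le; lra|].
      apply pow_incr; lra. }
    set (g3 := 2 ^ n * (2 ^ n * ((1 + rho * (1 * a1)) * a1) * a2)) in *.
    set (g4 := (1 + 2 ^ n * (lam * 1 * a3)) ^ n * Cmod (P x)) in *.
    apply Rle_trans with (E0 * (rho * rho * (2 ^ n * (2 ^ n * (2 ^ n * ((1 + U) * U) * U) * V)))).
    + apply Rmult_le_compat; [apply Cmod_ge_0| |exact Hk2|].
      * apply Rmult_le_pos; [nra|]; apply Rmult_le_pos; [auto|]; apply Rmult_le_pos; lra.
      * apply Rmult_le_compat_l; [nra|]; apply Rmult_le_compat_l; [auto|].
        apply Rmult_le_compat; lra.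
    + right; ring.
Qed.

Lemma filterlim_right_iff (g : R -> C) (l : C) :
  filterlim g (at_right 0) (locally (T := C_UniformSpace) l) <->
  (forall e, 0 < e -> exists eta, 0 < eta /\ forall y, 0 < y < eta -> Cmod (g y - l) < e).
Proof.
  split.
  - intros H e He.
    assert (HP : locally (T := C_UniformSpace) l (fun w => Cmod (w - l) < e)).
    { apply locally_Cmod; exists e; auto. }
    specialize (H _ HP); destruct H as [eta Heta].
    exists eta; split; [apply cond_pos|]; intros y [Hy1 Hy2]; apply Heta; [|exact Hy1].
    change (Rabs (y - 0) < eta); rewrite Rminus_0_r, Rabs_pos_eq; lra.
  - intros H P HP; apply locally_Cmod in HP; destruct HP as [e [He HP]].
    destruct (H e He) as [eta [Heta Hg]].
    exists (mkposreal eta Heta); intros y Hy Hy0; apply HP, Hg.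
    change (Rabs (y - 0) < eta) in Hy; rewrite Rminus_0_r, Rabs_pos_eq in Hy; lra.
Qed.

Section Local.
Variables (a b h x0 r : R) (F : C -> C) (f : functional).
Hypotheses (Hh : 0 < h) (Hr : 0 < r) (Ha : a < x0 - r) (Hb : x0 + r < b)
  (HF : holo F a b 0 h)
  (Hbv : forall phi, D_on (x0 - r) (x0 + r) phi ->
    filterlim (fun y => CInt (fun x => F (x, y) * phi x)%C (x0 - r) (x0 + r))
      (at_right 0) (locally (T := C_UniformSpace) (f phi))).

Let T (y : R) (phi : R -> C) : C := CInt (fun x => F (x, y) * phi x)%C (x0 - r) (x0 + r).

Lemma pairing_ex y phi : 0 < y < h -> D_on (x0 - r) (x0 + r) phi ->
  ex_CInt (fun x => F (x, y) * phi x)%C (x0 - r) (x0 + r).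
Proof.
  intros Hy [HS _]; apply ex_CInt_cont; intros x Hx; rewrite Rmin_left, Rmax_right in Hx by lra.
  apply ccont_mult; [|apply Smooth_cont, HS].
  apply (ccont_horizontal F), (holo_cont F a b 0 h); auto; lra.
Qed.

Lemma pairing_derive phi phi' y : D_on (x0 - r) (x0 + r) phi -> (forall x, dC phi x (phi' x)) ->
  0 < y < h -> dC (fun s => T s phi) y (- Ci * T y phi')%C.
Proof.
  intros HD Hd Hy.
  destruct (D_on_ends (x0 - r) (x0 + r) phi ltac:(lra) HD) as [E1 E2].
  apply (dC_pairing F phi phi' a b 0 h); auto; try lra.
  intros x; apply Smooth_cont, (D_on_deriv _ _ phi phi' HD Hd).
Qed.

Lemma pairing_bounded phi : D_on (x0 - r) (x0 + r) phi ->
  exists B, forall y, 0 < y <= h / 2 -> Cmod (T y phi) <= B.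
Proof.
  intros HD.
  destruct (proj1 (filterlim_right_iff _ _) (Hbv phi HD) 1 Rlt_0_1) as [eta [Heta Hlim]].
  set (e := Rmin eta (h / 2) / 2).
  pose proof (Rmin_l eta (h / 2)); pose proof (Rmin_r eta (h / 2)).
  assert (0 < Rmin eta (h / 2)) by (apply Rmin_glb_lt; lra).
  assert (He : 0 < e < eta /\ e < h / 2) by (unfold e; lra).
  destruct (Smooth_deriv phi (proj1 HD)) as [phi' [Hd _]].
  destruct (continuity_ab_maj (fun y => Cmod (T y phi)) e (h / 2)) as [m [Hm _]]; [lra| |].
  - intros y Hy; apply continuity_pt_filterlim, (continuous_Cmod (fun t => T t phi)).
    eapply dC_cont, (pairing_derive phi phi'); auto; lra.
  - exists (Cmod (f phi) + 1 + Cmod (T m phi)); intros y Hy.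
    pose proof (Cmod_ge_0 (f phi)); pose proof (Cmod_ge_0 (T m phi)).
    destruct (Rle_or_lt e y) as [Hey|Hey]; [specialize (Hm y ltac:(lra)); lra|].
    specialize (Hlim y ltac:(lra)); fold (T y phi) in Hlim.
    replace (T y phi) with ((T y phi - f phi) + f phi)%C by ring.
    eapply Rle_trans; [apply Cmod_triangle|]; lra.
Qed.

(** The pairings with the lines of height [y] are pointwise bounded as [y -> 0]
    because they converge, hence bounded in one [C^N]-norm. *)
Lemma pairing_uniform : exists A N, 0 <= A /\ forall y phi M, 0 < y <= h / 2 ->
  D_on (x0 - r) (x0 + r) phi -> dbound one_field N phi (fun _ => M) -> Cmod (T y phi) <= A * M.
Proof.
  destruct (uniform_boundedness {y : R | 0 < y <= h / 2} (fun i => T (proj1_sig i))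
    (x0 - r) (x0 + r)) as [A [N [HA H]]].
  - intros [y Hy] phi psi H1 H2; simpl; unfold T.
    rewrite <- CInt_plus by (apply pairing_ex; auto; lra).
    apply CInt_ext; intros; ring.
  - intros [y Hy] k phi H1; simpl; unfold T.
    rewrite <- (proj2 (CInt_scal (RtoC k) _ _ _ (pairing_ex y phi ltac:(lra) H1))).
    apply CInt_ext; intros; ring.
  - intros [y Hy]; simpl.
    assert (Hc : forall x, x0 - r <= x <= x0 + r -> continuous (fun x => Cmod (F (x, y))) x).
    { intros x Hx; apply (continuous_Cmod (fun t => F (t, y))).
      apply (ccont_horizontal F), (holo_cont F a b 0 h); auto; lra. }
    destruct (continuity_ab_maj (fun x => Cmod (F (x, y))) (x0 - r) (x0 + r)) as [m [Hm _]]; [lra| |].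
    + intros x Hx; apply continuity_pt_filterlim, Hc, Hx.
    + exists (2 * r * Cmod (F (m, y))).
      split; [apply Rmult_le_pos; [lra|apply Cmod_ge_0]|].
      intros phi M HD HM; unfold T.
      eapply Rle_trans; [apply (CInt_norm_const _ (Cmod (F (m, y)) * M))|].
      * lra.
      * intros x Hx; rewrite Cmod_mult; apply Rmult_le_compat; auto using Cmod_ge_0.
      * apply pairing_ex; auto; lra.
      * right; ring.
  - intros phi HD; destruct (pairing_bounded phi HD) as [B HB].
    exists B; intros [y Hy]; simpl; auto.
  - exists A, N; split; [exact HA|]; intros y phi M Hy HD HM.
    exact (H (exist _ y Hy) phi M HD HM).
Qed.

Definition cut (x : R) : C := cutoff (2 / r * (x - x0)).

Lemma cut_1 x : x0 - r / 2 <= x <= x0 + r / 2 -> cut x = 1%C.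
Proof.
  intros Hx; apply cutoff_1.
  assert (E : 2 / r * (r / 2) = 1) by (field; lra).
  assert (0 < 2 / r) by (apply Rdiv_lt_0_compat; lra).
  split; nra.
Qed.

Lemma cut_D : D_on (x0 - r) (x0 + r) cut.
Proof.
  split; [apply Smooth_affine, cutoff_smooth|].
  intros x Hx; apply cutoff_0.
  assert (E : 2 / r * r = 2) by (field; lra).
  assert (0 < 2 / r) by (apply Rdiv_lt_0_compat; lra).
  destruct (Rlt_or_le x (x0 - r)); [left; nra|right].
  assert (x0 + r < x) by (apply Rnot_le_lt; intros Q; apply Hx; lra). nra.
Qed.

Lemma D_on_dbound c d phi n : D_on c d phi -> exists M, 0 <= M /\ dbound one_field n phi (fun _ => M).
Proof.
  intros [HS Hz].
  apply (dbound_compact one_field n phi (Rabs c + Rabs d)).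
  - apply (Smooth_const 1%C).
  - exact HS.
  - pose proof (Rabs_pos c); pose proof (Rabs_pos d); lra.
  - intros x Hx; apply Hz; intros Hx'; apply Hx.
    pose proof (Rabs_pos c); pose proof (Rabs_pos d).
    pose proof (Rle_abs d); pose proof (Rle_abs (- c)) as Q; rewrite Rabs_Ropp in Q; lra.
Qed.

(** Cauchy's formula for [F (. + i s)] and the kernel with pole at
    [x0 + rho * p], whose value on the real axis is a fixed test function; then
    [s -> 0]. The contributions far from [x0] are controlled by uniform
    boundedness, as the kernel is [O (rho ^ 2)] there. *)
Theorem boundary_cauchy_formula lam : 0 <= lam -> exists B rho0, 0 <= B /\ 0 < rho0 /\
  forall rho del p, 0 < rho < rho0 -> 0 < del -> Cmod p = 1 -> 0 < snd p ->
    Cmod (f (fun x => scaled_kernel x0 rho lam del p (RtoC x) * cut x)%C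
      - RtoC (2 * PI) * Ci * (rho * F (RtoC x0 + rho * p)))%C <= B * (rho * rho).
Proof.
  intros Hl.
  destruct pairing_uniform as [A [N [HA HT]]].
  set (K := 4 / r + 8 / h).
  assert (HK1 : 0 < 4 / r) by (apply Rdiv_lt_0_compat; lra).
  assert (HK2 : 0 < 8 / h) by (apply Rdiv_lt_0_compat; lra).
  destruct (scaled_kernel_far N lam K Hl ltac:(unfold K; lra)) as [B0 [HB0 Hfar]].
  destruct (Smooth_deriv cut (proj1 cut_D)) as [cut' [Hcut' HScut']].
  assert (HD' : D_on (x0 - r) (x0 + r) cut') by (eapply D_on_deriv; [apply cut_D|exact Hcut']).
  destruct (D_on_dbound _ _ cut N cut_D) as [M1 [HM1 X1]].
  destruct (D_on_dbound _ _ cut' N HD') as [M2 [HM2 X2]].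
  assert (H2N : 0 <= 2 ^ N) by (apply pow_le; lra).
  set (Q1 := A * (2 ^ N * (B0 * M1))). set (Q2 := A * (2 ^ N * (B0 * M2))).
  assert (HQ1 : 0 <= Q1) by (unfold Q1; repeat apply Rmult_le_pos; auto).
  assert (HQ2 : 0 <= Q2) by (unfold Q2; repeat apply Rmult_le_pos; auto).
  exists (Q1 + h / 4 * Q2), (Rmin 1 (Rmin (r / 4) (h / 8))); split; [nra|].
  split; [repeat apply Rmin_glb_lt; lra|].
  intros rho del p [Hr0 Hr1] Hd Hp1 Hp2.
  pose proof (Rmin_l 1 (Rmin (r / 4) (h / 8))); pose proof (Rmin_r 1 (Rmin (r / 4) (h / 8))).
  pose proof (Rmin_l (r / 4) (h / 8)); pose proof (Rmin_r (r / 4) (h / 8)).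
  pose proof (unit_im_le p Hp1) as Hp3.
  assert (Hp4 : Rabs (fst p) <= 1) by (rewrite <- Hp1; apply fst_le_Cmod).
  assert (Hpx : - rho <= rho * fst p <= rho).
  { apply Rabs_le_between in Hp4; nra. }
  assert (Hpy : 0 < rho * snd p <= rho) by nra.
  assert (Hrd : 0 < rho * del) by nra.
  set (z := (x0 + rho * fst p, rho * snd p)%R).
  assert (Ez : (RtoC x0 + rho * p)%C = z) by (apply injective_projections; simpl; ring).
  rewrite Ez.
  set (hk := scaled_kernel x0 rho lam del p).
  (* where the cutoff is not locally constant, and on the line y = h / 4, the poles are far *)
  assert (HKre : forall (q : C) x y, Rabs (fst q - x0) <= rho -> r / 2 <= Rabs (x - x0) ->
    Cmod (pole q (x, y)) <= K).
  { intros q x y Hq Hx.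
    assert (Hf : r / 4 <= Rabs (x - fst q)).
    { pose proof (Rabs_triang (x - fst q) (fst q - x0)) as Q.
      replace (x - fst q + (fst q - x0)) with (x - x0) in Q by ring; lra. }
    eapply Rle_trans; [apply pole_mod_re|].
    - intros E; rewrite E, Rminus_diag, Rabs_R0 in Hf; lra.
    - apply Rle_trans with (/ (r / 4)); [apply Rinv_le_contravar; lra|].
      unfold K; replace (/ (r / 4)) with (4 / r) by (field; lra); lra. }
  assert (HKim : forall (q : C) x y, snd q <= rho -> h / 4 <= y -> Cmod (pole q (x, y)) <= K).
  { intros q x y Hq Hy.
    eapply Rle_trans; [apply pole_mod_im; lra|].
    rewrite Rabs_pos_eq by lra.
    apply Rle_trans with (/ (h / 8)); [apply Rinv_le_contravar; lra|].
    unfold K; replace (/ (h / 8)) with (8 / h) by (field; lra); lra. }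
  assert (Hq1 : Rabs (fst ((x0, - rho)%R : C) - x0) <= rho)
    by (simpl; rewrite Rminus_diag, Rabs_R0; lra).
  assert (Hq2 : Rabs (fst ((x0 + rho * fst p, rho * snd p)%R : C) - x0) <= rho)
    by (simpl; replace (x0 + rho * fst p - x0) with (rho * fst p) by ring; apply Rabs_le; lra).
  assert (Hq3 : Rabs (fst ((x0, - (rho * del))%R : C) - x0) <= rho)
    by (simpl; rewrite Rminus_diag, Rabs_R0; lra).
  assert (hkS : forall y, 0 <= y -> y <> rho * snd p -> Smooth (fun x => hk (x, y))).
  { intros y Hy Hyp n; destruct (scaled_kernel_far n lam K Hl ltac:(unfold K; lra)) as [B' [_ Hf']].
    destruct (Hf' x0 rho del p y) as [w [Hw _]]; auto; [lra|]. exists w; exact Hw. }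
  assert (E1 : forall y s, 0 <= y <= h / 4 -> y <> rho * snd p -> 0 < s <= h / 4 ->
    Cmod (T (y + s) (fun x => hk (x, y) * cut' x)%C) <= Q2 * (rho * rho)).
  { intros y s Hy Hyp Hs.
    destruct (Hfar x0 rho del p y ltac:(lra) Hd Hp1 Hp2 ltac:(lra) Hyp) as [w [Hw Hw2]].
    unfold Q2; rewrite Rmult_assoc; apply HT; [lra| |].
    - apply D_on_mult_r; [exact HD'|apply hkS; lra].
    - apply (dbound_localize _ _ _ (fun x => 2 ^ N * (w x * M2)) _
        (fun x => x0 - r / 2 < x < x0 + r / 2)).
      + intros x Hx; apply locally_R.
        exists (Rmin (x - (x0 - r / 2)) (x0 + r / 2 - x)); split; [apply Rmin_glb_lt; lra|].
        intros t Ht; pose proof (Rmin_l (x - (x0 - r / 2)) (x0 + r / 2 - x));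
          pose proof (Rmin_r (x - (x0 - r / 2)) (x0 + r / 2 - x)); apply Rabs_def2 in Ht; lra.
      + intros x Hx; replace (cut' x) with (RtoC 0); [ring|].
        apply (dC_unique (fun _ => 1%C) x); [apply dC_const|].
        apply (dC_ext_loc cut); [|apply Hcut'].
        apply locally_R.
        exists (Rmin (x - (x0 - r / 2)) (x0 + r / 2 - x)); split; [apply Rmin_glb_lt; lra|].
        intros t Ht; pose proof (Rmin_l (x - (x0 - r / 2)) (x0 + r / 2 - x));
          pose proof (Rmin_r (x - (x0 - r / 2)) (x0 + r / 2 - x)); apply Rabs_def2 in Ht.
        apply cut_1; lra.
      + intros x; repeat apply Rmult_le_pos; auto; nra.
      + intros x Hx.
        assert (Hx' : r / 2 <= Rabs (x - x0)).
        { destruct (Rle_or_lt x (x0 - r / 2)).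
          - rewrite Rabs_left1 by lra; lra.
          - assert (x0 + r / 2 <= x) by (apply Rnot_lt_le; intros Q; apply Hx; lra).
            rewrite Rabs_pos_eq by lra; lra. }
        specialize (Hw2 x (HKre _ x y Hq1 Hx') (HKre _ x y Hq2 Hx') (HKre _ x y Hq3 Hx')).
        replace (2 ^ N * (B0 * M2) * (rho * rho)) with (2 ^ N * (B0 * (rho * rho) * M2)) by ring.
        apply Rmult_le_compat_l; [auto|]; apply Rmult_le_compat_r; auto.
      + apply dbound_mult; assumption. }
  assert (E2 : forall s, 0 < s <= h / 4 ->
    Cmod (T (h / 4 + s) (fun x => hk (x, (h / 4)%R) * cut x)%C) <= Q1 * (rho * rho)).
  { intros s Hs.
    destruct (Hfar x0 rho del p (h / 4) ltac:(lra) Hd Hp1 Hp2 ltac:(lra) ltac:(lra)) as [w [Hw Hw2]].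
    unfold Q1; rewrite Rmult_assoc; apply HT; [lra| |].
    - apply D_on_mult_r; [exact cut_D|apply hkS; lra].
    - apply (dbound_weaken _ _ _ (fun x => 2 ^ N * (w x * M1))); [|apply dbound_mult; assumption].
      intros x.
      specialize (Hw2 x (HKim (x0, - rho)%R x (h / 4) ltac:(simpl; lra) ltac:(lra))
        (HKim (x0 + rho * fst p, rho * snd p)%R x (h / 4) ltac:(simpl; lra) ltac:(lra))
        (HKim (x0, - (rho * del))%R x (h / 4) ltac:(simpl; lra) ltac:(lra))).
      replace (2 ^ N * (B0 * M1) * (rho * rho)) with (2 ^ N * (B0 * (rho * rho) * M1)) by ring.
      apply Rmult_le_compat_l; [auto|]; apply Rmult_le_compat_r; auto. }
  (* Nf is the regular factor: F (w + i s) times the kernel without its pole *)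
  assert (Hs : forall s, 0 < s < h / 4 ->
    Cmod (T s (fun x => hk (RtoC x) * cut x)%C
      - RtoC (2 * PI) * Ci * (rho * F (fst z, snd z + s)%R)) <= (Q1 + h / 4 * Q2) * (rho * rho)).
  { intros s Hs.
    set (Nf := fun w => (F (w + (0, s)%R) * (/ numer lam del p
      * numer lam del (RtoC (/ rho) * (w - RtoC x0)) * rho))%C).
    set (m := Rmin s (Rmin (rho * del) rho)).
    assert (Hm : 0 < m) by (unfold m; repeat apply Rmin_glb_lt; lra).
    assert (Hm1 : m <= s) by apply Rmin_l.
    assert (Hm2 : m <= rho * del) by (eapply Rle_trans; [apply Rmin_r|apply Rmin_l]).
    assert (Hm3 : m <= rho) by (eapply Rle_trans; [apply Rmin_r|apply Rmin_r]).
    assert (Hrho : RtoC rho <> 0%C) by (intros E; injection E; lra).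
    assert (HN : holo Nf a b (- m) (h - s)).
    { intros x y Hx Hy.
      destruct (HF x (y + s) Hx ltac:(lra)) as [k1 Hk1].
      assert (D1 : Cder (fun w => F (w + (0, s)%R)) (x, y) ((1 + 0) * k1)%C).
      { apply (Cder_comp F (fun w => w + (0, s)%R)%C).
        - replace ((x, y) + (0, s)%R)%C with ((x, (y + s)%R) : C); [exact Hk1|].
          apply injective_projections; simpl; ring.
        - apply Cder_plus; [apply Cder_id|apply Cder_const]. }
      assert (D2 : exists k2, Cder (fun w => numer lam del (RtoC (/ rho) * (w - RtoC x0))%C) (x, y) k2).
      { assert (DZ : Cder (fun w => RtoC (/ rho) * (w - RtoC x0))%C (x, y)
          (0 * ((x, y) - RtoC x0) + RtoC (/ rho) * (1 - 0))%C).
        { apply (Cder_mult (fun _ => RtoC (/ rho)) (fun w => w - RtoC x0)%C);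
            [apply Cder_const|apply Cder_minus; [apply Cder_id|apply Cder_const]]. }
        assert (Hir : 0 < / rho) by (apply Rinv_0_lt_compat; lra).
        assert (Hyr : forall t, y > - (rho * t) -> / rho * y > - t).
        { intros t Ht; apply Rmult_gt_reg_l with rho; [lra|].
          rewrite <- Rmult_assoc, Rinv_r by lra; lra. }
        eexists; apply (Cder_comp (numer lam del) (fun w => RtoC (/ rho) * (w - RtoC x0))%C); [|exact DZ].
        unfold numer.
        assert (DR : Cder (pole (- Ci)) (RtoC (/ rho) * ((x, y) - RtoC x0))%C
          (- (pole (- Ci) (RtoC (/ rho) * ((x, y) - RtoC x0)) * pole (- Ci) (RtoC (/ rho) * ((x, y) - RtoC x0))))%C).
        { apply Cder_pole; intros E; apply (f_equal snd) in E; simpl in E.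
          specialize (Hyr 1 ltac:(lra)); lra. }
        apply Cder_mult; [|apply Cder_shifted_ipow; simpl; specialize (Hyr del ltac:(lra)); lra].
        apply Cder_mult; [|exact DR]. apply Cder_mult; [apply Cder_id|exact DR]. }
      destruct D2 as [k2 D2].
      eexists; unfold Nf; apply Cder_mult; [exact D1|].
      apply Cder_mult; [|apply Cder_const]; apply Cder_mult; [apply Cder_const|exact D2]. }
    assert (HNz : Nf z = (rho * F (fst z, snd z + s)%R)%C).
    { unfold Nf; replace (RtoC (/ rho) * (z - RtoC x0))%C with p.
      - replace (z + (0, s)%R)%C with ((fst z, (snd z + s)%R) : C)
          by (apply injective_projections; simpl; ring).
        rewrite Cinv_l by (apply numer_unit; auto). ring.
      - rewrite <- Ez, RtoC_inv by lra; field; exact Hrho. }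
    assert (HG : forall w, w <> z -> (Nf w * / (w - z))%C = (F (w + (0, s)%R) * hk w)%C).
    { intros w Hw.
      assert (Hwz : (w - z <> 0)%C) by (intros E; apply Hw, Cminus_eq_0, E).
      unfold Nf, hk, scaled_kernel, kernel, pole.
      replace (RtoC (/ rho) * (w - RtoC x0) - p)%C with (/ rho * (w - z))%C
        by (rewrite <- Ez, RtoC_inv by lra; field; exact Hrho).
      field; repeat split; auto; apply numer_unit; auto. }
    destruct (D_on_ends (x0 - r) (x0 + r) cut ltac:(lra) cut_D) as [C1 C2].
    assert (CE := cauchy_estimate Nf cut cut' a b (- m) (h - s) (x0 - r) (x0 + r)
      (x0 + rho * fst p) (rho * snd p) (r / 4) HN Ha Hb ltac:(lra) ltac:(lra) ltac:(lra) ltac:(lra)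
      Hcut' (fun x => Smooth_cont cut' x HScut') C1 C2
      ltac:(intros x Hx; apply cut_1; lra) 0 (h / 4) (Q2 * (rho * rho)) ltac:(lra) ltac:(lra)).
    assert (Pair : forall y g, 0 <= y -> y <> rho * snd p ->
      CInt (fun x => Nf (x, y) * / ((x, y) - z) * g x)%C (x0 - r) (x0 + r)
      = T (y + s) (fun x => hk (x, y) * g x)%C).
    { intros y g Hy Hyp; unfold T; apply CInt_ext; intros x _.
      rewrite HG.
      - replace ((x, y) + (0, s)%R)%C with ((x, (y + s)%R) : C)
          by (apply injective_projections; simpl; ring). ring.
      - intros E; apply Hyp; injection E; auto. }
    cbv zeta beta in CE; fold z in CE; rewrite (Pair 0 cut), (Pair (h / 4) cut) in CE by lra.
    rewrite HNz in CE.
    rewrite Rplus_0_l in CE.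
    eapply Rle_trans; [apply CE|].
    - intros y Hy Hyp; rewrite (Pair y cut') by lra. apply E1; lra.
    - specialize (E2 s ltac:(lra)); nra. }
  apply le_epsilon; intros e He.
  assert (HDk : D_on (x0 - r) (x0 + r) (fun x => hk (RtoC x) * cut x)%C).
  { apply D_on_mult_r; [exact cut_D|apply (hkS 0); lra]. }
  destruct (proj1 (filterlim_right_iff _ _) (Hbv _ HDk) (e / 2) ltac:(lra)) as [eta [Heta Hlim]].
  assert (HFc : ccont F z) by (apply (holo_cont F a b 0 h); auto; lra).
  rewrite ccont_iff in HFc.
  pose proof PI_RGT_0.
  destruct (proj1 (locally_Cmod _ _) (HFc (e / (4 * PI * rho)) ltac:(apply Rdiv_lt_0_compat; nra)))
    as [d2 [Hd2 HFd]].
  set (s := Rmin (Rmin eta (h / 4)) d2 / 2).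
  assert (Hs0 : 0 < Rmin (Rmin eta (h / 4)) d2) by (repeat apply Rmin_glb_lt; lra).
  pose proof (Rmin_l (Rmin eta (h / 4)) d2); pose proof (Rmin_r (Rmin eta (h / 4)) d2).
  pose proof (Rmin_l eta (h / 4)); pose proof (Rmin_r eta (h / 4)).
  assert (Hs1 : 0 < s < eta /\ s < h / 4 /\ s < d2) by (unfold s; lra).
  specialize (Hs s ltac:(lra)); specialize (Hlim s ltac:(lra)).
  fold (T s (fun x => hk (RtoC x) * cut x)%C) in Hlim.
  assert (HFs : Cmod (F (fst z, (snd z + s)%R) - F z) < e / (4 * PI * rho)).
  { apply HFd. replace ((fst z, (snd z + s)%R) - z)%C with (Ci * RtoC s)%C
      by (apply injective_projections; simpl; ring).
    rewrite Cmod_mult, Cmod_Ci, Cmod_R, Rabs_pos_eq; lra. }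
  set (t := T s (fun x => hk (RtoC x) * cut x)%C) in *.
  set (l := f (fun x => hk (RtoC x) * cut x)%C) in *.
  replace (l - RtoC (2 * PI) * Ci * (rho * F z))%C with
    ((t - RtoC (2 * PI) * Ci * (rho * F (fst z, (snd z + s)%R)))
     + (RtoC (2 * PI) * Ci * (rho * (F (fst z, (snd z + s)%R) - F z)) - (t - l)))%C by ring.
  eapply Rle_trans; [apply Cmod_triangle|].
  apply Rplus_le_compat; [exact Hs|].
  eapply Rle_trans; [apply Cmod_triangle_minus|].
  rewrite !Cmod_mult, Cmod_Ci, !Cmod_R, !Rabs_pos_eq by lra.
  assert (2 * PI * 1 * (rho * Cmod (F (fst z, (snd z + s)%R) - F z)) <= e / 2).
  { apply Rle_trans with (2 * PI * 1 * (rho * (e / (4 * PI * rho)))).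
    - apply Rmult_le_compat_l; [lra|]; apply Rmult_le_compat_l; lra.
    - right; field; lra. }
  lra.
Qed.

End Local.

(** * Uniformity in the angle *)

(** Compactness in its elementary form: pointwise smallness on a finite net, and
    the Lipschitz bound in between. *)
Lemma uniform_from_lipschitz (U : R -> R -> R) (L alpha beta rho0 : R) :
  0 <= L -> 0 < rho0 ->
  (forall t, alpha <= t <= beta -> forall e, 0 < e -> exists eta, 0 < eta /\
     forall rho, 0 < rho < eta -> U rho t <= e) ->
  (forall rho t t', 0 < rho < rho0 -> alpha <= t <= beta -> alpha <= t' <= beta ->
     U rho t' <= U rho t + L * Rabs (t' - t)) ->
  forall e, 0 < e -> exists eta, 0 < eta /\
     forall rho t, 0 < rho < eta -> alpha <= t <= beta -> U rho t <= e.
Proof.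
  intros HL Hrho0 Hpt HLip e He.
  set (dl := e / (2 * (L + 1))).
  assert (Hdl : 0 < dl) by (unfold dl; apply Rdiv_lt_0_compat; lra).
  assert (HLd : L * dl <= e / 2).
  { apply Rle_trans with ((L + 1) * dl); [nra|]. right; unfold dl; field; lra. }
  assert (G : forall m : nat, exists eta, 0 < eta /\ forall rho t, 0 < rho < eta ->
    alpha <= t <= beta -> t <= alpha + INR m * dl -> U rho t <= e).
  { induction m as [|m [eta [Heta IH]]].
    - destruct (Rle_or_lt alpha beta) as [Hab|Hab].
      + destruct (Hpt alpha ltac:(lra) e He) as [eta [Heta H]].
        exists eta; split; [exact Heta|]; intros rho t Hr1 Ht Ht2.
        simpl in Ht2; rewrite Rmult_0_l in Ht2; replace t with alpha by lra; auto.
      + exists 1; split; [lra|]; intros; lra.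
    - destruct (Rle_or_lt (alpha + INR m * dl) beta) as [Hm|Hm].
      + assert (Hm0 : alpha <= alpha + INR m * dl).
        { pose proof (pos_INR m); nra. }
        destruct (Hpt (alpha + INR m * dl) ltac:(lra) (e / 2) ltac:(lra)) as [eta2 [Heta2 H]].
        exists (Rmin (Rmin eta eta2) rho0); split; [repeat apply Rmin_glb_lt; auto|].
        intros rho t [Hr0 Hr1] Ht Ht2.
        pose proof (Rmin_l (Rmin eta eta2) rho0); pose proof (Rmin_r (Rmin eta eta2) rho0).
        pose proof (Rmin_l eta eta2); pose proof (Rmin_r eta eta2).
        destruct (Rle_or_lt t (alpha + INR m * dl)) as [Hc|Hc]; [apply IH; lra|].
        rewrite S_INR in Ht2.
        specialize (HLip rho (alpha + INR m * dl) t ltac:(lra) ltac:(lra) Ht).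
        specialize (H rho ltac:(lra)).
        rewrite Rabs_pos_eq in HLip by lra.
        assert (L * (t - (alpha + INR m * dl)) <= L * dl) by (apply Rmult_le_compat_l; lra).
        lra.
      + exists eta; split; [exact Heta|]; intros rho t Hr0 Ht Ht2; apply IH; auto; lra. }
  destruct (INR_archimed dl (beta - alpha) Hdl) as [m Hm].
  destruct (G m) as [eta [Heta H]]; exists eta; split; [exact Heta|].
  intros rho t Hr0 Ht; apply H; auto; lra.
Qed.

Lemma unit_angle_dist t t' :
  Cmod ((cos t', sin t') - (cos t, sin t)) <= 2 * Rabs (t' - t).
Proof.
  assert (G : forall (g g' : R -> R), (forall x, is_derive g x (g' x)) -> (forall x, -1 <= g' x <= 1) ->
    Rabs (g t' - g t) <= Rabs (t' - t)).
  { intros g g' Hd Hg.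
    destruct (MVT_gen g t t' g') as [c [_ E]].
    - intros x _; apply Hd.
    - intros x _; apply derivable_continuous_pt; exists (g' x); apply is_derive_Reals, Hd.
    - rewrite E, Rabs_mult; rewrite <- (Rmult_1_l (Rabs (t' - t))) at 2.
      apply Rmult_le_compat_r; [apply Rabs_pos|]; apply Rabs_le, Hg. }
  eapply Rle_trans; [apply Cmod_le_sum|]; simpl.
  pose proof (G cos (fun x => - sin x)) as G1; pose proof (G sin cos) as G2.
  assert (Rabs (cos t' - cos t) <= Rabs (t' - t)).
  { apply G1; [intros x; apply is_derive_cos|intros x; pose proof (SIN_bound x); lra]. }
  assert (Rabs (sin t' - sin t) <= Rabs (t' - t)).
  { apply G2; [intros x; apply is_derive_sin|intros x; pose proof (COS_bound x); lra]. }
  unfold Rminus in *; lra.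
Qed.

Lemma unit_angle p : Cmod p = 1 -> 0 <= snd p ->
  exists t, 0 <= t <= PI /\ p = (cos t, sin t).
Proof.
  intros Hp Hs; destruct p as [p1 p2]; simpl in Hs.
  assert (E : p1 * p1 + p2 * p2 = 1).
  { transitivity (Cmod (p1, p2) ^ 2); [rewrite Cmod2_alt; unfold Re, Im; simpl; ring|].
    rewrite Hp; ring. }
  assert (Hp1 : -1 <= p1 <= 1) by nra.
  exists (acos p1); split; [apply acos_bound|].
  rewrite cos_acos, sin_acos by exact Hp1; f_equal.
  replace (1 - p1²) with (p2 * p2) by (unfold Rsqr; lra).
  symmetry; apply sqrt_square, Hs.
Qed.

(** * The harmonic weight on the negative axis *)

Lemma exp_beats_pow (m : nat) (K g e : R) : 0 <= K -> 0 < g -> 0 < e ->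
  exists lam, 0 <= lam /\ K * (1 + lam) ^ m * exp (- lam * g) <= e.
Proof.
  intros HK Hg He.
  assert (Hfact : 0 < INR (Factorial.fact (S m))) by apply INR_fact_lt_0.
  assert (Hgm : 0 < g ^ S m) by (apply pow_lt; exact Hg).
  pose proof (exp_pos g) as Heg.
  set (Q := K * exp g * INR (Factorial.fact (S m)) / g ^ S m).
  assert (HQ : 0 <= Q).
  { unfold Q; apply Rmult_le_pos; [|left; apply Rinv_0_lt_compat; lra].
    apply Rmult_le_pos; [apply Rmult_le_pos; lra|lra]. }
  assert (HQe : 0 <= Q / e) by (apply Rmult_le_pos; [exact HQ|left; apply Rinv_0_lt_compat; lra]).
  exists (Q / e); split; [exact HQe|].
  set (L := 1 + Q / e).
  assert (HL : 1 <= L) by (unfold L; lra).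
  assert (HLm : 0 < L ^ S m) by (apply pow_lt; lra).
  pose proof (pow_fact_le_exp (L * g) (S m) ltac:(nra)) as Hexp.
  replace (- (Q / e) * g) with (g + - (L * g)) by (unfold L; ring).
  rewrite exp_plus, exp_Ropp.
  assert (Hinv : / exp (L * g) <= INR (Factorial.fact (S m)) / (L * g) ^ S m).
  { replace (INR (Factorial.fact (S m)) / (L * g) ^ S m)
      with (/ ((L * g) ^ S m / INR (Factorial.fact (S m)))).
    - apply Rinv_le_contravar; [|exact Hexp].
      apply Rdiv_lt_0_compat; [apply pow_lt; nra|exact Hfact].
    - assert (0 < (L * g) ^ S m) by (apply pow_lt; nra). field; lra. }
  apply Rle_trans with (K * L ^ m * (exp g * (INR (Factorial.fact (S m)) / (L * g) ^ S m))).
  - fold L; apply Rmult_le_compat_l; [apply Rmult_le_pos; [lra|apply pow_le; lra]|].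
    apply Rmult_le_compat_l; lra.
  - rewrite Rpow_mult_distr.
    replace (K * L ^ m * (exp g * (INR (Factorial.fact (S m)) / (L ^ S m * g ^ S m))))
      with (Q / L).
    + apply Rmult_le_reg_r with L; [lra|].
      unfold Rdiv; rewrite Rmult_assoc, Rinv_l, Rmult_1_r by lra.
      replace (e * L) with (e + Q) by (unfold L; field; lra). lra.
    + unfold Q; simpl. assert (L ^ m <> 0) by (apply pow_nonzero; lra).
      assert (g ^ m <> 0) by (apply pow_nonzero; lra). field; repeat split; lra.
Qed.

(** A negative point has larger argument than every point of the sector, once
    the shift of the base point is small compared with its modulus; with the
    shift [tau / (1 / sig + 1)] the cotangents of the two arguments are at most
    [- (1 / sig + 1)] and at least [- 1 / sig]. *)
Lemma weight_gap lam sig tau p X : 0 <= lam -> 0 < sig -> 0 < tau -> Cmod p = 1 -> sig <= snd p ->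
  X <= - tau ->
  Cmod (shifted_ipow lam (tau / (/ sig + 1)) (RtoC X)) / Cmod (shifted_ipow lam (tau / (/ sig + 1)) p)
    <= exp (- lam * (atan (/ sig + 1) - atan (/ sig))).
Proof.
  intros Hl Hsig Htau Hp1 Hp2 HX.
  assert (Hs : 0 < / sig) by (apply Rinv_0_lt_compat; lra).
  set (del := tau / (/ sig + 1)).
  assert (Hdel : 0 < del) by (apply Rdiv_lt_0_compat; lra).
  rewrite !shifted_ipow_mod.
  unfold Rdiv at 1; rewrite <- exp_Ropp, <- exp_plus.
  apply exp_le_compat.
  assert (G : atan (/ sig + 1) - atan (/ sig)
    <= arg (RtoC X + (0, del)) - arg (p + (0, del))).
  { unfold arg; simpl. rewrite !Rplus_0_r, Rplus_0_l.
    assert (A1 : atan (X / del) <= - atan (/ sig + 1)).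
    { rewrite <- atan_opp. destruct (Req_dec (X / del) (- (/ sig + 1))) as [E|E]; [rewrite E; lra|].
      left; apply atan_increasing. apply Rle_lt_or_eq_dec in HX.
      assert (X / del <= - (/ sig + 1)); [|lra].
      apply Rmult_le_reg_r with del; [lra|].
      replace (X / del * del) with X by (field; lra).
      replace (- (/ sig + 1) * del) with (- tau) by (unfold del; field; lra).
      destruct HX; lra. }
    assert (A2 : - atan (/ sig) <= atan (fst p / (snd p + del))).
    { rewrite <- atan_opp.
      assert (Hle : - / sig <= fst p / (snd p + del)).
      { apply Rmult_le_reg_r with (snd p + del); [lra|].
        replace (fst p / (snd p + del) * (snd p + del)) with (fst p) by (field; lra).
        pose proof (fst_le_Cmod p) as Q; rewrite Hp1 in Q; apply Rabs_le_between in Q.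
        assert (1 <= / sig * (snd p + del)).
        { replace 1 with (/ sig * sig) by (field; lra). apply Rmult_le_compat_l; lra. }
        lra. }
      destruct Hle as [Hlt|E]; [left; apply atan_increasing, Hlt|rewrite E; lra]. }
    lra. }
  nra.
Qed.

Lemma weight_ratio lam del p z : 0 <= lam ->
  0 <= Cmod (shifted_ipow lam del z) / Cmod (shifted_ipow lam del p) <= exp (lam * PI).
Proof.
  intros Hl; pose proof (shifted_ipow_pos lam del z); pose proof (shifted_ipow_pos lam del p).
  split; [left; apply Rdiv_lt_0_compat; assumption|].
  pose proof (shifted_ipow_le_1 lam del z Hl); pose proof (shifted_ipow_ge lam del p Hl) as Hg.
  apply Rle_trans with (1 * / exp (- lam * PI)).
  - apply Rmult_le_compat; [lra| |lra|apply Rinv_le_contravar; [apply exp_pos|exact Hg]].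
    left; apply Rinv_0_lt_compat; assumption.
  - rewrite Rmult_1_l, <- exp_Ropp; right; f_equal; ring.
Qed.

(** * Growth and limit in sectors *)

Lemma Smooth_pole q : snd q <> 0 -> Smooth (fun x => pole q (RtoC x)).
Proof. intros Hq n; destruct (dbound_pole_line n) as [A [k [_ H]]]; eexists; apply (H q 0 Hq). Qed.

Lemma Smooth_shifted_ipow lam del : 0 < del -> Smooth (fun x => shifted_ipow lam del (RtoC x)).
Proof.
  intros Hd n; destruct (dbound_pole_line n) as [A [k [_ H]]].
  eexists; apply (dbound_log_derivative one_field n _ (fun x => RtoC lam * Ci * pole (0, - del)%R (RtoC x))%C).
  - intros x; apply (Cder_x (shifted_ipow lam del) x 0), Cder_shifted_ipow; simpl; lra.
  - rewrite one_mult; apply dbound_scal, (H (0, - del)%R 0); simpl; lra.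
Qed.

Lemma Smooth_numer lam del : 0 < del -> Smooth (fun x => numer lam del (RtoC x)).
Proof.
  intros Hd; unfold numer.
  assert (Hi : snd (- Ci)%C <> 0) by (simpl; lra).
  apply Smooth_mult; [|apply Smooth_shifted_ipow, Hd].
  apply Smooth_mult; [|apply Smooth_pole, Hi].
  apply Smooth_mult; [|apply Smooth_pole, Hi].
  apply (Smooth_intro _ (fun _ => RtoC 1)); [|apply Smooth_const].
  intros x; apply (dC_RtoC (fun t => t)); auto_derive; [trivial|ring].
Qed.

Lemma numer_0 lam del : numer lam del (RtoC 0) = 0%C.
Proof. unfold numer; ring. Qed.

Lemma Smooth_kernel lam del p : 0 < del -> 0 < snd p -> Smooth (fun x => kernel lam del p (RtoC x)).
Proof.
  intros Hd Hp; unfold kernel; apply Smooth_scal, Smooth_mult;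
    [apply Smooth_numer, Hd|apply Smooth_pole; lra].
Qed.

Lemma kernel_0 lam del p : kernel lam del p (RtoC 0) = 0%C.
Proof. unfold kernel; rewrite numer_0; ring. Qed.

Lemma two_pi_gt_1 : 1 <= 2 * PI.
Proof. pose proof PI2_1; lra. Qed.

Section Angular.
Variables (a b h x0 r : R) (F : C -> C) (f : functional) (n : nat) (M : R).
Hypotheses (Hh : 0 < h) (Hr : 0 < r) (Ha : a < x0 - r) (Hb : x0 + r < b)
  (HF : holo F a b 0 h)
  (Hbv : forall phi, D_on (x0 - r) (x0 + r) phi ->
    filterlim (fun y => CInt (fun x => F (x, y) * phi x)%C (x0 - r) (x0 + r))
      (at_right 0) (locally (T := C_UniformSpace) (f phi)))
  (Hlin : forall c phi psi, D_on (x0 - r) (x0 + r) phi -> D_on (x0 - r) (x0 + r) psi ->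
    f (fun x => c * phi x + psi x)%C = (c * f phi + f psi)%C)
  (HM : 0 <= M)
  (Hlog : forall phi s kap, D_on (x0 - r) (x0 + r) phi -> phi x0 = 0%C -> 0 < s -> 0 <= kap ->
    dbound (fun x => x - x0) n phi (fun x => kap * (s / (s * s + (x - x0) * (x - x0)))) ->
    Cmod (f phi) <= M * kap).

Lemma f_plus phi psi : D_on (x0 - r) (x0 + r) phi -> D_on (x0 - r) (x0 + r) psi ->
  f (fun x => phi x + psi x)%C = (f phi + f psi)%C.
Proof.
  intros H1 H2; pose proof (Hlin 1 phi psi H1 H2) as H.
  replace (fun x => 1 * phi x + psi x)%C with (fun x => phi x + psi x)%C in H
    by (extensionality x; ring).
  rewrite H; ring.
Qed.

Lemma f_zero : f (fun _ => 0%C) = 0%C.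
Proof.
  assert (D0 : D_on (x0 - r) (x0 + r) (fun _ => 0%C)).
  { split; [apply Smooth_const|auto]. }
  pose proof (Hlin (-1) _ _ D0 D0) as H; cbv beta in H.
  replace (fun _ : R => (-1 * 0 + 0)%C) with (fun _ : R => RtoC 0) in H
    by (extensionality x; ring).
  rewrite H; ring.
Qed.

Lemma f_scal c phi : D_on (x0 - r) (x0 + r) phi -> f (fun x => c * phi x)%C = (c * f phi)%C.
Proof.
  intros H1.
  assert (D0 : D_on (x0 - r) (x0 + r) (fun _ => 0%C)).
  { split; [apply Smooth_const|auto]. }
  pose proof (Hlin c phi _ H1 D0) as H; cbv beta in H; rewrite f_zero in H.
  replace (fun x => c * phi x + 0)%C with (fun x => c * phi x)%C in H
    by (extensionality x; ring).
  rewrite H; ring.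
Qed.

Lemma D_on_dilate rho psi : 0 < rho -> D_on (- (r / rho)) (r / rho) psi ->
  D_on (x0 - r) (x0 + r) (fun x => psi (/ rho * (x - x0))).
Proof.
  intros Hrho [HS Hz]; split; [apply Smooth_affine, HS|].
  intros x Hx; apply Hz; intros [H1 H2]; apply Hx.
  assert (0 < / rho) by (apply Rinv_0_lt_compat; lra).
  assert (E : x - x0 = rho * (/ rho * (x - x0))) by (field; lra).
  assert (E2 : rho * (r / rho) = r) by (field; lra).
  assert (rho * (/ rho * (x - x0)) <= rho * (r / rho)) by (apply Rmult_le_compat_l; lra).
  assert (rho * - (r / rho) <= rho * (/ rho * (x - x0))) by (apply Rmult_le_compat_l; lra).
  nra.
Qed.

(** Both sides of the bound scale alike, as [(x - x0) d/dx] commutes with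
    dilations about [x0] and the weight is a Cauchy density of mass
    proportional to [kap]. *)
Lemma f_dilate_bound rho psi s kap : 0 < rho -> D_on (- (r / rho)) (r / rho) psi ->
  psi 0 = 0%C -> 0 < s -> 0 <= kap ->
  dbound idR n psi (fun x => kap * (s / (s * s + x * x))) ->
  Cmod (f (fun x => psi (/ rho * (x - x0)))) <= M * 2 ^ n * kap * rho.
Proof.
  intros Hrho HD H0 Hs Hk HX.
  assert (H2 : 0 <= 2 ^ n) by (apply pow_le; lra).
  replace (M * 2 ^ n * kap * rho) with (M * (2 ^ n * kap * rho)) by ring.
  apply (Hlog _ (s * rho)).
  - apply D_on_dilate; assumption.
  - rewrite Rminus_diag, Rmult_0_r; exact H0.
  - nra.
  - apply Rmult_le_pos; [apply Rmult_le_pos; auto|lra].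
  - generalize (dbound_affine idR (fun x => x - x0) n psi _ (/ rho) x0 1
      ltac:(intros; unfold idR; ring) HX).
    apply dbound_weaken; intros x; rewrite Rabs_R1; replace (1 + 1) with 2 by ring.
    right. set (t := x - x0).
    assert (0 < s * s) by nra. pose proof (Rle_0_sqr t) as Q; unfold Rsqr in Q.
    assert (0 < s * s * (rho * rho)) by (apply Rmult_lt_0_compat; nra).
    replace (s * s + / rho * t * (/ rho * t))
      with ((s * rho * (s * rho) + t * t) / (rho * rho)) by (field; lra).
    field; repeat split; nra.
Qed.

Definition outer_cut (rho X : R) : C := cutoff (2 * rho / r * (X - 0)).

Lemma outer_cut_D rho : 0 < rho -> D_on (- (r / rho)) (r / rho) (outer_cut rho).
Proof.
  intros Hrho; split; [apply Smooth_affine, cutoff_smooth|].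
  intros X HX; apply cutoff_0; rewrite Rminus_0_r.
  assert (E : 2 * rho / r * (r / rho) = 2) by (field; lra).
  assert (0 < 2 * rho / r) by (apply Rdiv_lt_0_compat; lra).
  destruct (Rlt_or_le X (- (r / rho))); [left; nra|right].
  assert (r / rho < X) by (apply Rnot_le_lt; intros Q; apply HX; lra). nra.
Qed.

Lemma scaled_kernel_dilate lam del p rho : 0 < rho ->
  (fun x => scaled_kernel x0 rho lam del p (RtoC x) * cut x0 r x)%C =
  (fun x => (fun X => kernel lam del p (RtoC X) * outer_cut rho X)%C (/ rho * (x - x0))).
Proof.
  intros Hrho; extensionality x; unfold scaled_kernel, cut, outer_cut.
  f_equal.
  - f_equal; rewrite RtoC_mult, RtoC_minus; reflexivity.
  - f_equal; field; lra.
Qed.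

Lemma outer_cut_dbound : exists S, 0 <= S /\ forall rho, dbound idR n (outer_cut rho) (fun _ => S).
Proof.
  destruct (cutoff_dbound_idR n) as [S [HS H]].
  exists ((1 + Rabs 1) ^ n * S); split.
  { apply Rmult_le_pos; [apply pow_le; rewrite Rabs_R1; lra|auto]. }
  intros rho; apply (dbound_affine idR idR n cutoff _ (2 * rho / r) 0 1
    ltac:(intros; unfold idR; ring) H).
Qed.

(** Without weight ([lam = 0]) the kernel is bounded by a power of [1 / snd p] times
    the Cauchy density, hence so is [F], uniformly on all scales [rho]. *)
Theorem angular_growth : exists A k rho0, 0 <= A /\ 0 < rho0 /\ forall rho p,
  0 < rho < rho0 -> Cmod p = 1 -> 0 < snd p ->
  Cmod (F (RtoC x0 + rho * p)%C) <= A * (/ snd p) ^ k.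
Proof.
  destruct (boundary_cauchy_formula a b h x0 r F f Hh Hr Ha Hb HF Hbv 0 (Rle_refl 0))
    as [B [rho1 [HB [Hrho1 HC]]]].
  destruct (kernel_axis_bound n) as [A [k [HA HK]]].
  destruct outer_cut_dbound as [S [HS HX]].
  assert (H2 : 0 <= 2 ^ n) by (apply pow_le; lra).
  set (A' := M * 2 ^ n * (2 ^ n * (A * S))).
  assert (HA' : 0 <= A') by (unfold A'; repeat apply Rmult_le_pos; auto).
  exists (A' + B), k, (Rmin rho1 1); split; [lra|]; split; [apply Rmin_glb_lt; lra|].
  intros rho p [Hr0 Hr1] Hp1 Hp2.
  pose proof (Rmin_l rho1 1); pose proof (Rmin_r rho1 1).
  specialize (HC rho 1 p ltac:(lra) Rlt_0_1 Hp1 Hp2).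
  rewrite scaled_kernel_dilate in HC by lra.
  pose proof (unit_inv_im p Hp1 Hp2) as Hinv.
  assert (Hpk : 1 <= (/ snd p) ^ k) by (apply pow_R1_Rle, Hinv).
  set (psi := fun X => (kernel 0 1 p (RtoC X) * outer_cut rho X)%C) in *.
  assert (Hf : Cmod (f (fun x => psi (/ rho * (x - x0)))) <=
    M * 2 ^ n * (2 ^ n * (A * (/ snd p) ^ k * S)) * rho).
  { apply (f_dilate_bound rho psi 1); [lra| | |lra| |].
    - apply D_on_mult_r; [apply outer_cut_D; lra|apply Smooth_kernel; lra].
    - unfold psi; rewrite kernel_0; ring.
    - apply Rmult_le_pos; [auto|]; apply Rmult_le_pos; [apply Rmult_le_pos; lra|auto].
    - generalize (dbound_mult _ _ _ _ _ _ (HK 0 1 p (Rle_refl 0) Rlt_0_1 Hp1 Hp2) (HX rho)).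
      apply dbound_weaken; intros x; right.
      rewrite !shifted_ipow_mod, !Ropp_0, !Rmult_0_l, exp_0, Rplus_0_r, pow1.
      assert (1 + x * x <> 0) by nra. field; repeat split; lra || nra. }
  set (T := f (fun x => psi (/ rho * (x - x0)))) in *.
  set (Fz := F (RtoC x0 + rho * p)%C) in *.
  pose proof (Cmod_triangle_minus T (T - RtoC (2 * PI) * Ci * (rho * Fz))) as Q.
  replace (T - (T - RtoC (2 * PI) * Ci * (rho * Fz)))%C
    with (RtoC (2 * PI) * Ci * (rho * Fz))%C in Q by ring.
  pose proof two_pi_gt_1.
  rewrite !Cmod_mult, Cmod_Ci, !Cmod_R, !Rabs_pos_eq in Q by lra.
  pose proof (Cmod_ge_0 Fz).
  assert (rho * Cmod Fz <= 2 * PI * 1 * (rho * Cmod Fz)).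
  { assert (0 <= rho * Cmod Fz) by nra. nra. }
  apply Rmult_le_reg_l with rho; [lra|].
  eapply Rle_trans; [eassumption|]. eapply Rle_trans; [exact Q|].
  eapply Rle_trans; [apply Rplus_le_compat; [exact Hf|exact HC]|].
  replace (M * 2 ^ n * (2 ^ n * (A * (/ snd p) ^ k * S)) * rho)
    with (rho * (A' * (/ snd p) ^ k)) by (unfold A'; ring).
  assert (B * (rho * rho) <= rho * (B * (/ snd p) ^ k)).
  { replace (B * (rho * rho)) with (rho * (B * rho)) by ring.
    apply Rmult_le_compat_l; [lra|]; apply Rmult_le_compat_l; lra. }
  lra.
Qed.

Hypothesis Hright : forall c d psi, 0 < c -> D_on c d psi -> forall e, 0 < e ->
  exists eta, 0 < eta /\ forall rho, 0 < rho < eta ->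
    Cmod (f (fun x => psi (/ rho * (x - x0)))) <= e * rho.

Definition middle_cut (tau X : R) : C := (step (/ tau * (X - 0)) * (1 - step (tau * (X - 0))))%C.

Lemma middle_cut_D tau : 0 < tau -> D_on tau (2 / tau) (middle_cut tau).
Proof.
  intros Ht; split.
  - unfold middle_cut; apply Smooth_mult; [apply Smooth_affine, step_smooth|].
    replace (fun X => 1 - step (tau * (X - 0))%R)%C
      with (fun X => 1 + RtoC (-1) * step (tau * (X - 0))%R)%C by (extensionality X; ring).
    apply Smooth_plus; [apply Smooth_const|]; apply Smooth_scal, Smooth_affine, step_smooth.
  - intros X HX; unfold middle_cut; rewrite Rminus_0_r.
    destruct (Rlt_or_le X tau) as [H|H].
    + rewrite step_0; [ring|]. apply Rmult_le_reg_l with tau; [lra|].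
      rewrite <- Rmult_assoc, Rinv_r by lra; lra.
    + assert (HX2 : 2 / tau < X) by (apply Rnot_le_lt; intros Q; apply HX; lra).
      rewrite (step_1 (tau * X)); [ring|].
      replace 2 with (tau * (2 / tau)) by (field; lra). nra.
Qed.

Lemma step_dilate_dbound : exists S, 0 <= S /\ forall c, dbound idR n (fun X => step (c * (X - 0))) (fun _ => S).
Proof.
  destruct (step_dbound idR n Smooth_idR) as [S [HS H]].
  exists ((1 + Rabs 1) ^ n * S); split.
  { apply Rmult_le_pos; [apply pow_le; rewrite Rabs_R1; lra|auto]. }
  intros c; apply (dbound_affine idR idR n step _ c 0 1 ltac:(intros; unfold idR; ring) H).
Qed.

Lemma middle_cut_dbound : exists S, 0 <= S /\ forall tau, dbound idR n (middle_cut tau) (fun _ => S).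
Proof.
  destruct step_dilate_dbound as [S [HS H]].
  assert (H2 : 0 <= 2 ^ n) by (apply pow_le; lra).
  exists (2 ^ n * (S * (1 + S))); split; [repeat apply Rmult_le_pos; lra|].
  intros tau; unfold middle_cut; apply dbound_mult; [apply H|].
  replace (fun X => 1 - step (tau * (X - 0))%R)%C
    with (fun X => 1 + RtoC (-1) * step (tau * (X - 0))%R)%C by (extensionality X; ring).
  apply (dbound_weaken _ _ _ (fun x => Cmod 1 + Cmod (RtoC (-1)) * S)).
  - intros x; rewrite Cmod_1, Cmod_R, Rabs_left by lra; lra.
  - apply (dbound_plus _ _ _ _ _ _ (dbound_const idR n 1%C) (dbound_scal _ _ _ _ (RtoC (-1)) (H tau))).
Qed.

(** For a fixed pole the kernel cut off to a compact part of the positive axis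
    is one test function, to which the lateral limit applies; the Lipschitz
    dependence on the pole makes this uniform in the sector. *)
Lemma mid_part_small lam del tau sig : 0 <= lam -> 0 < del -> 0 < tau -> 0 < sig ->
  forall e, 0 < e -> exists eta, 0 < eta /\ forall rho p, 0 < rho < eta ->
    Cmod p = 1 -> sig <= snd p ->
    Cmod (f (fun x => (fun X => numer lam del (RtoC X) * pole p (RtoC X) * middle_cut tau X)%C (/ rho * (x - x0))))
      <= e * rho.
Proof.
  intros Hl Hd Ht Hsig.
  set (psi := fun p X => (numer lam del (RtoC X) * pole p (RtoC X) * middle_cut tau X)%C).
  destruct (numer_pole_lipschitz n lam sig Hl Hsig) as [L [HL HLip]].
  destruct middle_cut_dbound as [S [HS HmX]].
  assert (H2 : 0 <= 2 ^ n) by (apply pow_le; lra).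
  assert (Ht2 : 0 < 2 / tau) by (apply Rdiv_lt_0_compat; lra).
  set (rho0 := r * tau / 2).
  assert (Hrho0 : 0 < rho0) by (unfold rho0; apply Rdiv_lt_0_compat; nra).
  assert (Hsup : forall rho, 0 < rho < rho0 -> 2 / tau <= r / rho).
  { intros rho [H0 H1]; unfold rho0 in H1.
    apply Rmult_le_reg_r with (rho * tau); [nra|].
    replace (2 / tau * (rho * tau)) with (2 * rho) by (field; lra).
    replace (r / rho * (rho * tau)) with (r * tau) by (field; lra). lra. }
  assert (HDpsi : forall p, 0 < snd p -> D_on tau (2 / tau) (psi p)).
  { intros p Hp; apply D_on_mult_r; [apply middle_cut_D, Ht|].
    apply Smooth_mult; [apply Smooth_numer, Hd|apply Smooth_pole; lra]. }
  set (Lip := M * 2 ^ n * (2 ^ n * (L * S)) * 2).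
  assert (HLipp : 0 <= Lip) by (unfold Lip; repeat apply Rmult_le_pos; lra).
  assert (Dif : forall rho p p', 0 < rho < rho0 -> Cmod p = 1 -> sig <= snd p ->
    Cmod p' = 1 -> sig <= snd p' ->
    Cmod (f (fun x => psi p' (/ rho * (x - x0)))) <=
    Cmod (f (fun x => psi p (/ rho * (x - x0)))) + M * 2 ^ n * (2 ^ n * (L * Cmod (p' - p) * S)) * rho).
  { intros rho p p' Hrho Hp1 Hp2 Hq1 Hq2.
    assert (HD1 : D_on (x0 - r) (x0 + r) (fun x => psi p (/ rho * (x - x0)))).
    { apply D_on_dilate; [lra|]. specialize (Hsup rho Hrho).
      apply (D_on_widen tau (2 / tau)); [lra|lra|apply HDpsi; lra]. }
    set (dif := fun X => ((numer lam del (RtoC X) * pole p' (RtoC X)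
      - numer lam del (RtoC X) * pole p (RtoC X)) * middle_cut tau X)%C).
    assert (HDd : D_on (- (r / rho)) (r / rho) dif).
    { specialize (Hsup rho Hrho). apply (D_on_widen tau (2 / tau)); [lra|lra|].
      apply (D_on_mult_r _ _ (middle_cut tau)); [apply middle_cut_D, Ht|].
      replace (fun X => numer lam del (RtoC X) * pole p' (RtoC X) - numer lam del (RtoC X) * pole p (RtoC X))%C
        with (fun X => numer lam del (RtoC X) * pole p' (RtoC X)
          + RtoC (-1) * (numer lam del (RtoC X) * pole p (RtoC X)))%C by (extensionality X; ring).
      apply Smooth_plus; [|apply Smooth_scal]; apply Smooth_mult;
        (apply Smooth_numer, Hd) || (apply Smooth_pole; lra). }
    assert (HB := f_dilate_bound rho dif 1 (2 ^ n * (L * Cmod (p' - p) * S)) ltac:(lra) HDd).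
    assert (E : f (fun x => psi p' (/ rho * (x - x0))) =
      (f (fun x => psi p (/ rho * (x - x0))%R) + f (fun x => dif (/ rho * (x - x0))%R))%C).
    { rewrite <- f_plus; [|exact HD1|apply (D_on_dilate rho _ ltac:(lra) HDd)].
      f_equal; extensionality x; unfold psi, dif; ring. }
    rewrite E; eapply Rle_trans; [apply Cmod_triangle|]; apply Rplus_le_compat_l.
    apply HB; [unfold dif; rewrite numer_0; ring|lra| |].
    - repeat apply Rmult_le_pos; auto using Cmod_ge_0.
    - generalize (dbound_mult _ _ _ _ _ _ (HLip del p' p Hd Hq1 Hq2 Hp1 Hp2) (HmX tau)).
      apply dbound_weaken; intros x; right. assert (1 + x * x <> 0) by nra. field; lra || nra. }
  intros e He.
  set (th := asin (Rmin sig 1)).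
  assert (Hm : 0 < Rmin sig 1 <= 1) by (split; [apply Rmin_glb_lt; lra|apply Rmin_r]).
  assert (Hths : sin th = Rmin sig 1) by (apply sin_asin; lra).
  assert (Hth0 : 0 < th).
  { destruct (Rlt_or_le 0 th) as [Q|Q]; [exact Q|exfalso].
    pose proof (asin_bound (Rmin sig 1)) as Hbd; fold th in Hbd.
    assert (sin th <= sin 0) by (apply sin_incr_1; lra).
    rewrite sin_0 in *; lra. }
  (* on this range of angles the value 0 is taken only if sig > 1, when no pole qualifies *)
  destruct (uniform_from_lipschitz
    (fun rho t => if Rle_dec sig (sin t) then Cmod (f (fun x => psi (cos t, sin t) (/ rho * (x - x0)))) / rho
       else 0) Lip th (PI - th) rho0) with (e := e) as [eta [Heta Hu]]; auto.
  - intros t _ e1 He1; destruct (Rle_dec sig (sin t)) as [Hsin|Hsin].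
    + destruct (Hright tau (2 / tau) (psi (cos t, sin t)) Ht (HDpsi (cos t, sin t) ltac:(simpl; lra)) e1 He1)
        as [eta [Heta H]].
      exists eta; split; [exact Heta|]; intros rho Hrho; specialize (H rho Hrho).
      apply Rmult_le_reg_r with rho; [lra|].
      unfold Rdiv; rewrite Rmult_assoc, Rinv_l, Rmult_1_r by lra; exact H.
    + exists 1; split; [lra|]; intros; lra.
  - intros rho t t' Hrho Htt Htt'.
    assert (Hall : forall s, th <= s <= PI - th -> Rmin sig 1 <= sin s).
    { intros s Hs; rewrite <- Hths.
      pose proof (asin_bound (Rmin sig 1)) as Hbd; fold th in Hbd.
      destruct (Rle_or_lt s (PI / 2)).
      - apply sin_incr_1; lra.
      - replace (sin s) with (sin (PI - s)) by (rewrite sin_PI_x; reflexivity).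
        apply sin_incr_1; lra. }
    destruct (Rle_or_lt sig 1) as [Hs1|Hs1].
    + rewrite Rmin_left in Hall by lra.
      destruct (Rle_dec sig (sin t')) as [S1|S1]; [|exfalso; apply S1, Hall, Htt'].
      destruct (Rle_dec sig (sin t)) as [S2|S2]; [|exfalso; apply S2, Hall, Htt].
      specialize (Dif rho (cos t, sin t) (cos t', sin t') Hrho (unit_circle_mod t) S2 (unit_circle_mod t') S1).
      pose proof (unit_angle_dist t t') as Hdist.
      apply Rmult_le_reg_r with rho; [lra|].
      unfold Rdiv; rewrite Rmult_plus_distr_r, !Rmult_assoc, Rinv_l, !Rmult_1_r by lra.
      eapply Rle_trans; [exact Dif|]; apply Rplus_le_compat_l.
      apply Rle_trans with (M * 2 ^ n * (2 ^ n * (L * (2 * Rabs (t' - t)) * S)) * rho).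
      * apply Rmult_le_compat_r; [lra|]; apply Rmult_le_compat_l; [apply Rmult_le_pos; auto|].
        apply Rmult_le_compat_l; [auto|]; apply Rmult_le_compat_r; [auto|].
        apply Rmult_le_compat_l; auto.
      * right; unfold Lip; ring.
    + pose proof (SIN_bound t); pose proof (SIN_bound t').
      destruct (Rle_dec sig (sin t')); [lra|]; destruct (Rle_dec sig (sin t)); [lra|].
      pose proof (Rabs_pos (t' - t)); nra.
  - exists eta; split; [exact Heta|]; intros rho p Hrho Hp1 Hp2.
    destruct (unit_angle p Hp1 ltac:(lra)) as [t [Ht0 Ept]].
    assert (Hst : sig <= sin t) by (rewrite Ept in Hp2; exact Hp2).
    assert (Hsig1 : sig <= 1) by (pose proof (SIN_bound t); lra).
    rewrite Rmin_left in Hths by lra.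
    pose proof (asin_bound (Rmin sig 1)) as Hbd; fold th in Hbd.
    specialize (Hu rho t Hrho).
    destruct (Rle_dec sig (sin t)) as [S1|S1]; [|contradiction].
    assert (Htr : th <= t <= PI - th).
    { rewrite <- Hths in Hst.
      destruct (Rle_or_lt t (PI / 2)).
      - assert (th <= t) by (apply sin_incr_0; lra). lra.
      - rewrite <- (sin_PI_x t) in Hst.
        assert (th <= PI - t) by (apply sin_incr_0; lra). lra. }
    specialize (Hu Htr). rewrite Ept.
    apply Rmult_le_compat_r with (r := rho) in Hu; [|lra].
    unfold Rdiv in Hu; rewrite Rmult_assoc, Rinv_l, Rmult_1_r in Hu by lra. exact Hu.
Qed.

(** The line is cut into four parts. The negative one is small by the weight,
    the neighbourhoods of [0] and [+ oo] by their size, and the middle of the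
    positive axis by the lateral limit. *)
Theorem angular_limit_unit sig eta : 0 < sig -> 0 < eta ->
  exists rho0, 0 < rho0 /\ forall rho p, 0 < rho < rho0 -> Cmod p = 1 -> sig <= snd p ->
    Cmod (F (RtoC x0 + rho * p)%C) <= eta.
Proof.
  intros Hsig Heta.
  destruct (kernel_axis_bound n) as [A [k [HA HK]]].
  destruct outer_cut_dbound as [C1 [HC1 HX1]].
  destruct step_dilate_dbound as [S [HS HXS]].
  assert (H2 : 0 <= 2 ^ n) by (apply pow_le; lra).
  set (S' := 1 + 2 * S + 2 ^ n * (S * S)).
  assert (HSS : 0 <= 2 ^ n * (S * S)) by (repeat apply Rmult_le_pos; auto).
  assert (HS' : 0 <= S') by (unfold S'; lra).
  assert (His : 0 < / sig) by (apply Rinv_0_lt_compat; lra).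
  set (g := atan (/ sig + 1) - atan (/ sig)).
  assert (Hg : 0 < g).
  { assert (atan (/ sig) < atan (/ sig + 1)) by (apply atan_increasing; lra). unfold g; lra. }
  set (Kc := 2 ^ n * (2 ^ n * (A * (/ sig) ^ k * C1) * S')).
  assert (HKc : 0 <= Kc).
  { unfold Kc; apply Rmult_le_pos; [auto|]; apply Rmult_le_pos; [|auto].
    apply Rmult_le_pos; [auto|]; apply Rmult_le_pos; [|auto].
    apply Rmult_le_pos; [auto|apply pow_le; lra]. }
  set (Mn := M * 2 ^ n).
  assert (HMn : 0 <= Mn) by (apply Rmult_le_pos; auto).
  (* lam settles the negative axis; tau, chosen after it, absorbs the factor exp (lam * PI) *)
  destruct (exp_beats_pow n (Mn * Kc) g (eta / 4)) as [lam [Hl Hlam]];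
    [apply Rmult_le_pos; auto|exact Hg|lra|].
  set (W0 := Kc * (1 + lam) ^ n).
  assert (HW0 : 0 <= W0) by (apply Rmult_le_pos; [auto|apply pow_le; lra]).
  set (E := exp (lam * PI)).
  assert (HE : 0 < E) by apply exp_pos.
  assert (HWE : 0 <= Mn * (W0 * E)) by (apply Rmult_le_pos; [auto|apply Rmult_le_pos; lra]).
  set (tau := eta / (4 * (7 * (Mn * (W0 * E)) + 1))).
  assert (Htau : 0 < tau) by (unfold tau; apply Rdiv_lt_0_compat; lra).
  assert (Htau7 : 7 * tau * (Mn * (W0 * E)) <= eta / 4).
  { apply Rle_trans with (tau * (7 * (Mn * (W0 * E)) + 1)); [nra|].
    right; unfold tau; field; lra. }
  set (del := tau / (/ sig + 1)).
  assert (Hdel : 0 < del) by (apply Rdiv_lt_0_compat; lra).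
  destruct (boundary_cauchy_formula a b h x0 r F f Hh Hr Ha Hb HF Hbv lam Hl)
    as [B [rho1 [HB [Hrho1 HC]]]].
  destruct (mid_part_small lam del tau sig Hl Hdel Htau Hsig (eta / (16 * E)))
    as [rho2 [Hrho2 Hmid]]; [apply Rdiv_lt_0_compat; lra|].
  set (rho3 := Rmin (r * tau / 4) (eta / (4 * (B + 1)))).
  assert (Hrho3 : 0 < rho3).
  { unfold rho3; apply Rmin_glb_lt; apply Rdiv_lt_0_compat; nra. }
  exists (Rmin (Rmin rho1 rho2) rho3); split; [apply Rmin_glb_lt; [apply Rmin_glb_lt; auto|exact Hrho3]|].
  intros rho p [Hr0 Hr1] Hp1 Hp2.
  pose proof (Rmin_l (Rmin rho1 rho2) rho3); pose proof (Rmin_r (Rmin rho1 rho2) rho3).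
  pose proof (Rmin_l rho1 rho2); pose proof (Rmin_r rho1 rho2).
  assert (R3 : rho < r * tau / 4) by (assert (rho3 <= r * tau / 4) by apply Rmin_l; lra).
  assert (R4 : rho < eta / (4 * (B + 1))) by (assert (rho3 <= eta / (4 * (B + 1))) by apply Rmin_r; lra).
  assert (Hp3 : 0 < snd p) by lra.
  specialize (HC rho del p ltac:(lra) Hdel Hp1 Hp3).
  rewrite scaled_kernel_dilate in HC by lra.
  specialize (Hmid rho p ltac:(lra) Hp1 Hp2).
  set (K := fun X => (kernel lam del p (RtoC X) * outer_cut rho X)%C) in *.
  set (ratio := fun X => Cmod (shifted_ipow lam del (RtoC X)) / Cmod (shifted_ipow lam del p)).
  assert (Hratio : forall X, 0 <= ratio X <= E) by (intros; apply weight_ratio, Hl).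
  assert (HKD : D_on (- (r / rho)) (r / rho) K).
  { apply D_on_mult_r; [apply outer_cut_D; lra|apply Smooth_kernel; auto]. }
  assert (HKX : dbound idR n K (fun X => 2 ^ n * (A * (1 + lam) ^ n * (/ sig) ^ k * ratio X * / (1 + X * X) * C1))).
  { generalize (dbound_mult _ _ _ _ _ _ (HK lam del p Hl Hdel Hp1 Hp3) (HX1 rho)).
    apply dbound_weaken; intros X.
    apply Rmult_le_compat_l; [auto|]; apply Rmult_le_compat_r; [auto|].
    apply Rmult_le_compat_r; [left; apply Rinv_0_lt_compat; nra|].
    apply Rmult_le_compat_r; [apply Hratio|].
    apply Rmult_le_compat_l; [apply Rmult_le_pos; [auto|apply pow_le; lra]|].
    apply pow_incr; split; [left; apply Rinv_0_lt_compat; lra|apply Rinv_le_contravar; lra]. }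
  assert (piece : forall (beta : R -> C) (U : R -> Prop) s kap,
    Smooth beta -> dbound idR n beta (fun _ => S') -> (forall X, U X -> locally X U) ->
    (forall X, U X -> beta X = 0%C) -> 0 < s -> 0 <= kap ->
    (forall X, ~ U X -> W0 * ratio X * / (1 + X * X) <= kap * (s / (s * s + X * X))) ->
    D_on (x0 - r) (x0 + r) (fun x => (fun X => beta X * K X)%C (/ rho * (x - x0))) /\
    Cmod (f (fun x => (fun X => beta X * K X)%C (/ rho * (x - x0)))) <= Mn * kap * rho).
  { intros beta U s kap HbS HbX HU HbU Hs Hkap Hw.
    assert (HD : D_on (- (r / rho)) (r / rho) (fun X => beta X * K X)%C)
      by (apply D_on_mult_r; assumption).
    split; [apply (D_on_dilate rho _ Hr0 HD)|].
    apply (f_dilate_bound rho (fun X => beta X * K X)%C s kap); auto.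
    - unfold K; rewrite kernel_0; ring.
    - apply (dbound_localize idR n _ (fun X => W0 * ratio X * / (1 + X * X)) _ U); auto.
      + intros X UX; rewrite (HbU X UX); ring.
      + intros X; apply Rmult_le_pos; [auto|]; left; apply Rdiv_lt_0_compat; nra.
      + generalize (dbound_mult _ _ _ _ _ _ HbX HKX); apply dbound_weaken; intros X; right.
        unfold W0, Kc; ring. }
  set (s1 := fun X => step (/ tau * (X - 0))). set (s2 := fun X => step (- / tau * (X - 0))).
  set (s3 := fun X => step (tau * (X - 0))).
  assert (Hs1 : Smooth s1) by apply (Smooth_affine step), step_smooth.
  assert (Hs2 : Smooth s2) by apply (Smooth_affine step), step_smooth.
  assert (Hs3 : Smooth s3) by apply (Smooth_affine step), step_smooth.
  assert (Hit : 0 < / tau) by (apply Rinv_0_lt_compat; lra).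
  assert (Htt : / tau * tau = 1) by (field; lra).
  destruct (piece s2 (fun X => - tau < X) 1 (W0 * exp (- lam * g))) as [Dneg Bneg].
  { exact Hs2. }
  { generalize (HXS (- / tau)); apply dbound_weaken; intros; unfold S'; lra. }
  { intros X UX; apply locally_R; exists (X + tau); split; [lra|]; intros Y HY;
      apply Rabs_def2 in HY; lra. }
  { intros X UX; apply step_0; rewrite Rminus_0_r. nra. }
  { lra. }
  { apply Rmult_le_pos; [auto|left; apply exp_pos]. }
  { intros X UX.
    pose proof (weight_gap lam sig tau p X Hl Hsig Htau Hp1 Hp2 ltac:(lra)) as Q.
    fold del in Q; fold (ratio X) in Q; fold g in Q.
    replace (1 / (1 * 1 + X * X)) with (/ (1 + X * X)) by (field; nra).
    apply Rmult_le_compat_r; [left; apply Rinv_0_lt_compat; nra|].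
    apply Rmult_le_compat_l; auto. }
  assert (Hb0S : Smooth (fun X => 1 + (RtoC (-1) * s1 X + RtoC (-1) * s2 X))%C).
  { apply Smooth_plus; [apply Smooth_const|]; apply Smooth_plus; apply Smooth_scal; auto. }
  destruct (piece (fun X => 1 + (RtoC (-1) * s1 X + RtoC (-1) * s2 X))%C
    (fun X => X < - (2 * tau) \/ 2 * tau < X) tau (5 * tau * (W0 * E))) as [Dzero Bzero].
  { exact Hb0S. }
  { generalize (dbound_plus _ _ _ _ _ _ (dbound_const idR n 1%C)
      (dbound_plus _ _ _ _ _ _ (dbound_scal _ _ _ _ (RtoC (-1)) (HXS (/ tau)))
        (dbound_scal _ _ _ _ (RtoC (-1)) (HXS (- / tau))))).
    apply dbound_weaken; intros X; rewrite Cmod_1, Cmod_R, Rabs_left by lra; unfold S'; lra. }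
  { intros X [UX|UX]; apply locally_R.
    - exists (- (2 * tau) - X); split; [lra|]; intros Y HY; apply Rabs_def2 in HY; left; lra.
    - exists (X - 2 * tau); split; [lra|]; intros Y HY; apply Rabs_def2 in HY; right; lra. }
  { intros X [UX|UX]; unfold s1, s2; rewrite Rminus_0_r.
    - rewrite step_0, step_1 by nra; ring.
    - rewrite step_1, step_0 by nra; ring. }
  { lra. }
  { apply Rmult_le_pos; [lra|apply Rmult_le_pos; lra]. }
  { intros X UX.
    assert (HX : - (2 * tau) <= X <= 2 * tau).
    { split; apply Rnot_lt_le; intros Q; apply UX; auto. }
    apply Rle_trans with (W0 * E * 1).
    - apply Rmult_le_compat; [apply Rmult_le_pos; [auto|apply Hratio]| | |].
      + left; apply Rinv_0_lt_compat; nra.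
      + apply Rmult_le_compat_l; [auto|apply Hratio].
      + rewrite <- Rinv_1; apply Rinv_le_contravar; nra.
    - assert (HXX : X * X <= 4 * (tau * tau)) by nra.
      assert (Htt2 : 0 < tau * tau + X * X) by nra.
      replace (5 * tau * (W0 * E) * (tau / (tau * tau + X * X)))
        with (W0 * E * (5 * (tau * tau) / (tau * tau + X * X))) by (field; lra).
      apply Rmult_le_compat_l; [apply Rmult_le_pos; lra|].
      apply Rmult_le_reg_r with (tau * tau + X * X); [lra|].
      unfold Rdiv; rewrite Rmult_assoc, Rinv_l by lra; lra. }
  destruct (piece (fun X => s1 X * s3 X)%C (fun X => X < / tau) (/ tau) (2 * tau * (W0 * E)))
    as [Dfar Bfar].
  { apply Smooth_mult; auto. }
  { generalize (dbound_mult _ _ _ _ _ _ (HXS (/ tau)) (HXS tau)); apply dbound_weaken; intros X; unfold S'; lra. }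
  { intros X UX; apply locally_R; exists (/ tau - X); split; [lra|]; intros Y HY;
      apply Rabs_def2 in HY; lra. }
  { intros X UX; unfold s3; rewrite (step_0 (tau * (X - 0))); [ring|]; rewrite Rminus_0_r; nra. }
  { exact Hit. }
  { apply Rmult_le_pos; [lra|apply Rmult_le_pos; lra]. }
  { intros X UX.
    assert (HX : / tau <= X) by lra.
    assert (HXX : / tau * / tau <= X * X) by nra.
    assert (HX0 : 0 < / tau * / tau) by nra.
    apply Rle_trans with (W0 * E * / (1 + X * X)).
    - apply Rmult_le_compat_r; [left; apply Rinv_0_lt_compat; nra|].
      apply Rmult_le_compat_l; [auto|apply Hratio].
    - replace (2 * tau * (W0 * E) * (/ tau / (/ tau * / tau + X * X)))
        with (W0 * E * (2 * / (/ tau * / tau + X * X))) by (field; split; [lra|nra]).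
      apply Rmult_le_compat_l; [apply Rmult_le_pos; lra|].
      apply Rmult_le_reg_r with ((1 + X * X) * (/ tau * / tau + X * X)); [nra|].
      replace (/ (1 + X * X) * ((1 + X * X) * (/ tau * / tau + X * X)))
        with (/ tau * / tau + X * X) by (field; nra).
      replace (2 * / (/ tau * / tau + X * X) * ((1 + X * X) * (/ tau * / tau + X * X)))
        with (2 * (1 + X * X)) by (field; nra).
      lra. }
  (* the middle part of the positive axis, where the outer cutoff is 1 *)
  assert (Hsup : 2 / tau <= r / (2 * rho)).
  { apply Rmult_le_reg_r with (2 * rho * tau); [nra|].
    replace (2 / tau * (2 * rho * tau)) with (4 * rho) by (field; lra).
    replace (r / (2 * rho) * (2 * rho * tau)) with (r * tau) by (field; lra). lra. }
  set (mK := fun X => (middle_cut tau X * K X)%C).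
  assert (HmK : mK =
    (fun X => / numer lam del p * (numer lam del (RtoC X) * pole p (RtoC X) * middle_cut tau X))%C).
  { extensionality X; unfold mK, K, kernel.
    destruct (excluded_middle_informative (tau <= X <= 2 / tau)) as [HX|HX].
    - unfold outer_cut; rewrite cutoff_1; [ring|]; rewrite Rminus_0_r.
      assert (0 < 2 * rho / r) by (apply Rdiv_lt_0_compat; lra).
      assert (E1 : 2 * rho / r * (r / (2 * rho)) = 1) by (field; lra).
      split; nra.
    - rewrite (proj2 (middle_cut_D tau Htau) X HX); ring. }
  assert (HmD : D_on (- (r / rho)) (r / rho) (fun X => numer lam del (RtoC X) * pole p (RtoC X) * middle_cut tau X)%C).
  { apply (D_on_widen tau (2 / tau)).
    - assert (0 < r / rho) by (apply Rdiv_lt_0_compat; lra). lra.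
    - eapply Rle_trans; [exact Hsup|].
      apply Rmult_le_compat_l; [lra|]; apply Rinv_le_contravar; lra.
    - apply D_on_mult_r; [apply middle_cut_D, Htau|].
      apply Smooth_mult; [apply Smooth_numer, Hdel|apply Smooth_pole; lra]. }
  assert (HmD2 := D_on_dilate rho _ Hr0 HmD).
  assert (Bmid : Cmod (f (fun x => mK (/ rho * (x - x0))%R)) <= eta / 4 * rho).
  { rewrite HmK; cbv beta.
    rewrite (f_scal (/ numer lam del p) _ HmD2), Cmod_mult.
    destruct (numer_unit p Hp1 Hp3 lam del Hl) as [_ Hk].
    assert (Hk2 : Cmod (/ numer lam del p) <= 4 * E).
    { eapply Rle_trans; [exact Hk|]; apply Rmult_le_compat_l; [lra|].
      replace E with (/ exp (- lam * PI))
        by (unfold E; rewrite <- exp_Ropp; f_equal; ring).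
      apply Rinv_le_contravar; [apply exp_pos|apply shifted_ipow_ge, Hl]. }
    apply Rle_trans with (4 * E * (eta / (16 * E) * rho)).
    - apply Rmult_le_compat; auto using Cmod_ge_0.
    - right; field; lra. }
  assert (DmK : D_on (x0 - r) (x0 + r) (fun x => mK (/ rho * (x - x0))%R)).
  { rewrite HmK; apply D_on_mult_r; [exact HmD2|apply Smooth_const]. }
  assert (Hsplit : f (fun x => K (/ rho * (x - x0))%R) =
    (f (fun x => (fun X => s2 X * K X)%C (/ rho * (x - x0))%R) +
     (f (fun x => (fun X => (1 + (RtoC (-1) * s1 X + RtoC (-1) * s2 X)) * K X)%C (/ rho * (x - x0))%R) +
      (f (fun x => (fun X => s1 X * s3 X * K X)%C (/ rho * (x - x0))%R) +
       f (fun x => mK (/ rho * (x - x0))%R))))%C).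
  { rewrite <- f_plus by assumption.
    rewrite <- f_plus by (try apply D_on_plus; assumption).
    rewrite <- f_plus by (try apply D_on_plus; try apply D_on_plus; assumption).
    f_equal; extensionality x; unfold mK, middle_cut.
    fold (s1 (/ rho * (x - x0))); fold (s3 (/ rho * (x - x0))); ring. }
  set (T := f (fun x => K (/ rho * (x - x0)))) in *.
  set (Fz := F (RtoC x0 + rho * p)%C) in *.
  assert (HT : Cmod T <= (3 * (eta / 4)) * rho).
  { rewrite Hsplit.
    eapply Rle_trans; [apply Cmod_triangle|].
    eapply Rle_trans; [apply Rplus_le_compat; [exact Bneg|]|].
    { eapply Rle_trans; [apply Cmod_triangle|].
      apply Rplus_le_compat; [exact Bzero|].
      eapply Rle_trans; [apply Cmod_triangle|]; apply Rplus_le_compat; [exact Bfar|exact Bmid]. }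
    assert (Q1 : Mn * (W0 * exp (- lam * g)) <= eta / 4).
    { eapply Rle_trans; [right|exact Hlam]. unfold W0; ring. }
    assert (Q2 : Mn * (5 * tau * (W0 * E)) + Mn * (2 * tau * (W0 * E)) <= eta / 4).
    { eapply Rle_trans; [right|exact Htau7]; ring. }
    nra. }
  pose proof (Cmod_triangle_minus T (T - RtoC (2 * PI) * Ci * (rho * Fz))) as Q.
  replace (T - (T - RtoC (2 * PI) * Ci * (rho * Fz)))%C
    with (RtoC (2 * PI) * Ci * (rho * Fz))%C in Q by ring.
  pose proof two_pi_gt_1.
  rewrite !Cmod_mult, Cmod_Ci, !Cmod_R, !Rabs_pos_eq in Q by lra.
  pose proof (Cmod_ge_0 Fz).
  assert (rho * Cmod Fz <= 2 * PI * 1 * (rho * Cmod Fz)).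
  { assert (0 <= rho * Cmod Fz) by nra. nra. }
  assert (B * rho <= eta / 4).
  { apply Rle_trans with ((B + 1) * (eta / (4 * (B + 1)))).
    - apply Rmult_le_compat; lra.
    - right; field; lra. }
  assert (B * (rho * rho) <= rho * (eta / 4)).
  { replace (B * (rho * rho)) with (rho * (B * rho)) by ring.
    apply Rmult_le_compat_l; lra. }
  assert (HC' : Cmod (T - RtoC (2 * PI) * Ci * (rho * Fz)) <= B * (rho * rho)) by exact HC.
  apply Rmult_le_reg_l with rho; [lra|].
  lra.
Qed.

End Angular.

(** * From the limit in sectors to the point value *)

Lemma polar_form u s : 0 < s ->
  exists rho p, 0 < rho <= Rabs u + s /\ Cmod p = 1 /\ snd p = s / rho /\ ((u, s) : C) = (RtoC rho * p)%C.
Proof.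
  intros Hs; set (rho := Cmod (u, s)).
  assert (H1 : s <= rho).
  { pose proof (snd_le_Cmod (u, s)) as Q; simpl in Q; rewrite Rabs_pos_eq in Q by lra; exact Q. }
  assert (H2 : rho <= Rabs u + s).
  { pose proof (Cmod_le_sum (u, s)) as Q; simpl in Q; rewrite (Rabs_pos_eq s) in Q by lra; exact Q. }
  assert (H0 : RtoC rho <> 0%C) by (intros E; injection E; lra).
  assert (E : (RtoC rho * (u / rho, s / rho)%R)%C = (u, s)).
  { apply injective_projections; simpl; field; lra. }
  exists rho, (u / rho, s / rho)%R; repeat split; [lra|exact H2| |symmetry; exact E].
  apply Rmult_eq_reg_l with rho; [|lra].
  rewrite <- (Rabs_pos_eq rho) at 1 by lra; rewrite <- Cmod_R, <- Cmod_mult, E, Rmult_1_r.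
  reflexivity.
Qed.

Lemma CInt_support (g : R -> C) c d c' d' : c <= c' -> c' <= d' -> d' <= d ->
  (forall x, c <= x <= d -> ccont g x) -> (forall x, c <= x <= d -> ~ (c' <= x <= d') -> g x = 0%C) ->
  CInt g c d = CInt g c' d'.
Proof.
  intros H1 H2 H3 Hg Hz.
  assert (Hex : forall u v, c <= u -> u <= v -> v <= d -> ex_CInt g u v).
  { intros u v Hu Huv Hv; apply ex_CInt_cont; intros x Hx.
    rewrite Rmin_left, Rmax_right in Hx by lra; apply Hg; lra. }
  assert (Z : forall u v, c <= u -> u <= v -> v <= d -> (forall x, u < x < v -> ~ (c' <= x <= d')) ->
    CInt g u v = 0%C).
  { intros u v Hu Huv Hv Ho.
    rewrite (CInt_ext g (fun _ => (0 * 0)%C)).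
    - rewrite (proj2 (CInt_scal 0 (fun _ => 0%C) u v (ex_RInt_const (V := C_R_NormedModule) u v _))).
      ring.
    - intros x Hx; rewrite Rmin_left, Rmax_right in Hx by lra.
      rewrite Hz; [ring|lra|apply Ho, Hx]. }
  rewrite <- (CInt_Chasles g c c' d), <- (CInt_Chasles g c' d' d) by (apply Hex; lra).
  rewrite (Z c c'), (Z d' d) by (try lra; intros; lra). ring.
Qed.

Lemma smooth_CDerive_n phi k x : smooth phi -> dC (CDerive_n phi k) x (CDerive_n phi (S k) x).
Proof.
  intros H; destruct (H (S k) x) as [H1 H2].
  apply dC_pair; simpl; apply Derive_correct; [exact H1|exact H2].
Qed.

Lemma is_derive_shifted_pow s0 N m s :
  is_derive (fun s => (s0 - s) ^ S m / N) s (- (INR (S m) * (s0 - s) ^ m / N)).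
Proof. auto_derive; [trivial|]. change (match m with O => 1 | S _ => INR m + 1 end) with (INR (S m)); unfold Rdiv, Rminus; ring. Qed.

Section PointValue.
Variables (a b h x0 r : R) (F : C -> C) (f : functional).
Hypotheses (Hh : 0 < h) (Hr : 0 < r) (Ha : a < x0 - r) (Hb : x0 + r < b)
  (HF : holo F a b 0 h)
  (Hbv : forall phi, D_on (x0 - r) (x0 + r) phi ->
    filterlim (fun y => CInt (fun x => F (x, y) * phi x)%C (x0 - r) (x0 + r))
      (at_right 0) (locally (T := C_UniformSpace) (f phi))).
Variables (G0 rhog : R) (k : nat).
Hypotheses (HG0 : 0 <= G0) (Hrhog : 0 < rhog)
  (Hgrow : forall rho p, 0 < rho < rhog -> Cmod p = 1 -> 0 < snd p ->
    Cmod (F (RtoC x0 + rho * p)%C) <= G0 * (/ snd p) ^ k)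
  (Hlim : forall sig eta, 0 < sig -> 0 < eta -> exists rho0, 0 < rho0 /\
    forall rho p, 0 < rho < rho0 -> Cmod p = 1 -> sig <= snd p ->
    Cmod (F (RtoC x0 + rho * p)%C) <= eta).

Let T (y : R) (phi : R -> C) : C := CInt (fun x => F (x, y) * phi x)%C (x0 - r) (x0 + r).

Section Scale.
Variables (phi : R -> C) (A eps : R).
Hypotheses (HA : 0 < A) (Hphi : D_on (- A) A phi) (Heps : 0 < eps)
  (HepsA : eps * A <= r) (Hepsh : eps < h).

Let der (j : nat) : R -> C := CDerive_n phi j.
Let dil (j : nat) (x : R) : C := der j (/ eps * (x - x0)).
Let J (j : nat) (s : R) : C := (RtoC (/ eps) * T (eps * s) (dil j))%C.

Lemma der_D j : D_on (- A) A (der j).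
Proof.
  induction j as [|j IH].
  - unfold der; replace (CDerive_n phi 0) with phi; [exact Hphi|].
    extensionality x; unfold CDerive_n; simpl; destruct (phi x); reflexivity.
  - apply (D_on_deriv _ _ (der j)); [exact IH|].
    intros x; apply smooth_CDerive_n, Smooth_smooth, Hphi.
Qed.

Lemma dil_support j x : ~ (x0 - eps * A <= x <= x0 + eps * A) -> dil j x = 0%C.
Proof.
  intros Hx; apply (proj2 (der_D j)); intros [H1 H2]; apply Hx.
  assert (E : x - x0 = eps * (/ eps * (x - x0))) by (field; lra).
  assert (eps * (/ eps * (x - x0)) <= eps * A) by (apply Rmult_le_compat_l; lra).
  assert (eps * - A <= eps * (/ eps * (x - x0))) by (apply Rmult_le_compat_l; lra).
  lra.
Qed.

Lemma dil_D j : D_on (x0 - r) (x0 + r) (dil j).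
Proof.
  split; [apply (Smooth_affine (der j)), (der_D j)|].
  intros x Hx; apply dil_support; intros Hx'; apply Hx; lra.
Qed.

Lemma J_derive j s : 0 < s <= 1 -> dC (J j) s (- Ci * J (S j) s)%C.
Proof.
  intros Hs; unfold J.
  assert (Hd : forall x, dC (dil j) x (RtoC (/ eps) * dil (S j) x)%C).
  { intros x; unfold dil; apply (dC_comp (der j) (fun x => / eps * (x - x0))).
    - apply smooth_CDerive_n, Smooth_smooth, Hphi.
    - auto_derive; [trivial|ring]. }
  assert (Hes : 0 < eps * s < h) by nra.
  assert (HT := pairing_derive a b h x0 r F Hr Ha Hb HF _ _ (eps * s) (dil_D j) Hd Hes).
  eapply dC_eq.
  - apply dC_scal, (dC_comp (fun y => T y (dil j)) (fun s => eps * s));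
      [exact HT|apply (is_derive_eq _ _ (1 * eps)); [auto_derive; [trivial|ring]|reflexivity]].
  - unfold T.
    rewrite (CInt_ext _ (fun x => RtoC (/ eps) * (F (x, (eps * s)%R) * dil (S j) x))%C)
      by (intros; ring).
    rewrite (proj2 (CInt_scal (RtoC (/ eps)) _ _ _
      (pairing_ex a b h x0 r F Hr Ha Hb HF (eps * s) _ Hes (dil_D (S j))))).
    rewrite RtoC_inv by lra. rewrite Rmult_1_l; field. intros E; injection E; lra.
Qed.

Lemma J_bound j s B M : 0 < s <= 1 -> 0 <= B -> (forall x, Cmod (der j x) <= M) ->
  (forall u, - A <= u <= A -> Cmod (F (x0 + eps * u, eps * s)) <= B) ->
  Cmod (J j s) <= 2 * A * M * B.
Proof.
  intros Hs HB HM HFB.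
  assert (HM0 : 0 <= M) by (eapply Rle_trans; [apply Cmod_ge_0|apply (HM 0)]).
  assert (Hes : 0 < eps * s < h) by nra.
  assert (HeA : 0 < eps * A) by nra.
  unfold J; rewrite Cmod_mult, Cmod_R, Rabs_pos_eq by (left; apply Rinv_0_lt_compat; lra).
  assert (Hc : forall x, x0 - r <= x <= x0 + r -> ccont (fun x => F (x, (eps * s)%R) * dil j x)%C x).
  { intros x Hx; apply ccont_mult; [|apply Smooth_cont, (dil_D j)].
    apply (ccont_horizontal F), (holo_cont F a b 0 h); auto; lra. }
  unfold T; rewrite (CInt_support _ _ _ (x0 - eps * A) (x0 + eps * A)); try lra; [| exact Hc |].
  2: { intros x _ Hx; rewrite (dil_support j x Hx); ring. }
  assert (Hb1 : Cmod (CInt (fun x => F (x, (eps * s)%R) * dil j x)%C (x0 - eps * A) (x0 + eps * A))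
    <= (x0 + eps * A - (x0 - eps * A)) * (B * M)).
  { apply CInt_norm_const; [lra| |].
    - intros x Hx; rewrite Cmod_mult; apply Rmult_le_compat; auto using Cmod_ge_0.
      + replace x with (x0 + eps * (/ eps * (x - x0))) by (field; lra).
        apply HFB. assert (0 < / eps) by (apply Rinv_0_lt_compat; lra).
        assert (/ eps * (eps * A) = A) by (field; lra). split; nra.
      + apply HM.
    - apply ex_CInt_cont; intros x Hx; rewrite Rmin_left, Rmax_right in Hx by lra; apply Hc; lra. }
  apply Rle_trans with (/ eps * ((x0 + eps * A - (x0 - eps * A)) * (B * M))).
  - apply Rmult_le_compat_l; [left; apply Rinv_0_lt_compat; lra|exact Hb1].
  - right; field; lra.
Qed.

(** With [s0] fixed and the centre [s] variable, the derivative of the Taylor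
    polynomial reduces to one term, of the highest order. *)
Fixpoint taylor (s0 : R) (m : nat) (s : R) : C :=
  match m with
  | O => J 0 s
  | S i => (taylor s0 i s
     + RtoC ((s0 - s) ^ S i / INR (Factorial.fact (S i))) * ((- Ci) ^ S i * J (S i) s))%C
  end.

Lemma taylor_derive s0 m s : 0 < s <= 1 ->
  dC (taylor s0 m) s
    (RtoC ((s0 - s) ^ m / INR (Factorial.fact m)) * ((- Ci) ^ S m * J (S m) s))%C.
Proof.
  intros Hs; induction m as [|m IH].
  - eapply dC_eq; [apply (J_derive 0 s Hs)|]. simpl. unfold Rdiv; rewrite Rinv_1, Rmult_1_r; ring.
  - pose proof (INR_fact_lt_0 (S m)) as Hf1; pose proof (INR_fact_lt_0 m) as Hf0.
    eapply dC_eq.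
    + apply dC_plus; [exact IH|].
      apply dC_mult; [apply dC_RtoC|apply dC_scal, (J_derive (S m) s Hs)].
      apply (is_derive_eq _ _ (- (INR (S m) * (s0 - s) ^ m / INR (Factorial.fact (S m)))));
        [apply is_derive_shifted_pow|].
      rewrite fact_simpl, mult_INR; pose proof (pos_INR m); rewrite S_INR.
      instantiate (1 := - ((s0 - s) ^ m / INR (Factorial.fact m))).
      field; lra.
    + rewrite RtoC_opp; simpl; ring.
Qed.

Lemma taylor_S s0 i s : taylor s0 (S i) s = (taylor s0 i s
  + RtoC ((s0 - s) ^ S i / INR (Factorial.fact (S i))) * ((- Ci) ^ S i * J (S i) s))%C.
Proof. reflexivity. Qed.

Lemma taylor_at s0 m : taylor s0 m s0 = J 0 s0.
Proof.
  induction m as [|m IH]; [reflexivity|]; rewrite taylor_S, IH.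
  rewrite Rminus_diag, pow_i by apply Nat.lt_0_succ; unfold Rdiv; rewrite Rmult_0_l; ring.
Qed.

Lemma taylor_bound s0 m y (Bd : nat -> R) : 0 < s0 <= y -> y <= 1 ->
  (forall j, Cmod (J j y) <= Bd j) -> Cmod (taylor s0 m y) <= sum_f_R0 Bd m.
Proof.
  intros H0 H1 HB; induction m as [|m IH]; [apply HB|].
  rewrite taylor_S; simpl sum_f_R0; eapply Rle_trans; [apply Cmod_triangle|].
  apply Rplus_le_compat; [exact IH|].
  rewrite !Cmod_mult, Cmod_pow, Cmod_opp, Cmod_Ci, pow1, Rmult_1_l, Cmod_R.
  rewrite <- (Rmult_1_l (Bd (S m))); apply Rmult_le_compat; auto using Cmod_ge_0, Rabs_pos.
  unfold Rdiv; rewrite Rabs_mult, <- RPow_abs.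
  assert (Hf : 1 <= INR (Factorial.fact (S m))).
  { apply (le_INR 1), Factorial.lt_O_fact. }
  rewrite <- (Rmult_1_l 1); apply Rmult_le_compat; try apply Rabs_pos; [apply pow_le, Rabs_pos| |].
  - rewrite <- (pow1 (S m)); apply pow_incr; split; [apply Rabs_pos|]. apply Rabs_le; lra.
  - rewrite Rabs_pos_eq by (left; apply Rinv_0_lt_compat; lra).
    rewrite <- Rinv_1; apply Rinv_le_contravar; lra.
Qed.

End Scale.

Lemma F_on_strip A eps u s (B sig rho0 : R) : 0 < A -> 0 < s <= 1 -> - A <= u <= A -> 0 < eps ->
  eps * (A + 1) < rho0 -> s / (A + 1) = sig ->
  (forall rho p, 0 < rho < rho0 -> Cmod p = 1 -> sig <= snd p ->
    Cmod (F (RtoC x0 + rho * p)%C) <= B) ->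
  Cmod (F (x0 + eps * u, eps * s)) <= B.
Proof.
  intros HA Hs Hu He Her Hsig H.
  destruct (polar_form u s ltac:(lra)) as [rho [p [Hrho [Hp1 [Hp2 E]]]]].
  assert (Hua : Rabs u <= A) by (apply Rabs_le; lra).
  replace ((x0 + eps * u, eps * s) : C) with (RtoC x0 + RtoC (eps * rho) * p)%C.
  - apply H; [|exact Hp1|].
    + split; [nra|]. apply Rle_lt_trans with (eps * (A + 1)); [|exact Her].
      apply Rmult_le_compat_l; lra.
    + rewrite Hp2, <- Hsig; apply Rmult_le_compat_l; [lra|]; apply Rinv_le_contravar; lra.
  - rewrite RtoC_mult, <- Cmult_assoc, <- E; apply injective_projections; simpl; ring.
Qed.

(** Expanding the pairing at height [eps * s0], [s0 -> 0], around the height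
    [eps * y]: the order of the expansion compensates the growth of [F] at the
    real axis, so the error is [O (y)] uniformly in [eps], while for fixed [y]
    the polynomial tends to zero with [eps]. *)
Theorem point_value_zero phi A : 0 < A -> D_on (- A) A phi -> forall e, 0 < e ->
  exists eta, 0 < eta /\ forall eps, 0 < eps < eta ->
    Cmod (f (fun x => phi (/ eps * (x - x0)))) <= e * eps.
Proof.
  intros HA HD e He.
  assert (HMj : forall j, exists M, 0 <= M /\ forall x, Cmod (CDerive_n phi j x) <= M).
  { intros j; destruct (D_on_dbound _ _ _ 0 (der_D phi A HD j)) as [M [HM HX]].
    exists M; split; [exact HM|]; intros x; apply (dbound_value _ _ _ _ x HX). }
  set (Mj := fun j => proj1_sig (constructive_indefinite_description _ (HMj j))).
  assert (HMj' : forall j, 0 <= Mj j /\ forall x, Cmod (CDerive_n phi j x) <= Mj j)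
    by (intros j; exact (proj2_sig (constructive_indefinite_description _ (HMj j)))).
  clearbody Mj.
  set (Kc := 2 * A * Mj (S k) * (G0 * (A + 1) ^ k)).
  assert (HKc : 0 <= Kc).
  { unfold Kc; apply Rmult_le_pos; [|apply Rmult_le_pos; [auto|apply pow_le; lra]].
    apply Rmult_le_pos; [lra|apply HMj']. }
  set (y := Rmin 1 (e / (4 * (Kc + 1)))).
  assert (Hy : 0 < y <= 1).
  { split; [apply Rmin_glb_lt; [lra|apply Rdiv_lt_0_compat; lra]|apply Rmin_l]. }
  assert (HyK : Kc * y <= e / 4).
  { apply Rle_trans with ((Kc + 1) * (e / (4 * (Kc + 1)))); [|right; field; lra].
    apply Rmult_le_compat; [lra|lra|lra|apply Rmin_r]. }
  set (Sm := sum_f_R0 Mj k).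
  assert (HSm : 0 <= Sm) by (apply cond_pos_sum; intros; apply HMj').
  set (e1 := e / (4 * (2 * A * Sm + 1))).
  assert (HAS : 0 <= 2 * A * Sm) by (apply Rmult_le_pos; lra).
  assert (He1 : 0 < e1) by (apply Rdiv_lt_0_compat; lra).
  assert (HSe : 2 * A * Sm * e1 <= e / 4).
  { apply Rle_trans with ((2 * A * Sm + 1) * e1); [nra|]. right; unfold e1; field; lra. }
  destruct (Hlim (y / (A + 1)) e1) as [rho1 [Hrho1 Hl1]]; [apply Rdiv_lt_0_compat; lra|exact He1|].
  set (m := Rmin (Rmin rho1 rhog) (Rmin r h)).
  assert (Hm : 0 < m) by (unfold m; repeat apply Rmin_glb_lt; lra).
  assert (Hm1 : m <= rho1) by (eapply Rle_trans; [apply Rmin_l|apply Rmin_l]).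
  assert (Hm2 : m <= rhog) by (eapply Rle_trans; [apply Rmin_l|apply Rmin_r]).
  assert (Hm3 : m <= r) by (eapply Rle_trans; [apply Rmin_r|apply Rmin_l]).
  assert (Hm4 : m <= h) by (eapply Rle_trans; [apply Rmin_r|apply Rmin_r]).
  exists (m / (A + 1)); split; [apply Rdiv_lt_0_compat; lra|].
  intros eps [Heps Heps2].
  assert (Hem : eps * (A + 1) < m).
  { apply Rmult_lt_compat_r with (r := A + 1) in Heps2; [|lra].
    replace (m / (A + 1) * (A + 1)) with m in Heps2 by (field; lra). exact Heps2. }
  assert (HeA : eps * A <= r) by nra. assert (Heh : eps < h) by nra.
  set (J := fun j s => (RtoC (/ eps) * T (eps * s) (fun x => CDerive_n phi j (/ eps * (x - x0))%R))%C).
  assert (Jy : forall j, Cmod (J j y) <= 2 * A * Mj j * e1).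
  { intros j; apply (J_bound phi A eps HA HD Heps HeA Heh j y e1 (Mj j) Hy); [lra|apply HMj'|].
    intros u Hu; apply (F_on_strip A eps u y e1 (y / (A + 1)) rho1); auto; lra. }
  assert (Js : forall s, 0 < s <= 1 -> Cmod (J (S k) s) <= Kc * (/ s) ^ k).
  { intros s Hs.
    assert (Q : Cmod (J (S k) s) <= 2 * A * Mj (S k) * (G0 * ((A + 1) * / s) ^ k)).
    { apply (J_bound phi A eps HA HD Heps HeA Heh (S k) s _ (Mj (S k)) Hs); [|apply HMj'|].
      - apply Rmult_le_pos; [auto|apply pow_le]. apply Rmult_le_pos; [lra|left; apply Rinv_0_lt_compat; lra].
      - intros u Hu; apply (F_on_strip A eps u s _ (s / (A + 1)) rhog); auto; [lra|].
        intros rho p Hrho Hp1 Hp2.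
        assert (0 < s / (A + 1)) by (apply Rdiv_lt_0_compat; lra).
        eapply Rle_trans; [apply Hgrow; auto; lra|].
        apply Rmult_le_compat_l; [auto|]; apply pow_incr; split; [left; apply Rinv_0_lt_compat; lra|].
        replace ((A + 1) * / s) with (/ (s / (A + 1))) by (field; lra).
        apply Rinv_le_contravar; lra. }
    eapply Rle_trans; [exact Q|]. rewrite Rpow_mult_distr; right; unfold Kc; ring. }
  assert (J0 : forall s0, 0 < s0 < y -> Cmod (J 0%nat s0) <= e / 2).
  { intros s0 Hs0.
    pose proof (taylor_bound phi eps s0 k y (fun j => 2 * A * Mj j * e1) ltac:(lra) ltac:(lra) Jy) as Q1.
    assert (Q1' : sum_f_R0 (fun j => 2 * A * Mj j * e1) k = 2 * A * Sm * e1).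
    { rewrite (sum_eq _ (fun j => Mj j * (2 * A * e1))) by (intros; ring).
      rewrite <- scal_sum; fold Sm; ring. }
    rewrite Q1' in Q1.
    pose proof (dC_mean_value (taylor phi eps s0 k)
      (fun s => RtoC ((s0 - s) ^ k / INR (Factorial.fact k)) * ((- Ci) ^ S k * J (S k) s))%C
      Kc s0 y ltac:(lra)) as Q2.
    rewrite taylor_at in Q2.
    assert (Q3 : Cmod (taylor phi eps s0 k y - J 0%nat s0) <= Kc * (y - s0)).
    { apply Q2.
      - intros s Hs; apply (taylor_derive phi A eps HD Heps HeA Heh s0 k s); lra.
      - intros s Hs.
        rewrite !Cmod_mult, Cmod_pow, Cmod_opp, Cmod_Ci, pow1, Rmult_1_l, Cmod_R.
        assert (Hf : 1 <= INR (Factorial.fact k)) by (apply (le_INR 1), Factorial.lt_O_fact).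
        assert (Hc : Rabs ((s0 - s) ^ k / INR (Factorial.fact k)) <= s ^ k).
        { unfold Rdiv; rewrite Rabs_mult, <- RPow_abs, <- (Rmult_1_r (s ^ k)).
          apply Rmult_le_compat; try apply Rabs_pos; [apply pow_le, Rabs_pos| |].
          - apply pow_incr; split; [apply Rabs_pos|apply Rabs_le; lra].
          - rewrite Rabs_pos_eq by (left; apply Rinv_0_lt_compat; lra).
            rewrite <- Rinv_1; apply Rinv_le_contravar; lra. }
        apply Rle_trans with (s ^ k * (Kc * (/ s) ^ k)).
        + apply Rmult_le_compat; auto using Rabs_pos, Cmod_ge_0. apply Js; lra.
        + right. replace (s ^ k * (Kc * (/ s) ^ k)) with (Kc * (s ^ k * (/ s) ^ k)) by ring.
          rewrite <- Rpow_mult_distr, Rinv_r, pow1 by lra; ring. }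
    replace (J 0%nat s0) with (taylor phi eps s0 k y - (taylor phi eps s0 k y - J 0%nat s0))%C by ring.
    eapply Rle_trans; [apply Cmod_triangle_minus|].
    assert (Kc * (y - s0) <= Kc * y) by (apply Rmult_le_compat_l; lra).
    lra. }
  assert (HDd : D_on (x0 - r) (x0 + r) (fun x => CDerive_n phi 0 (/ eps * (x - x0))))
    by apply (dil_D phi A eps HD Heps HeA 0).
  assert (E0 : (fun x => CDerive_n phi 0 (/ eps * (x - x0))) = (fun x => phi (/ eps * (x - x0)))).
  { extensionality x; unfold CDerive_n; simpl; destruct (phi (/ eps * (x - x0))); reflexivity. }
  apply le_epsilon; intros e2 He2.
  destruct (proj1 (filterlim_right_iff _ _) (Hbv _ HDd) e2 He2) as [eta [Heta Hl2]].
  set (s0 := Rmin (y / 2) (eta / (2 * eps))).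
  assert (Hs0 : 0 < s0) by (apply Rmin_glb_lt; [lra|apply Rdiv_lt_0_compat; lra]).
  assert (Hs1 : s0 <= y / 2) by apply Rmin_l.
  assert (Hs2 : s0 <= eta / (2 * eps)) by apply Rmin_r.
  assert (Hs3 : 0 < eps * s0 < eta).
  { split; [nra|]. apply Rle_lt_trans with (eps * (eta / (2 * eps))).
    - apply Rmult_le_compat_l; lra.
    - replace (eps * (eta / (2 * eps))) with (eta / 2) by (field; lra). lra. }
  specialize (Hl2 (eps * s0) Hs3).
  specialize (J0 s0 ltac:(lra)).
  rewrite <- E0.
  set (t := f (fun x => CDerive_n phi 0 (/ eps * (x - x0)))) in *.
  set (t1 := CInt (fun x => F (x, (eps * s0)%R) * CDerive_n phi 0 (/ eps * (x - x0))%R)%C (x0 - r) (x0 + r)) in *.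
  assert (Ht1 : Cmod t1 <= e / 2 * eps).
  { unfold J, T in J0; fold t1 in J0.
    rewrite Cmod_mult, Cmod_R, Rabs_pos_eq in J0 by (left; apply Rinv_0_lt_compat; lra).
    apply Rmult_le_compat_r with (r := eps) in J0; [|lra].
    replace (/ eps * Cmod t1 * eps) with (Cmod t1) in J0 by (field; lra). exact J0. }
  replace t with (t1 - (t1 - t))%C by ring.
  eapply Rle_trans; [apply Cmod_triangle_minus|]. nra.
Qed.

End PointValue.

(** * Reduction to a vanishing lateral limit *)

Lemma ccont_mult_support (g phi : R -> C) c d x : D_on c d phi ->
  (c <= x <= d -> ccont g x) -> ccont (fun t => g t * phi t)%C x.
Proof.
  intros [HS Hz] Hg.
  destruct (excluded_middle_informative (c <= x <= d)) as [Hx|Hx].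
  - apply ccont_mult; [apply Hg, Hx|apply Smooth_cont, HS].
  - apply (ccont_comp_ext (fun _ => 0%C)); [|apply ccont_const].
    generalize (locally_off_interval c d x Hx); apply filter_imp.
    intros t Ht; rewrite (Hz t Ht); ring.
Qed.

Lemma D_on_ex_CInt c d phi u v : D_on c d phi -> ex_CInt phi u v.
Proof. intros [HS _]; apply ex_CInt_cont; intros; apply Smooth_cont, HS. Qed.

Lemma CInt_D_on c d phi u v : D_on c d phi -> u <= c -> c <= d -> d <= v ->
  CInt phi u v = CInt phi c d.
Proof.
  intros HD Hu Hcd Hv; apply CInt_support; auto.
  - intros; apply Smooth_cont, HD.
  - intros x _ Hx; apply HD, Hx.
Qed.

Lemma total_integral_D_on c d phi : c <= d -> D_on c d phi -> total_integral phi = CInt phi c d.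
Proof.
  intros Hcd HD; unfold total_integral.
  apply (is_RInt_gen_unique (V := C_R_CompleteNormedModule)).
  intros P HP.
  exists (fun u => u < c) (fun v => d < v).
  - exists c; auto.
  - exists d; auto.
  - intros u v Hu Hv; simpl; exists (CInt phi c d); split.
    + rewrite <- (CInt_D_on c d phi u v HD) by lra.
      apply (RInt_correct (V := C_R_CompleteNormedModule)), (D_on_ex_CInt c d), HD.
    + apply locally_singleton, HP.
Qed.

Lemma CInt_dilate c d psi x0 rho r : c <= d -> D_on c d psi -> 0 < rho ->
  - r <= rho * c -> rho * d <= r ->
  CInt (fun x => psi (/ rho * (x - x0))) (x0 - r) (x0 + r) = (RtoC rho * total_integral psi)%C.
Proof.
  intros Hcd HD Hrho Hc Hd.
  assert (Hi : 0 < / rho) by (apply Rinv_0_lt_compat; lra).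
  assert (Hri : rho * / rho = 1) by (field; lra).
  rewrite (total_integral_D_on c d psi Hcd HD).
  assert (Hc' : - (r / rho) <= c).
  { apply Rmult_le_reg_l with rho; [exact Hrho|].
    replace (rho * - (r / rho)) with (- r) by (field; lra); lra. }
  assert (Hd' : d <= r / rho).
  { apply Rmult_le_reg_l with rho; [exact Hrho|].
    replace (rho * (r / rho)) with r by (field; lra); lra. }
  assert (Hex : ex_CInt (fun x => psi (/ rho * (x - x0))) (x0 - r) (x0 + r)).
  { apply ex_CInt_cont; intros; apply Smooth_cont, Smooth_affine, HD. }
  assert (E : CInt (fun x => RtoC (/ rho) * psi (/ rho * (x - x0))%R)%C (x0 - r) (x0 + r)
    = CInt psi c d).
  { rewrite <- (CInt_D_on c d psi (- (r / rho)) (r / rho) HD); try lra.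
    assert (Hl := RInt_comp_lin (V := C_R_CompleteNormedModule) psi (/ rho) (- (/ rho * x0))
      (x0 - r) (x0 + r)).
    replace (/ rho * (x0 - r) + - (/ rho * x0)) with (- (r / rho)) in Hl by (field; lra).
    replace (/ rho * (x0 + r) + - (/ rho * x0)) with (r / rho) in Hl by (field; lra).
    unfold CInt at 2; rewrite <- Hl; [|apply (D_on_ex_CInt c d), HD].
    apply CInt_ext; intros x _.
    replace (/ rho * x + - (/ rho * x0)) with (/ rho * (x - x0)) by ring.
    apply injective_projections; unfold scal; simpl; unfold prod_scal, scal; simpl;
      unfold mult; simpl; ring. }
  rewrite (proj2 (CInt_scal (RtoC (/ rho)) _ _ _ Hex)) in E.
  rewrite <- E, Cmult_assoc, <- RtoC_mult, Hri; ring.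
Qed.

(** The mass of the Cauchy density does not depend on its width [s]; this is
    why the estimates are uniform in the scale. *)
Lemma cauchy_density_mass x0 s kap u v : 0 < s -> 0 <= kap -> u <= v ->
  ex_RInt (fun x => kap * (s / (s * s + (x - x0) * (x - x0)))) u v /\
  RInt (fun x => kap * (s / (s * s + (x - x0) * (x - x0)))) u v <= PI * kap.
Proof.
  intros Hs Hk Huv.
  assert (Hq : forall x, 0 < s * s + (x - x0) * (x - x0)).
  { intros x; pose proof (Rle_0_sqr (x - x0)); unfold Rsqr in *; nra. }
  assert (H : is_RInt (fun x => kap * (s / (s * s + (x - x0) * (x - x0)))) u v
    (kap * atan ((v - x0) / s) - kap * atan ((u - x0) / s))).
  { apply (is_RInt_derive (V := R_CompleteNormedModule) (fun x => kap * atan ((x - x0) / s))).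
    - intros x _; apply (is_derive_scal (fun x => atan ((x - x0) / s))).
      rewrite Rplus_comm; apply is_derive_atan_scaled, Hs.
    - intros x _; apply (ex_derive_continuous (K := R_AbsRing) (V := R_NormedModule)).
      auto_derive; specialize (Hq x); lra. }
  split; [eexists; exact H|].
  rewrite (is_RInt_unique _ _ _ _ H).
  pose proof (atan_bound ((v - x0) / s)); pose proof (atan_bound ((u - x0) / s)). nra.
Qed.

(** [f = partial ^ n fn] is tested through the [n]-fold derivative
    [(x - x0) d/dx], which vanishes at [x0] with the test function. *)
Lemma iter_partial x0 c d n (fn : functional) : forall phi w,
  D_on c d phi -> phi x0 = 0%C -> dbound (fun x => x - x0) n phi w ->
  exists psi, D_on c d psi /\ psi x0 = 0%C /\ (forall x, Cmod (psi x) <= w x) /\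
    Cmod (Nat.iter n (distr_partial x0) fn phi) = Cmod (fn psi).
Proof.
  induction n as [|n IH]; intros phi w HD H0 HX.
  - exists phi; split; [exact HD|]; split; [exact H0|]; split; [|reflexivity].
    intros x; apply (dbound_value _ _ _ _ x HX).
  - destruct HX as [Hw [phi' [Hd HX]]].
    destruct (IH (fun x => RtoC (x - x0) * phi' x)%C w) as [psi [P1 [P2 [P3 P4]]]].
    + apply D_on_mult_r; [apply (D_on_deriv c d phi); assumption|apply Smooth_id].
    + rewrite Rminus_diag; ring.
    + exact HX.
    + exists psi; split; [exact P1|]; split; [exact P2|]; split; [exact P3|].
      rewrite <- P4; simpl; unfold distr_partial at 1, distr_derive, distr_mul.
      rewrite Cmod_opp, (CDerive_n_1 phi phi' Hd); reflexivity.
Qed.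

(** The zero of [psi] at [x0] compensates a possible discontinuity of the bounded
    function [g] there. *)
Lemma ccont_bounded_mult (g psi : R -> C) x0 e M c d :
  0 < e -> (forall x, x0 - e < x < x0 + e -> x <> x0 -> ccont g x) ->
  (forall x, x0 - e < x < x0 + e -> x <> x0 -> Cmod (g x) <= M) ->
  x0 - e < c -> d < x0 + e -> D_on c d psi -> psi x0 = 0%C ->
  forall x, ccont (fun t => g t * psi t)%C x.
Proof.
  intros He Hg HM Hc Hd HD H0 x.
  destruct (Req_dec x x0) as [->|Hx].
  - apply ccont_iff; intros eps Heps.
    pose proof (Smooth_cont psi x0 (proj1 HD)) as Hpsi; rewrite ccont_iff in Hpsi.
    pose proof (Rabs_pos M) as HMp.
    destruct (proj1 (locally_R _ _) (Hpsi (eps / (Rabs M + 1)) ltac:(apply Rdiv_lt_0_compat; lra)))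
      as [d1 [Hd1 H1]].
    apply locally_R; exists (Rmin d1 e); split; [apply Rmin_glb_lt; auto|]; intros t Ht.
    pose proof (Rmin_l d1 e); pose proof (Rmin_r d1 e).
    rewrite H0, Cmult_0_r. replace (g t * psi t - 0)%C with (g t * psi t)%C by ring.
    specialize (H1 t ltac:(lra)); rewrite H0 in H1.
    replace (psi t - 0)%C with (psi t) in H1 by ring.
    destruct (Req_dec t x0) as [->|Htx].
    + rewrite H0, Cmult_0_r, Cmod_0; exact Heps.
    + apply Rabs_def2 in Ht.
      rewrite Cmod_mult.
      assert (Cmod (g t) <= Rabs M + 1).
      { eapply Rle_trans; [apply HM; lra|]; pose proof (Rle_abs M); lra. }
      apply Rle_lt_trans with ((Rabs M + 1) * Cmod (psi t)).
      * apply Rmult_le_compat_r; [apply Cmod_ge_0|assumption].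
      * replace eps with ((Rabs M + 1) * (eps / (Rabs M + 1))) by (field; lra).
        apply Rmult_lt_compat_l; lra.
  - apply (ccont_mult_support g psi c d x HD); intros Hxc; apply Hg; [lra|exact Hx].
Qed.

Theorem theorem2 (a b h : R) (F : C -> C) (f : functional) (x0 : R) (gamma : C)
  (hab : a < b) (hh : 0 < h)
  (hF : analytic_on_rectangle a b h F)
  (hf : distribution (Ioo a b) f)
  (hbv : boundary_value a b F f)
  (hx0 : a < x0 < b)
  (hlat : right_limit f x0 gamma)
  (hbd : distr_bounded_at a b f x0) :
  point_value f x0 gamma /\ angular_limit F x0 gamma.
Proof.
  destruct hbd as [n [fn [_ [Hfn [e [g [He [Hae [Hbe [Hgc [[Mg HMg] Hg]]]]]]]]]]].
  unfold Ioo in *.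
  set (r := e / 2).
  assert (Hr : 0 < r) by (unfold r; lra).
  assert (Hre : r < e) by (unfold r; lra).
  assert (Ha : a < x0 - r) by lra. assert (Hb : x0 + r < b) by lra.
  set (F1 := fun z => (F z - gamma)%C).
  set (f1 := fun phi => (f phi - gamma * CInt phi (x0 - r) (x0 + r))%C : C).
  assert (Htest : forall phi, D_on (x0 - r) (x0 + r) phi -> test_function (fun x => a < x < b) phi).
  { intros phi HD; apply (D_on_test _ _ _ _ HD); intros; lra. }
  assert (HhF : holo F a b 0 h) by exact hF.
  assert (HF1 : holo F1 a b 0 h).
  { intros x y Hx Hy; destruct (HhF x y Hx Hy) as [k Hk].
    eexists; apply Cder_minus; [exact Hk|apply Cder_const]. }
  assert (Hbv1 : forall phi, D_on (x0 - r) (x0 + r) phi ->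
    filterlim (fun y => CInt (fun x => F1 (x, y) * phi x)%C (x0 - r) (x0 + r))
      (at_right 0) (locally (T := C_UniformSpace) (f1 phi))).
  { intros phi HD; apply filterlim_right_iff; intros ep Hep.
    destruct (proj1 (filterlim_right_iff _ _) (hbv phi (Htest phi HD)) ep Hep) as [eta [Heta Hl]].
    exists (Rmin eta h); split; [apply Rmin_glb_lt; lra|]; intros y Hy.
    pose proof (Rmin_l eta h); pose proof (Rmin_r eta h).
    specialize (Hl y ltac:(lra)).
    assert (Hyh : 0 < y < h) by lra.
    assert (Hcont : forall x, a <= x <= b -> ccont (fun x => F (x, y) * phi x)%C x).
    { intros x _; apply (ccont_mult_support (fun x => F (x, y)) phi (x0 - r) (x0 + r) x HD).
      intros Hx; apply (ccont_horizontal F), (holo_cont F a b 0 h); auto; lra. }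
    change (regular_on a b (fun x => F (x, y)) phi) with (CInt (fun x => F (x, y) * phi x)%C a b) in Hl.
    rewrite (CInt_support _ a b (x0 - r) (x0 + r)) in Hl; try lra; [|exact Hcont|].
    2: { intros x _ Hx; rewrite (proj2 HD x Hx); ring. }
    replace (CInt (fun x => F1 (x, y) * phi x)%C (x0 - r) (x0 + r) - f1 phi)%C
      with (CInt (fun x => F (x, y) * phi x)%C (x0 - r) (x0 + r) - f phi)%C; [exact Hl|].
    assert (E1 : ex_CInt (fun x => F (x, y) * phi x)%C (x0 - r) (x0 + r)).
    { apply ex_CInt_cont; intros x Hx; rewrite Rmin_left, Rmax_right in Hx by lra; apply Hcont; lra. }
    pose proof (CInt_scal gamma phi (x0 - r) (x0 + r) (D_on_ex_CInt _ _ _ _ _ HD)) as [E2 E3].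
    unfold F1, f1.
    rewrite (CInt_ext (fun x => (F (x, y) - gamma) * phi x)%C
      (fun x => F (x, y) * phi x - gamma * phi x)%C) by (intros; cbv beta; ring).
    rewrite CInt_minus, E3 by assumption; ring. }
  assert (Hlin : forall c phi psi, D_on (x0 - r) (x0 + r) phi -> D_on (x0 - r) (x0 + r) psi ->
    f1 (fun x => c * phi x + psi x)%C = (c * f1 phi + f1 psi)%C).
  { intros c phi psi H1 H2; unfold f1.
    rewrite (proj1 hf c phi psi (Htest phi H1) (Htest psi H2)).
    pose proof (CInt_scal c phi (x0 - r) (x0 + r) (D_on_ex_CInt _ _ _ _ _ H1)) as [E2 E3].
    rewrite CInt_plus, E3; [ring|exact E2|apply (D_on_ex_CInt _ _ _ _ _ H2)]. }
  set (M := (Rabs Mg + Cmod gamma) * PI).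
  pose proof PI_RGT_0 as HPI. pose proof (Rabs_pos Mg) as HMg0. pose proof (Cmod_ge_0 gamma) as Hgam.
  assert (HM : 0 <= M) by (unfold M; apply Rmult_le_pos; lra).
  assert (Hlog : forall phi s kap, D_on (x0 - r) (x0 + r) phi -> phi x0 = 0%C -> 0 < s -> 0 <= kap ->
    dbound (fun x => x - x0) n phi (fun x => kap * (s / (s * s + (x - x0) * (x - x0)))) ->
    Cmod (f1 phi) <= M * kap).
  { intros phi s kap HD H0 Hs Hkap HX.
    set (w := fun x => kap * (s / (s * s + (x - x0) * (x - x0)))) in *.
    destruct (iter_partial x0 (x0 - r) (x0 + r) n fn phi w HD H0 HX) as [psi [HDpsi [Hpsi0 [Hpsiw Epsi]]]].
    assert (Hf : Cmod (f phi) <= Rabs Mg * (PI * kap)).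
    { rewrite (Hfn phi (Htest phi HD)), Epsi.
      rewrite (Hg psi) by (apply (D_on_test _ _ _ _ HDpsi); intros; lra).
      change (Cmod (CInt (fun x => g x * psi x)%C (x0 - e) (x0 + e)) <= Rabs Mg * (PI * kap)).
      destruct (cauchy_density_mass x0 s kap (x0 - e) (x0 + e) Hs Hkap ltac:(lra)) as [Ew Iw].
      fold w in Ew, Iw.
      eapply Rle_trans; [apply (CInt_norm_le _ (fun x => Rabs Mg * w x))|].
      - lra.
      - intros x Hx.
        assert (Hw0 : 0 <= w x) by (eapply Rle_trans; [apply Cmod_ge_0|apply Hpsiw]).
        destruct (excluded_middle_informative (psi x = 0%C)) as [E|E].
        + rewrite E, Cmult_0_r, Cmod_0; apply Rmult_le_pos; auto.
        + assert (Hx2 : x0 - r <= x <= x0 + r) by (apply NNPP; intros Q; apply E, HDpsi, Q).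
          rewrite Cmod_mult; apply Rmult_le_compat; auto using Cmod_ge_0.
          eapply Rle_trans; [apply HMg; [lra|]|apply Rle_abs].
          intros Ex; apply E; rewrite Ex; exact Hpsi0.
      - apply ex_CInt_cont; intros x _.
        apply (ccont_bounded_mult g psi x0 e Mg (x0 - r) (x0 + r)); auto; lra.
      - apply (ex_RInt_scal (V := R_NormedModule)), Ew.
      - rewrite (RInt_scal (V := R_CompleteNormedModule)) by exact Ew.
        apply Rmult_le_compat_l; auto. }
    assert (Hi : Cmod (CInt phi (x0 - r) (x0 + r)) <= PI * kap).
    { destruct (cauchy_density_mass x0 s kap (x0 - r) (x0 + r) Hs Hkap ltac:(lra)) as [Ew Iw].
      eapply Rle_trans; [apply (CInt_norm_le _ w)|exact Iw]; [lra| | |exact Ew].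
      - intros x _; apply (dbound_value _ _ _ _ x HX).
      - apply (D_on_ex_CInt _ _ _ _ _ HD). }
    unfold f1; eapply Rle_trans; [apply Cmod_triangle_minus|]; rewrite Cmod_mult.
    assert (Cmod gamma * Cmod (CInt phi (x0 - r) (x0 + r)) <= Cmod gamma * (PI * kap))
      by (apply Rmult_le_compat_l; auto).
    unfold M; lra. }
  (* the dilated test function is supported in [x0 - r, x0 + r], so f1 subtracts its whole integral *)
  assert (Hdil : forall c d psi eps, c <= d -> D_on c d psi -> 0 < eps -> - r <= eps * c -> eps * d <= r ->
    (dilate_pairing f x0 eps psi - gamma * total_integral psi)%C
    = (RtoC (/ eps) * f1 (fun x => psi (/ eps * (x - x0))%R))%C).
  { intros c d psi eps Hcd HD Heps Hc Hd; unfold dilate_pairing, f1.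
    rewrite (CInt_dilate c d psi x0 eps r Hcd HD Heps Hc Hd).
    replace (fun t => psi ((t - x0) / eps)) with (fun x => psi (/ eps * (x - x0)))
      by (extensionality t; f_equal; unfold Rdiv; ring).
    rewrite RtoC_inv by lra. field. intros E; injection E; lra. }
  assert (Hright : forall c d psi, 0 < c -> D_on c d psi -> forall ep, 0 < ep ->
    exists eta, 0 < eta /\ forall rho, 0 < rho < eta ->
      Cmod (f1 (fun x => psi (/ rho * (x - x0)))) <= ep * rho).
  { intros c d0 psi Hc HD0 ep Hep.
    set (d := Rmax c d0).
    assert (Hcd : c <= d) by apply Rmax_l.
    assert (HD : D_on c d psi) by (apply (D_on_widen c d0); [lra|apply Rmax_r|exact HD0]).
    assert (Hlat := hlat psi (D_on_test c d psi (fun x => 0 < x) HD ltac:(intros; lra))).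
    destruct (proj1 (filterlim_right_iff _ _) Hlat ep Hep) as [eta [Heta Hl]].
    exists (Rmin eta (r / d)); split; [apply Rmin_glb_lt; [lra|apply Rdiv_lt_0_compat; lra]|].
    intros rho [Hr0 Hr1]; pose proof (Rmin_l eta (r / d)); pose proof (Rmin_r eta (r / d)).
    assert (Hrd : rho * d <= r).
    { assert (rho * d <= r / d * d) by (apply Rmult_le_compat_r; lra).
      replace (r / d * d) with r in * by (field; lra). lra. }
    specialize (Hl rho ltac:(lra)).
    rewrite (Hdil c d psi rho Hcd HD Hr0 ltac:(nra) Hrd) in Hl.
    rewrite Cmod_mult, Cmod_R, Rabs_pos_eq in Hl by (left; apply Rinv_0_lt_compat; lra).
    left; apply Rmult_lt_compat_l with (r := rho) in Hl; [|lra].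
    rewrite <- Rmult_assoc, Rinv_r, Rmult_1_l in Hl by lra.
    rewrite Rmult_comm; exact Hl. }
  assert (HLim : forall sig eta, 0 < sig -> 0 < eta -> exists rho0, 0 < rho0 /\
    forall rho p, 0 < rho < rho0 -> Cmod p = 1 -> sig <= snd p ->
    Cmod (F1 (RtoC x0 + rho * p)%C) <= eta).
  { intros sig eta Hs Heta.
    exact (angular_limit_unit a b h x0 r F1 f1 n M hh Hr Ha Hb HF1 Hbv1 Hlin HM Hlog Hright
      sig eta Hs Heta). }
  split.
  - intros phi Hphi; destruct (test_D_on _ _ Hphi) as [A [HA HD]].
    destruct (angular_growth a b h x0 r F1 f1 n M hh Hr Ha Hb HF1 Hbv1 HM Hlog)
      as [G0 [k [rhog [HG0 [Hrhog Hgrow]]]]].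
    apply filterlim_right_iff; intros ep Hep.
    destruct (point_value_zero a b h x0 r F1 f1 hh Hr Ha Hb HF1 Hbv1 G0 rhog k HG0 Hrhog Hgrow HLim
      phi A HA HD (ep / 2) ltac:(lra)) as [eta [Heta Hpv]].
    exists (Rmin eta (r / A)); split; [apply Rmin_glb_lt; [lra|apply Rdiv_lt_0_compat; lra]|].
    intros eps [He0 He1]; pose proof (Rmin_l eta (r / A)); pose proof (Rmin_r eta (r / A)).
    assert (HeA : eps * A <= r).
    { assert (eps * A <= r / A * A) by (apply Rmult_le_compat_r; lra).
      replace (r / A * A) with r in * by (field; lra). lra. }
    rewrite (Hdil (- A) A phi eps ltac:(lra) HD He0 ltac:(lra) HeA).
    specialize (Hpv eps ltac:(lra)).
    rewrite Cmod_mult, Cmod_R, Rabs_pos_eq by (left; apply Rinv_0_lt_compat; lra).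
    apply Rle_lt_trans with (/ eps * (ep / 2 * eps)).
    + apply Rmult_le_compat_l; [left; apply Rinv_0_lt_compat; lra|exact Hpv].
    + replace (/ eps * (ep / 2 * eps)) with (ep / 2) by (field; lra). lra.
  - intros theta Htheta P HP.
    apply locally_Cmod in HP; destruct HP as [ep [Hep HP]].
    assert (Hsin : 0 < sin theta) by (apply sin_gt_0; lra).
    destruct (HLim (sin theta) (ep / 2) Hsin ltac:(lra)) as [rho0 [Hrho0 Hl]].
    apply locally_Cmod; exists rho0; split; [exact Hrho0|].
    intros z Hz [rho [t [Hrho [Ht Ez]]]]; apply HP.
    set (p := (cos t, sin t) : C).
    assert (Hp : Cmod p = 1) by apply unit_circle_mod.
    assert (Ez2 : z = (RtoC x0 + rho * p)%C).
    { rewrite Ez; apply injective_projections; simpl; ring. }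
    assert (Hmod : Cmod (z - RtoC x0) = rho).
    { rewrite Ez2; replace (RtoC x0 + rho * p - RtoC x0)%C with (rho * p)%C by ring.
      rewrite Cmod_mult, Hp, Cmod_R, Rabs_pos_eq; lra. }
    assert (Hst : sin theta <= sin t).
    { destruct (Rle_or_lt t (PI / 2)).
      - apply sin_incr_1; lra.
      - rewrite <- (sin_PI_x t); apply sin_incr_1; lra. }
    rewrite Hmod in Hz.
    specialize (Hl rho p ltac:(lra) Hp Hst); rewrite <- Ez2 in Hl; unfold F1 in Hl.
    lra.
Qed.
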